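(* For any $0<a,\alpha,t,\delta<\infty$ there exist constants $q(a,\alpha,t,\delta)$ and $C=C(a,\alpha,t,\delta)$ such that if $q\ge q(a,\alpha,t,\delta)$ and $G=(V,E)$ is any graph on $n$ vertices satisfying $$\forall v\in V,\ t(v,a\log n)\le t,\qquad m_\alpha(G,a\log n)<\delta\log n,$$ then the mixing time of the Gibbs sampler of $q$-colorings of $G$ is $O(n^{C})$.
   Context: For a graph $G=(V,E)$ with graph distance $d(\cdot,\cdot)$, $v\in V$ and $l\ge0$, let $B(v,l)$ be the subgraph induced on $V(v,l)=\{u:d(u,v)\le l\}$. The tree excess of a graph $H=(V_H,E_H)$ is $t(H)=|E_H|-|V_H|+1$, and $t(v,l)=t(B(v,l))$. A path is self-avoiding if its vertices are distinct. For $\alpha>0$ the maximal path $\alpha$-weight is $$m_\alpha(G,l)=\max_\Gamma\sum_{u\in\Gamma}\ \sum_{v\in V,\,v\ne u}\alpha^{d(u,v)},$$ the maximum being over all self-avoiding paths $\Gamma$ in $G$ of length at most $l$ (with $\alpha^{d(u,v)}=0$ if $u,v$ are in different components). Coloring model: for a set $\mathcal C$ of $q$ colors, the coloring distribution $P$ is the uniform distribution on proper colorings $\sigma\in\mathcal C^V$. Gibbs sampler of $q$-colorings: the discrete time Markov chain on the proper $q$-colorings of $G$ in which, from the current configuration $\sigma$, a vertex $v\in V$ is chosen uniformly at random, $\sigma'(w)=\sigma(w)$ for all $w\ne v$, and $\sigma'(v)$ is chosen uniformly from $\mathcal C\setminus\{\sigma(w): (v,w)\in E\}$. The mixing time is the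 number of steps needed to guarantee that the chain, started from an arbitrary state, is within total variation distance $(2e)^{-1}$ of the stationary distribution. The constant implied in $O(n^C)$ does not depend on $n$ or $G$. *)

(* Defs.v *)
From HB Require Import structures.
From mathcomp Require Import all_boot all_order all_algebra.
From mathcomp Require Import all_classical all_reals all_analysis.

Set Implicit Arguments.
Unset Strict Implicit.
Unset Printing Implicit Defensive.

Import Order.TTheory GRing.Theory Num.Theory.
Local Open Scope ring_scope.

Section Graph.
Context {R : realType} {V : finType}.
Variable e : rel V.

Definition has_walk (u v : V) (k : nat) : bool :=
  [exists p : k.-tuple V, path e u p && (last u p == v)].

Lemma connect_has_walk (u v : V) : connect e u v -> exists k, has_walk u v k.
Proof.
move=> /connectP[p ep ->]; exists (size p); apply/existsP.
by exists (in_tuple p); rewrite ep eqxx.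
Qed.

(** [None] is the infinite distance between different components. *)
Definition gdist (u v : V) : option nat :=
  if @idP (connect e u v) is ReflectT uv
  then Some (ex_minn (connect_has_walk uv)) else None.

Definition ball_vertices (v : V) (l : R) : {set V} :=
  [set u | if gdist u v is Some k then k%:R <= l else false].

(** Edges are unordered pairs of vertices, so each is counted once. *)
Definition graph_edges : {set {set V}} :=
  [set A | [exists u, exists w, e u w && (A == [set u; w])]].

Definition induced_edges (W : {set V}) : {set {set V}} :=
  [set A in graph_edges | A \subset W].

Definition tree_excess (VH : {set V}) (EH : {set {set V}}) : int :=
  #|EH|%:Z - #|VH|%:Z + 1.

Definition ball_tree_excess (v : V) (l : R) : int :=
  tree_excess (ball_vertices v l) (induced_edges (ball_vertices v l)).

Definition dist_weight (alpha : R) (u v : V) : R :=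
  if gdist u v is Some k then alpha ^+ k else 0.

Definition path_weight (alpha : R) (p : seq V) : R :=
  \sum_(u <- p) \sum_(v : V | v != u) dist_weight alpha u v.

(** The length [k] of a path is its number of edges; it has [k.+1] distinct
    vertices, so [k < #|V|].  Path weights are nonnegative when
    [0 <= alpha], so the default value [0] does not change the maximum. *)
Definition max_path_weight (alpha l : R) : R :=
  \big[Num.max/0]_(k < #|V| | k%:R <= l)
    \big[Num.max/0]_(p : k.+1.-tuple V | sorted e p && uniq p)
      path_weight alpha p.

End Graph.

Section MarkovChain.
Context {R : realType} {S : finType}.

(** [step_dist P x k] is the law after [k] steps of the chain with transition
    probabilities [P x y] from [x] to [y], started from [x]. *)
Fixpoint step_dist (P : S -> S -> R) (x : S) (k : nat) (y : S) : R :=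
  if k is k'.+1 then \sum_(z : S) step_dist P x k' z * P z y
  else (x == y)%:R.

Definition tv_distance (mu nu : S -> R) : R :=
  2^-1 * \sum_(x : S) `|mu x - nu x|.

(** The value is [+oo] if no number of steps suffices. *)
Definition mixing_time (P : S -> S -> R) (pi : S -> R) : \bar R :=
  ereal_inf [set (k%:R)%:E | k in [set k : nat | forall x : S,
    tv_distance (step_dist P x k) pi <= (2 * expR 1)^-1]]%classic.

Definition uniform_dist (_ : S) : R := #|S|%:R^-1.

End MarkovChain.

Section Coloring.
Context {R : realType} {V : finType}.
Variables (e : rel V) (q : nat).

Definition is_proper (sigma : {ffun V -> 'I_q}) : bool :=
  [forall v, forall w, e v w ==> (sigma v != sigma w)].

Definition proper_coloring : finType :=
  {sigma : {ffun V -> 'I_q} | is_proper sigma}.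

Definition coloring_dist : proper_coloring -> R := uniform_dist.

Definition available_colors (sigma : {ffun V -> 'I_q}) (v : V) : {set 'I_q} :=
  ~: [set sigma w | w : V & e v w].

Definition update_prob (v : V) (sigma sigma' : {ffun V -> 'I_q}) : R :=
  if [forall w, (w != v) ==> (sigma' w == sigma w)]
     && (sigma' v \in available_colors sigma v)
  then #|available_colors sigma v|%:R^-1 else 0.

Definition gibbs_sampler (sigma sigma' : proper_coloring) : R :=
  \sum_(v : V) #|V|%:R^-1 * update_prob v (val sigma) (val sigma').

End Coloring.

(* Main.v *)
(** Write [E_S f] for the mean of [f] over the proper colorings that agree with
    the current one off [S], and [Var_S] for the corresponding variance. The
    Gibbs sampler is the average of the projections [E_v], so a polynomial
    mixing time follows from a Poincare inequality with polynomial constant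
    [Var_V f <= Gamma * sum_v Var_v f].

    (1) Reveal the vertices one at a time. A disagreement at [x] must travel
    along a self-avoiding path of length about [(a/2) log n] to leave the block
    around [x], and the condition on the path weights makes the total
    probability of these paths at most [n^-5] when [q] is large: a vertex of
    degree at most [d] transmits with probability [O(d/q)], and there are few
    vertices of larger degree on a path. Hence
    [Var_V <= 4 * sum_x Var_(B x)] for blocks [B x]. The block [B x] is the ball
    around [x] together with the clusters of high-degree vertices it meets and
    their neighbours, so that every vertex of [B x] has at most [d] neighbours
    outside.

    (2) Inside a block delete a vertex [r]. The two-block dynamics on [r] and
    [S - r] has a constant [3 / k^2], where [k] bounds below the probability
    that two given colors are avoided by all the neighbours of [r]. Continuing
    in the components of [S - r] produces self-avoiding paths, so the constant
    for the block is the exponential of a maximal path sum.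

    (3) The probability that a vertex avoids two given colors is at least
    [exp (- 2 * Phi)], with [Phi] the sum of [a1 ^ length] over self-avoiding
    paths: most colors are unlikely at the neighbours of the vertex, by
    averaging over the colors. By the bound on the tree excess, [Phi] at [u] is
    at most a constant multiple of [sum_v a1 ^ d(u, v)], and the path sums of
    (2) are [O(log n)]. *)
Require Import Defs.
From HB Require Import structures.
From mathcomp Require Import all_boot all_order all_algebra.
From mathcomp Require Import all_classical all_reals all_analysis.
From mathcomp Require Import fintype finset fingraph ring lra zify.

Set Implicit Arguments.
Unset Strict Implicit.
Unset Printing Implicit Defensive.

Import Order.TTheory GRing.Theory Num.Theory.
Local Open Scope ring_scope.

(** * Conditional means and variances over the classes of an equivalence *)

Section ConditionalMean.
Context {R : realFieldType} {T : finType}.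
Implicit Types (r s : rel T) (f g h : T -> R).

Definition cmean r f x : R := (\sum_(y | r x y) f y) / #|r x|%:R.

(** The sum runs over all points without normalization, so variances for different relations add and
    compare without weights. *)
Definition cvar r f : R := \sum_x (f x - cmean r f x) ^+ 2.

Lemma eq_cmean r f g : f =1 g -> cmean r f =1 cmean r g.
Proof. by move=> fg x; rewrite /cmean (eq_bigr g). Qed.

Lemma eq_cmean_in r f g x : (forall y, r x y -> f y = g y) ->
  cmean r f x = cmean r g x.
Proof. by move=> fg; rewrite /cmean (eq_bigr g). Qed.

Lemma cmeanD r f g x :
  cmean r (fun y => f y + g y) x = cmean r f x + cmean r g x.
Proof. by rewrite /cmean big_split mulrDl. Qed.

Lemma cmeanZ r a f x : cmean r (fun y => a * f y) x = a * cmean r f x.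
Proof. by rewrite /cmean -mulr_sumr mulrA. Qed.

Lemma cmeanB r f g x :
  cmean r (fun y => f y - g y) x = cmean r f x - cmean r g x.
Proof. by rewrite /cmean sumrB mulrBl. Qed.

Section Equivalence.
Variables (r : rel T) (er : equivalence_rel r).

Let rr x : r x x. Proof. by case: (er x x x). Qed.

Let r_left x y : r x y -> r x =1 r y.
Proof. by move=> rxy z; case: (er x y z) => _; apply. Qed.

Let r_sym x y : r x y = r y x.
Proof.
by apply/idP/idP => xy; rewrite -(r_left xy) rr.
Qed.

Lemma class_card_gt0 x : 0 < #|r x|%:R :> R.
Proof. by rewrite ltr0n; apply/card_gt0P; exists x; exact: rr. Qed.

Let card_neq0 x : #|r x|%:R != 0 :> R.
Proof. by rewrite gt_eqF ?class_card_gt0. Qed.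

Lemma cmean_const (c : R) x : cmean r (fun=> c) x = c.
Proof.
by rewrite /cmean sumr_const -(mulr_natr c) mulfK.
Qed.

Lemma cmean_inv f x y : r x y -> cmean r f x = cmean r f y.
Proof.
move=> xy; rewrite /cmean (eq_bigl (r y)) ?(eq_card (r_left xy)) //.
exact: r_left.
Qed.

Lemma cmean_le f g x : (forall y, r x y -> f y <= g y) ->
  cmean r f x <= cmean r g x.
Proof.
by move=> fg; rewrite ler_pM2r ?invr_gt0 ?class_card_gt0 ?ler_sum.
Qed.

Lemma cmean_pull f g x : (forall y, r x y -> f y = f x) ->
  cmean r (fun y => f y * g y) x = f x * cmean r g x.
Proof.
move=> fi; rewrite /cmean mulrA mulr_sumr; congr (_ / _).
by apply: eq_bigr => y /fi ->.
Qed.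

Lemma cmean_id f x : (forall y, r x y -> f y = f x) -> cmean r f x = f x.
Proof.
move=> fi; rewrite -[RHS]mulr1 -[X in _ * X](cmean_const 1 x) -cmean_pull //.
by apply: eq_cmean => y; rewrite mulr1.
Qed.

Section Tower.
Variables (s : rel T) (es : equivalence_rel s) (rs : subrel r s).

Lemma sum_cmean f x : \sum_(y | s x y) cmean r f y = \sum_(y | s x y) f y.
Proof.
rewrite /cmean; under eq_bigr do rewrite mulr_suml.
rewrite (exchange_big_dep (s x)) /=; last first.
  by move=> y z sxy ryz; case: (es x y z) => _ -> //; apply: rs.
apply: eq_bigr => z sxz.
rewrite (eq_bigl (r z)); last first.
  move=> y; rewrite r_sym andbC; case ryz: (r z y) => //=.
  by case: (es x z y) => _ ->//; apply: rs.
rewrite (eq_bigr (fun=> f z / #|r z|%:R)); last first.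
  by move=> y rzy; rewrite (eq_card (r_left rzy)).
by rewrite sumr_const -(mulr_natr (_ / _)) divfK.
Qed.

Lemma cmean_cmean f x : cmean s (cmean r f) x = cmean s f x.
Proof. by rewrite /cmean sum_cmean. Qed.

End Tower.

Lemma sum_cmeanT f : \sum_x cmean r f x = \sum_x f x.
Proof.
case: (pickP (@predT T)) => [x0 _|T0]; last by rewrite !big_pred0.
exact: (@sum_cmean (fun _ _ => true) _ _ f x0).
Qed.

(** [cmean r] is the orthogonal projection onto the functions that are constant on the classes of
    [r]. *)
Lemma cmean_orth f h : (forall x y, r x y -> h y = h x) ->
  \sum_x (f x - cmean r f x) * h x = 0.
Proof.
move=> hi; rewrite -[LHS]sum_cmeanT; apply: big1 => x _.
under eq_cmean do rewrite mulrC.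
rewrite cmean_pull; last exact: hi.
by rewrite cmeanB (@cmean_id (cmean r f)) ?subrr ?mulr0 // => y /cmean_inv ->.
Qed.

Lemma sqr_cmean f : \sum_x f x ^+ 2 = cvar r f + \sum_x cmean r f x ^+ 2.
Proof.
have := @cmean_orth f (cmean r f) _.
rewrite /cvar -big_split /= => o.
rewrite -[RHS]addr0 -[X in _ + X](mul0r (2%:R)) -[X in X * _]o; last first.
  by move=> x y /cmean_inv ->.
by rewrite mulr_suml -big_split /=; apply: eq_bigr => x _; ring.
Qed.

Lemma cvar_ge0 f : 0 <= cvar r f.
Proof. by apply: sumr_ge0 => x _; rewrite sqr_ge0. Qed.

Lemma cvar_le_sqr f : cvar r f <= \sum_x f x ^+ 2.
Proof. by rewrite sqr_cmean lerDl sumr_ge0 // => x _; rewrite sqr_ge0. Qed.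

Lemma sqr_cmean_le f : \sum_x cmean r f x ^+ 2 <= \sum_x f x ^+ 2.
Proof. by rewrite [leRHS]sqr_cmean lerDr cvar_ge0. Qed.

(** The law of total variance for [r] finer than [s]: [f - cmean r f] is orthogonal to everything
    constant on the classes of [r], in particular to [cmean r f - cmean s f]. *)
Lemma cvar_split s f : equivalence_rel s -> subrel r s ->
  cvar s f = cvar r f + cvar s (cmean r f).
Proof.
move=> es rs.
have si x y : s x y -> cmean s f y = cmean s f x.
  move=> sxy; rewrite /cmean; case: (es x y y) => _ /(_ sxy) _.
  have E z : s x z = s y z by case: (es x y z) => _ ->.
  by rewrite (eq_bigl (s x)) // (eq_card (B := s x)) // => z; exact/esym/E.
have := @cmean_orth f (fun x => cmean r f x - cmean s f x) _.
rewrite /cvar -big_split /= => o.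
rewrite -[RHS]addr0 -[X in _ + X](mul0r (2%:R)) -[X in X * _]o; last first.
  by move=> x y rxy; rewrite (cmean_inv f rxy) (si x y (rs _ _ rxy)).
rewrite mulr_suml -big_split /=; apply: eq_bigr => x _.
rewrite cmean_cmean //; ring.
Qed.

Lemma cvarD f g : cvar r (fun x => f x + g x) <= 2 * cvar r f + 2 * cvar r g.
Proof.
rewrite /cvar !mulr_sumr -big_split /=; apply: ler_sum => x _.
rewrite cmeanD -subr_ge0.
set a := f x; set b := g x; set c := cmean r f x; set d := cmean r g x.
rewrite (_ : _ - _ = ((a - c) - (b - d)) ^+ 2) ?sqr_ge0 //; ring.
Qed.

(** A variance is half the mean squared difference of two independent samples from one class. *)
Lemma cvar_pairs f :
  cvar r f = \sum_x cmean r (fun y => (f x - f y) ^+ 2) x / 2.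
Proof.
rewrite -[LHS]sum_cmeanT -[RHS]sum_cmeanT; apply: eq_bigr => x _.
set m := cmean r f x.
have mi y : r x y -> cmean r f y = m by move=> /cmean_inv <-.
pose q := cmean r (fun y => f y ^+ 2) x.
have qi y : r x y -> cmean r (fun y => f y ^+ 2) y = q by move=> /cmean_inv <-.
transitivity (cmean r (fun y => f y ^+ 2 + ((- 2 * m) * f y + m ^+ 2)) x).
  apply: eq_cmean_in => y rxy.
  by rewrite mi //; ring.
rewrite 2!cmeanD cmeanZ cmean_const -/m -/q.
transitivity (cmean r (fun y => 2^-1 * f y ^+ 2 + (- m * f y + 2^-1 * q)) x);
  last first.
  apply: eq_cmean_in => y rxy.
  transitivity (cmean r (fun z => (f z ^+ 2 + ((- 2 * f y) * f z + f y ^+ 2))) y / 2);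
    last by congr (_ / _); apply: eq_cmean => z; ring.
  by rewrite 2!cmeanD cmeanZ cmean_const qi // mi //; field.
by rewrite 2!cmeanD 2!cmeanZ cmean_const -/m -/q; field.
Qed.

(** Since [f] has mean zero on every class, its second moment is a variance, and [cvar_pairs]
    reduces it to the bound on pairs; the half there cancels the two terms in [g]. *)
Lemma sqr_le_cmean f g c : 0 <= c ->
  (forall x y, r x y -> (f x - f y) ^+ 2 <= c * (g x + g y)) ->
  (forall x, cmean r f x = 0) ->
  \sum_x f x ^+ 2 <= c * \sum_x g x.
Proof.
move=> c0 fg f0.
have -> : \sum_x f x ^+ 2 = cvar r f.
  by apply: eq_bigr => x _; rewrite f0 subr0.
have : cvar r f <= \sum_x c / 2 * (g x + cmean r g x).
  rewrite cvar_pairs; apply: ler_sum => x _.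
  have : cmean r (fun y => (f x - f y) ^+ 2) x <= c * (g x + cmean r g x).
    rewrite -[X in X + cmean _ _ _](cmean_const (g x) x) -cmeanD -cmeanZ.
    exact/cmean_le/fg.
  lra.
move=> /le_trans; apply; rewrite -mulr_sumr big_split /= sum_cmeanT; lra.
Qed.

End Equivalence.

End ConditionalMean.

(** * Connected vertex sets and tree excess *)

Section Connected.
Context {V : finType}.
Variable e : rel V.
Hypotheses (e_sym : symmetric e) (e_irr : irreflexive e).
Implicit Types (S B C D : {set V}) (u v w x : V).

Definition edge_in S : rel V := [rel u w | [&& u \in S, w \in S & e u w]].

Definition connected_set S := {in S &, forall u w, connect (edge_in S) u w}.

Definition nbhd v S := [set w in S | e v w].

(** The component of [v] in the subgraph induced on [S]; for [v] outside [S] it is just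
    [[set v]]. *)
Definition conn_class S v := [set u | connect (edge_in S) v u].

Definition n_edges S := #|induced_edges e S|.

Lemma in_nbhd v S w : (w \in nbhd v S) = (w \in S) && e v w.
Proof. by rewrite inE. Qed.

Lemma edge_in_connect_sym S : connect_sym (edge_in S).
Proof. by apply: sym_connect_sym => u w; rewrite /edge_in /= e_sym andbCA. Qed.

Lemma edge_in_sub C S : C \subset S -> subrel (edge_in C) (edge_in S).
Proof. by move=> /subsetP CS u w /and3P[/CS uS /CS wS uw]; apply/and3P. Qed.

Lemma connect_edge_in_sub C S : C \subset S ->
  subrel (connect (edge_in C)) (connect (edge_in S)).
Proof.
move=> CS; apply: connect_sub => u w uw; apply: connect1.
exact: edge_in_sub uw.
Qed.

Lemma conn_class_refl S v : v \in conn_class S v.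
Proof. by rewrite inE connect0. Qed.

Lemma conn_class_sub S v : v \in S -> conn_class S v \subset S.
Proof.
move=> vS; apply/subsetP => u; rewrite inE => /connectP[p].
elim: p v vS => [|w p IH] v vS /=; first by move=> _ ->.
by move=> /andP[/and3P[_ wS _]]; apply: IH.
Qed.

Lemma conn_class_closed S v u w : v \in S ->
  u \in conn_class S v -> w \in S -> e u w -> w \in conn_class S v.
Proof.
move=> vS uC wS uw; have uS := subsetP (conn_class_sub vS) _ uC.
move: uC; rewrite !inE => /connect_trans; apply; apply: connect1.
by apply/and3P.
Qed.

Lemma conn_class_connected S v : v \in S -> connected_set (conn_class S v).
Proof.
move=> vS; suff vu u : u \in conn_class S v -> connect (edge_in (conn_class S v)) v u.
  move=> u w uC wC; apply: connect_trans (vu w wC).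
  by rewrite edge_in_connect_sym vu.
suff H p z : z \in conn_class S v -> path (edge_in S) z p ->
    connect (edge_in (conn_class S v)) z (last z p).
  by rewrite inE => /connectP[p pp ->]; apply: H; rewrite ?conn_class_refl.
elim: p z => [|w p IH] z zC /=; first by rewrite connect0.
move=> /andP[/and3P[_ wS zw] pw]; have wC := conn_class_closed vS zC wS zw.
by apply: connect_trans (IH _ wC pw); apply: connect1; apply/and3P.
Qed.

Lemma conn_class_eq S v u : u \in conn_class S v -> conn_class S u = conn_class S v.
Proof.
rewrite inE => vu; apply/setP => w; rewrite !inE.
by rewrite (same_connect (@edge_in_connect_sym S) vu).
Qed.

Lemma sub_conn_class C S v :
  connected_set C -> C \subset S -> v \in C -> C \subset conn_class S v.
Proof.
move=> cC CS vC; apply/subsetP => u uC; rewrite inE.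
exact/(connect_edge_in_sub CS)/cC.
Qed.

Lemma connected_set1 v : connected_set [set v].
Proof. by move=> u w /set1P -> /set1P ->; rewrite connect0. Qed.

Lemma connected_setU1 C c v : connected_set C -> c \in C -> e c v ->
  connected_set (v |: C).
Proof.
move=> cC cC' cv; suff cu u : u \in v |: C -> connect (edge_in (v |: C)) c u.
  by move=> u w /cu; rewrite edge_in_connect_sym => uc /cu; apply: connect_trans.
move=> /setU1P[->|uC]; last first.
  exact: (connect_edge_in_sub (subsetUr _ _)) (cC _ _ cC' uC).
by apply: connect1; rewrite /edge_in /= !inE eqxx cC' cv orbT.
Qed.

Lemma connected_boundary C B : connected_set B -> C \subset B -> C != set0 ->
  C != B -> exists b c, [/\ b \in B, b \notin C, c \in C & e c b].
Proof.
move=> cB CB /set0Pn[c0 c0C] CnB.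
have /subsetPn[b0 b0B b0C] : ~~ (B \subset C).
  by apply: contra CnB => BC; rewrite eqEsubset CB.
have /connectP[p] := cB _ _ (subsetP CB _ c0C) b0B.
elim: p c0 c0C => [|w p IH] c cC /=.
  by move=> _ E; rewrite E cC in b0C.
move=> /andP[/and3P[_ wB cw]] pw lw.
have [wC|wC] := boolP (w \in C); first exact: IH wC pw lw.
by exists w, c.
Qed.

Lemma n_edges_setU1 v C : v \notin C ->
  n_edges (v |: C) = (n_edges C + #|nbhd v C|)%N.
Proof.
move=> vC; rewrite /n_edges.
have -> : induced_edges e (v |: C) =
    induced_edges e C :|: [set [set v; w] | w in nbhd v C].
  apply/setP => A; rewrite !inE; apply/andP/orP.
    case=> /[dup] Ae /existsP[u /existsP[w /andP[uw /eqP EA]]] /subsetP AS.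
    have uA : u \in A by rewrite EA !inE eqxx.
    have wA : w \in A by rewrite EA !inE eqxx orbT.
    have /setU1P[uv|uC] := AS u uA; have /setU1P[wv|wC] := AS w wA.
    - by move: uw; rewrite uv wv e_irr.
    - by right; apply/imsetP; exists w; rewrite ?EA ?uv // inE wC -uv.
    - right; apply/imsetP; exists u; first by rewrite inE uC -wv e_sym.
      by rewrite EA wv setUC.
    - left; rewrite Ae EA; apply/subsetP => z /set2P[]-> //.
  case=> [/andP[-> /subset_trans->]|/imsetP[w]] //; first exact: subsetUr.
  rewrite inE => /andP[wC vw] ->; split.
    by apply/existsP; exists v; apply/existsP; exists w; rewrite vw eqxx.
  by apply/subsetP => z /set2P[]->; rewrite !inE ?eqxx ?wC ?orbT.
rewrite cardsU disjoint_setI0 ?cards0 ?subn0; last first.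
  apply/pred0P => A /=; apply/negP => /andP[].
  rewrite inE => /andP[_ /subsetP AC] /imsetP[w _ EA].
  by move/negP: vC; apply; apply: AC; rewrite EA !inE eqxx.
congr (_ + _)%N; apply: card_in_imset => w w'.
rewrite !inE => /andP[wC _] /andP[w'C _] E.
have : w \in [set v; w'] by rewrite -E !inE eqxx orbT.
by case/set2P => // wv; rewrite -wv wC in vC.
Qed.

(** Tree excess is monotone on connected sets, stated without subtraction: growing [C] to [B] by one
    boundary vertex at a time adds at least one edge with each vertex. *)
Lemma n_edges_mono C B : connected_set B -> connected_set C -> C \subset B ->
  C != set0 -> (n_edges C + #|B| <= n_edges B + #|C|)%N.
Proof.
move=> cB; have [n] := ubnP (#|B| - #|C|); elim: n C => // n IH C lt cC CB C0.
have [->//|CnB] := eqVneq C B.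
have [b [c [bB bC c_C cb]]] := connected_boundary cB CB C0 CnB.
have bCB : b |: C \subset B by rewrite subUset sub1set bB.
have := IH _ _ (connected_setU1 cC c_C cb) bCB _.
have := subset_leq_card bCB; rewrite cardsU1 bC n_edges_setU1 //= => le.
have : (0 < #|nbhd b C|)%N.
  by apply/card_gt0P; exists c; rewrite inE c_C e_sym.
have b0 : b |: C != set0 by apply/set0Pn; exists b; rewrite setU11.
move=> d0 /(_ _ b0); lia.
Qed.

Lemma n_edges_connected C : connected_set C -> C != set0 ->
  (#|C| <= n_edges C + 1)%N.
Proof.
move=> cC /set0Pn[c cC'].
have := n_edges_mono cC (@connected_set1 c).
rewrite sub1set cC' cards1 => /(_ isT).
have -> : [set c] != set0 by apply/set0Pn; exists c; rewrite inE.
by move=> /(_ isT); lia.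
Qed.

(** Quantifying over connected subsets makes the bound pass to every subset of [B], connected or
    not. *)
Definition excess_le B (s : nat) := forall C, C \subset B ->
  connected_set C -> C != set0 -> (n_edges C + 1 <= #|C| + s)%N.

Lemma excess_le_sub B B' s : B \subset B' -> excess_le B' s -> excess_le B s.
Proof. by move=> BB ex C CB; apply: ex; apply: subset_trans BB. Qed.

Lemma excess_le_connected B s : connected_set B ->
  (n_edges B + 1 <= #|B| + s)%N -> excess_le B s.
Proof.
move=> cB ex C CB cC C0; have := n_edges_mono cB cC CB C0; lia.
Qed.

(** Attaching [v] by [k] edges to a connected set raises the excess by [k - 1], and the excess is at
    most [s]. *)
Lemma nbhd_excess B s C v : excess_le B s -> v |: C \subset B -> v \notin C ->
  connected_set C -> connected_set (v |: C) -> C != set0 ->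
  (#|nbhd v C| <= s.+1)%N.
Proof.
move=> ex vCB vC cC cvC C0.
have := n_edges_connected cC C0.
have v0 : v |: C != set0 by apply/set0Pn; exists v; rewrite setU11.
have := ex _ vCB cvC v0; rewrite n_edges_setU1 // cardsU1 vC /=; lia.
Qed.

End Connected.

(** * Distances and weighted sums over self-avoiding paths *)

Section Distance.
Context {V : finType}.
Variable e : rel V.

Lemma has_walkP (u v : V) k :
  reflect (exists p, [/\ size p = k, path e u p & last u p = v]) (has_walk e u v k).
Proof.
apply: (iffP existsP) => [[p /andP[ep /eqP lp]]|[p [sp ep lp]]].
  by exists p; rewrite size_tuple.
have sp' : size p == k by apply/eqP.
by exists (Tuple sp'); rewrite /= ep lp eqxx.
Qed.

Lemma has_walk0 u : has_walk e u u 0.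
Proof. by apply/has_walkP; exists [::]. Qed.

Lemma has_walk_cons u w v k : e u w -> has_walk e w v k -> has_walk e u v k.+1.
Proof.
move=> uw /has_walkP[p [sp ep lp]]; apply/has_walkP; exists (w :: p).
by rewrite /= sp uw ep lp.
Qed.

Lemma has_walk_cat u w v j k : has_walk e u w j -> has_walk e w v k ->
  has_walk e u v (j + k).
Proof.
move=> /has_walkP[p [<- ep lp]] /has_walkP[p' [<- ep' lp']].
by apply/has_walkP; exists (p ++ p'); rewrite size_cat cat_path last_cat lp ep.
Qed.

Lemma has_walk1 u w : e u w -> has_walk e u w 1.
Proof. by move=> uw; apply: has_walk_cons uw (has_walk0 _). Qed.

Lemma gdist_some u v k : gdist e u v = Some k ->
  has_walk e u v k /\ forall j, has_walk e u v j -> (k <= j)%N.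
Proof.
rewrite /gdist; case: {-}_ / idP => // uv [<-].
by case: ex_minnP => m hm mm; split.
Qed.

Lemma walk_gdist u v k : has_walk e u v k ->
  exists2 j, gdist e u v = Some j & (j <= k)%N.
Proof.
move=> uvk; have : connect e u v.
  by have /has_walkP[p [_ ep <-]] := uvk; apply/connectP; exists p.
rewrite /gdist; case: {-}_ / idP => // uv _.
by case: ex_minnP => m hm mm; exists m => //; apply: mm.
Qed.

Lemma gdist_refl u : gdist e u u = Some 0.
Proof. by have [[|j] ->] := walk_gdist (has_walk0 u). Qed.

Context {R : realType}.
Variable (a : R).
Hypotheses (a0 : 0 <= a) (a1 : a <= 1).

Lemma dist_weight_ge0 u v : 0 <= dist_weight e a u v.
Proof. by rewrite /dist_weight; case: gdist => // k; rewrite exprn_ge0. Qed.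

Lemma dist_weight_refl u : dist_weight e a u u = 1.
Proof. by rewrite /dist_weight gdist_refl. Qed.

Lemma dist_weight_edge u v w : e u v ->
  a * dist_weight e a v w <= dist_weight e a u w.
Proof.
move=> uv; rewrite {1}/dist_weight; case E : gdist => [k|]; last first.
  by rewrite mulr0 dist_weight_ge0.
have [vw _] := gdist_some E.
have [j uj jk] := walk_gdist (has_walk_cons uv vw).
by rewrite /dist_weight uj -exprS ler_wiXn2l.
Qed.

End Distance.

Lemma dist_weight_mono (R : realType) (V : finType) (e : rel V) (a b : R) u v :
  0 <= a -> a <= b -> dist_weight e a u v <= dist_weight e b u v.
Proof.
move=> a0 ab; rewrite /dist_weight; case: gdist => // k.
by rewrite lerXn2r // nnegrE (le_trans a0).
Qed.

Section SelfAvoidingSums.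
Context {R : realType} {V : finType}.
Variables (e : rel V) (a : R).
Hypotheses (e_sym : symmetric e) (e_irr : irreflexive e).
Hypotheses (a0 : 0 <= a) (a1 : a <= 1).

(** The sum of [a ^+ k] over the self-avoiding paths in [S] from [v] to [w],
    where [k] is the number of edges and [n] bounds the recursion depth. *)
Fixpoint saw_sum (n : nat) (S : {set V}) (v w : V) : R :=
  (v == w)%:R +
  if n is n'.+1 then a * \sum_(u in nbhd e v (S :\ v)) saw_sum n' (S :\ v) u w
  else 0.

Lemma saw_sum_ge0 n S v w : 0 <= saw_sum n S v w.
Proof.
elim: n S v => [|n IH] S v /=; rewrite addr_ge0 ?ler0n //.
by rewrite mulr_ge0 // sumr_ge0.
Qed.

(** The truncated subtraction is harmless for nonempty connected sets, by [n_edges_connected]. *)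
Let excess (C : {set V}) := (n_edges e C + 1 - #|C|)%N.

(** Several self-avoiding paths from [v] to [w] exist only because of cycles. If [k] neighbours of
    [v] still lead to [w] once [v] is deleted, the deletion lowers the excess by at least [k - 1],
    and [k <= 2 ^ k.-1]; so a factor two per unit of excess covers all choices. *)
Lemma saw_sum_conn_class n (S : {set V}) v w : v \in S ->
  (w \notin conn_class e S v -> saw_sum n S v w = 0) /\
  (w \in conn_class e S v ->
   saw_sum n S v w <= 2 ^+ excess (conn_class e S v) * dist_weight e a v w).
Proof.
elim: n S v => [|n IH] S v vS.
  split=> /= [wC|_].
    by rewrite addr0; case: eqP => // E; rewrite -E conn_class_refl in wC.
  case: eqP => [->|_]; rewrite addr0.
    by rewrite dist_weight_refl mulr1 -natrX ler1n expn_gt0.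
  by rewrite mulr_ge0 ?dist_weight_ge0 // exprn_ge0.
have sub_comp u : u \in nbhd e v (S :\ v) ->
    conn_class e (S :\ v) u \subset conn_class e S v.
  rewrite in_nbhd => /andP[uS vu].
  have uSv : u \in S by move: uS; rewrite inE => /andP[].
  have uC : u \in conn_class e S v.
    exact: (conn_class_closed vS (conn_class_refl _ _ _) uSv vu).
  rewrite -(conn_class_eq e_sym uC).
  apply: sub_conn_class.
  - exact: conn_class_connected.
  - by apply: subset_trans (subsetDl S [set v]); apply: conn_class_sub.
  - exact: conn_class_refl.
have vnC u : u \in nbhd e v (S :\ v) -> v \notin conn_class e (S :\ v) u.
  rewrite in_nbhd => /andP[uS _].
  by apply/negP => /(subsetP (conn_class_sub e uS)); rewrite !inE eqxx.
have nS u : u \in nbhd e v (S :\ v) -> u \in S :\ v by rewrite in_nbhd => /andP[].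
split=> [wC|wC] /=.
  have /negbTE-> : v != w by apply: contra wC => /eqP <-; apply: conn_class_refl.
  rewrite add0r big1 ?mulr0 // => u uN.
  have [-> //] := IH _ _ (nS u uN).
  by apply: contra wC; apply: (subsetP (sub_comp u uN)).
case: eqP => [vw|/eqP vw].
  rewrite big1 ?mulr0 ?addr0 => [|u uN].
    by rewrite vw dist_weight_refl mulr1 -natrX ler1n expn_gt0.
  by have [->] := IH _ _ (nS u uN); rewrite // -vw vnC.
rewrite add0r mulr_sumr.
set Cw := conn_class e (S :\ v) w.
have inw u : u \in nbhd e v (S :\ v) ->
    (w \in conn_class e (S :\ v) u) = (u \in Cw).
  by move=> uN; rewrite !inE edge_in_connect_sym.
have wSv : w \in S :\ v.
  by rewrite !inE eq_sym vw; apply: (subsetP (conn_class_sub e vS)).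
have CwS : Cw \subset S :\ v by apply: conn_class_sub.
have Cw_conn : connected_set e Cw by apply: conn_class_connected.
have Cw0 : Cw != set0 by apply/set0Pn; exists w; apply: conn_class_refl.
have vCw : v \notin Cw by apply/negP => /(subsetP CwS); rewrite !inE eqxx.
rewrite (bigID (mem Cw)) /= [X in _ + X]big1 ?addr0; last first.
  by move=> u /andP[uN uC]; have [->] := IH _ _ (nS u uN); rewrite ?mulr0 ?inw.
rewrite (eq_bigl (mem (nbhd e v Cw))); last first.
  move=> u; rewrite /= !in_nbhd andbC.
  by case uC : (u \in Cw) => //=; rewrite (subsetP CwS).
have [N0|[u0 u0N]] := set_0Vmem (nbhd e v Cw).
  by rewrite N0 big_set0 mulr_ge0 ?dist_weight_ge0 // exprn_ge0.
have vCw_conn : connected_set e (v |: Cw).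
  move: u0N; rewrite in_nbhd => /andP[u0C vu0].
  by apply: (connected_setU1 e_sym Cw_conn u0C); rewrite e_sym.
have vCw_sub : v |: Cw \subset conn_class e S v.
  apply: sub_conn_class => //; last exact: setU11.
  by rewrite subUset sub1set vS (subset_trans CwS) // subsetDl.
have step u : u \in nbhd e v Cw ->
    a * saw_sum n (S :\ v) u w <= 2 ^+ excess Cw * dist_weight e a v w.
  rewrite in_nbhd => /andP[uC vu].
  have uN : u \in nbhd e v (S :\ v) by rewrite in_nbhd (subsetP CwS).
  have [_] := IH _ _ (nS u uN); rewrite inw // (conn_class_eq e_sym uC) => /(_ uC) le.
  apply: (le_trans (ler_wpM2l a0 le)); rewrite mulrCA ler_wpM2l ?exprn_ge0 //.
  exact: dist_weight_edge.
apply: (le_trans (ler_sum _ step)).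
rewrite sumr_const -[leLHS]mulr_natl mulrA ler_wpM2r ?dist_weight_ge0 //.
have k0 : (0 < #|nbhd e v Cw|)%N by apply/card_gt0P; exists u0.
(* All but one of the edges from [v] to [Cw] count toward the excess of [v |: Cw], hence of the
   component of [v] in [S]. *)
have : (excess Cw + #|nbhd e v Cw| <= (excess (conn_class e S v)).+1)%N.
  have vC0 : v |: Cw != set0 by apply/set0Pn; exists v; rewrite setU11.
  have := n_edges_mono e_sym e_irr (conn_class_connected e_sym vS) vCw_conn vCw_sub vC0.
  have := n_edges_connected e_sym e_irr Cw_conn Cw0.
  have := n_edges_connected e_sym e_irr vCw_conn vC0.
  rewrite (n_edges_setU1 e_sym e_irr vCw) cardsU1 vCw /excess /=; lia.
move: (#|nbhd e v Cw|) k0 => k k0 le.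
have kle : (k <= 2 ^ k.-1)%N by case: k k0 {le} => // k _; rewrite ltn_expl.
rewrite -!natrX -natrM ler_nat.
apply: (@leq_trans (2 ^ k.-1 * 2 ^ excess Cw)); first by rewrite leq_mul2r kle orbT.
by rewrite -expnD leq_exp2l //; lia.
Qed.

Lemma saw_sum_le n (S : {set V}) v w (s : nat) : v \in S ->
  excess_le e S s -> saw_sum n S v w <= 2 ^+ s * dist_weight e a v w.
Proof.
move=> vS exS; have [sum0 suml] := saw_sum_conn_class n w vS.
have [wC|wC] := boolP (w \in conn_class e S v); last first.
  by rewrite sum0 // mulr_ge0 ?dist_weight_ge0 // exprn_ge0.
apply: (le_trans (suml wC)); rewrite ler_wpM2r ?dist_weight_ge0 //.
rewrite ler_eXn2l ?ltr1n // /excess.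
have := exS _ (conn_class_sub e vS) (conn_class_connected e_sym vS) _.
have -> : conn_class e S v != set0 by apply/set0Pn; exists w.
by move=> /(_ isT); lia.
Qed.

Definition saw_total n S v := \sum_w saw_sum n S v w.

Lemma saw_total_rec n S v : saw_total n.+1 S v =
  1 + a * \sum_(u in nbhd e v (S :\ v)) saw_total n (S :\ v) u.
Proof.
rewrite /saw_total big_split /=; congr (_ + _).
  rewrite (bigD1 v) //= eqxx big1 ?addr0 // => w /negbTE.
  by rewrite eq_sym => ->.
by rewrite -mulr_sumr exchange_big.
Qed.

Lemma saw_total_ge0 n S v : 0 <= saw_total n S v.
Proof. by apply: sumr_ge0 => w _; apply: saw_sum_ge0. Qed.

Lemma saw_total_nbhd n (S : {set V}) v (s : nat) : v \in S ->
  excess_le e S s ->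
  a * \sum_(u in nbhd e v (S :\ v)) saw_total n (S :\ v) u <=
  2 ^+ s * \sum_(w | w != v) dist_weight e a v w.
Proof.
move=> vS exS; rewrite mulr_sumr.
rewrite /saw_total; under eq_bigr do rewrite mulr_sumr.
rewrite exchange_big (bigD1 v) //= big1 ?add0r; last first.
  move=> u; rewrite in_nbhd => /andP[uS _].
  have [sum0 _] := saw_sum_conn_class n v uS; rewrite sum0 ?mulr0 //.
  by apply/negP => /(subsetP (conn_class_sub e uS)); rewrite !inE eqxx.
rewrite mulr_sumr; apply: ler_sum => w wv.
have := saw_sum_le n.+1 w vS exS.
by rewrite /= eq_sym (negbTE wv) add0r mulr_sumr.
Qed.

End SelfAvoidingSums.

(** * List colorings *)

Section ListColorings.
Context {V : finType} {q : nat}.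
Variable e : rel V.
Hypotheses (e_sym : symmetric e) (e_irr : irreflexive e).
Implicit Types (S T U C : {set V}) (L : V -> {set 'I_q}) (s : {ffun V -> 'I_q}).

(** Vertices outside [S] are constrained by their lists only; a singleton list
    pins the color. *)
Definition list_colorings S L : {set {ffun V -> 'I_q}} :=
  [set s : {ffun V -> 'I_q} | [forall v, s v \in L v] &&
    [forall u in S, forall w in S, e u w ==> (s u != s w)]].

(** Taken with [c = c'], it removes a single color. *)
Definition remove_colors T (c c' : 'I_q) L v :=
  if v \in T then L v :\ c :\ c' else L v.

Definition fix_color v0 (c : 'I_q) L v := if v == v0 then [set c] else L v.

Definition recolor s v0 (c : 'I_q) : {ffun V -> 'I_q} :=
  [ffun v => if v == v0 then c else s v].

Lemma in_list_coloringsP S L s : reflect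
  ((forall v, s v \in L v) /\
   (forall u w, u \in S -> w \in S -> e u w -> s u != s w))
  (s \in list_colorings S L).
Proof.
rewrite inE; apply: (iffP andP) => [[/forallP sL /'forall_in_forall_inP sS]|[sL sS]].
  by split=> // u w uS wS; apply/implyP/sS.
split; first exact/forallP.
by apply/'forall_in_forall_inP => u uS w wS; apply/implyP/sS.
Qed.

Lemma sub_list_colorings S L L' : (forall v, L v \subset L' v) ->
  list_colorings S L \subset list_colorings S L'.
Proof.
move=> LL; apply/subsetP => s /in_list_coloringsP[sL sS].
by apply/in_list_coloringsP; split=> // v; apply: (subsetP (LL v)).
Qed.

Lemma eq_list_colorings S L L' : L =1 L' -> list_colorings S L = list_colorings S L'.
Proof.
move=> LL; apply/eqP; rewrite eqEsubset.
by rewrite !sub_list_colorings // => v; rewrite LL.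
Qed.

Lemma remove_colors_sub T c c' L v : remove_colors T c c' L v \subset L v.
Proof.
rewrite /remove_colors; case: ifP => // _.
exact: subset_trans (subsetDl _ _) (subsetDl _ _).
Qed.

Lemma list_colorings_removeU S T c c' L w :
  list_colorings S (remove_colors (w |: T) c c' L) =
  [set s in list_colorings S (remove_colors T c c' L) | (s w != c) && (s w != c')].
Proof.
apply/setP => s; rewrite [RHS]inE; apply/in_list_coloringsP/andP.
  move=> [sL sS]; split.
    apply/in_list_coloringsP; split=> // v; have := sL v.
    rewrite /remove_colors !inE; case: (v \in T); first by rewrite orbT.
    by case: eqP => //= _; rewrite !inE => /and3P[].
  by have := sL w; rewrite /remove_colors setU11 !inE => /and3P[-> ->].
move=> [/in_list_coloringsP[sL sS] sw]; split=> // v; have := sL v.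
rewrite /remove_colors !inE; case: (v \in T); first by rewrite orbT.
by case: eqP => [->|] //=; rewrite !inE andbA [(_ != c') && _]andbC sw.
Qed.

(** Pinning [v] to [c] deletes [v] from the graph at the price of removing [c] from the lists of its
    neighbours. *)
Lemma list_colorings_fix v S c L : v \in S -> c \in L v ->
  [set s in list_colorings S L | s v == c] =
  list_colorings (S :\ v)
    (fix_color v c (remove_colors (nbhd e v (S :\ v)) c c L)).
Proof.
move=> vS cL; apply/setP => s; rewrite [LHS]inE; apply/andP/in_list_coloringsP.
  move=> [/in_list_coloringsP[sL sS] /eqP sv]; split; last first.
    by move=> u w /setD1P[_ uS] /setD1P[_ wS]; apply: sS.
  move=> u; rewrite /fix_color /remove_colors.
  case: eqP => [->|uv]; first by rewrite sv inE.
  case: ifP => [|_]; last exact: sL.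
  rewrite in_nbhd => /andP[/setD1P[_ uS] vu].
  by rewrite !inE sL -sv eq_sym sS.
move=> [sL sS]; have sv : s v = c by have := sL v; rewrite /fix_color eqxx inE => /eqP.
have sL' u : s u \in L u.
  have := sL u; rewrite /fix_color; case: eqP => [->|_]; first by rewrite sv.
  exact: (subsetP (remove_colors_sub _ _ _ _ _)).
have vw w : w \in S -> e v w -> s w != s v.
  move=> wS vw; have wv : w != v by apply: contraTneq vw => ->; rewrite e_irr.
  have := sL w; rewrite /fix_color (negbTE wv) /remove_colors in_nbhd.
  by rewrite !inE wv wS vw /= !inE sv => /andP[].
split; last exact/eqP.
apply/in_list_coloringsP; split=> // u w uS wS uw.
have [uv|uv] := eqVneq u v; first by rewrite uv eq_sym vw // -uv.
have [wv|wv] := eqVneq w v; first by rewrite wv vw // -wv e_sym.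
by apply: sS => //; rewrite !inE ?uv ?wv.
Qed.

Lemma recolor_list_colorings v S c c' L s : v \notin S ->
  s \in list_colorings S (fix_color v c L) ->
  recolor s v c' \in list_colorings S (fix_color v c' L).
Proof.
move=> vS /in_list_coloringsP[sL sS]; apply/in_list_coloringsP; split=> [u|u w uS wS uw].
  by have := sL u; rewrite /fix_color ffunE; case: eqP => // _ _; rewrite inE.
have uv : u != v by apply: contraNneq vS => <-.
have wv : w != v by apply: contraNneq vS => <-.
by rewrite !ffunE (negbTE uv) (negbTE wv) sS.
Qed.

Lemma card_list_colorings_fix v S c c' L : v \notin S ->
  #|list_colorings S (fix_color v c L)| = #|list_colorings S (fix_color v c' L)|.
Proof.
move=> vS; wlog suff H : c c' /
    (#|list_colorings S (fix_color v c L)| <=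
     #|list_colorings S (fix_color v c' L)|)%N.
  by apply/eqP; rewrite eqn_leq !H.
rewrite -(@card_in_imset _ _ (fun s => recolor s v c')).
  apply/subset_leq_card/subsetP => _ /imsetP[s sl ->].
  exact: recolor_list_colorings sl.
move=> s t /in_list_coloringsP[/(_ v) sv _] /in_list_coloringsP[/(_ v) tv _].
move=> /ffunP E; apply/ffunP => u; have := E u; rewrite !ffunE.
by case: eqP => // -> _; move: sv tv; rewrite /fix_color eqxx !inE => /eqP-> /eqP->.
Qed.

(** Independence of the colors in [C] and in [S :\: C], in product form: the
    injection exchanges the restrictions to [C] of two colorings. *)
Lemma list_colorings_swap C S T U y L :
  (forall u w, u \in S -> w \in S -> e u w -> (u \in C) = (w \in C)) ->
  [disjoint T & C] -> U \subset C ->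
  (#|list_colorings S (remove_colors T y y L)| *
   #|list_colorings S (remove_colors U y y L)| <=
   #|list_colorings S (remove_colors (T :|: U) y y L)| *
   #|list_colorings S L|)%N.
Proof.
move=> CS TC UC; rewrite -!cardsX.
pose mix (s t : {ffun V -> 'I_q}) : {ffun V -> 'I_q} :=
  [ffun v => if v \in C then t v else s v].
rewrite -(@card_imset _ _ (fun p : {ffun V -> 'I_q} * {ffun V -> 'I_q} =>
    (mix p.1 p.2, mix p.2 p.1))).
  apply/subset_leq_card/subsetP => _ /imsetP[[s t] /setXP[/= sl tl] ->].
  move: sl tl => /in_list_coloringsP[sL sS] /in_list_coloringsP[tL tS].
  apply/setXP => /=; split; apply/in_list_coloringsP; split.
  - move=> v; rewrite ffunE /remove_colors inE; case: ifP => vC.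
      by rewrite (disjointFl TC vC) /=; have := tL v.
    have /negbTE-> : v \notin U by apply/negP => /(subsetP UC); rewrite vC.
    by rewrite orbF; have := sL v.
  - move=> u w uS wS uw; rewrite !ffunE -(CS _ _ uS wS uw).
    by case: ifP => _; [apply: tS|apply: sS].
  - move=> v; rewrite ffunE; case: ifP => _.
      exact: (subsetP (remove_colors_sub _ _ _ _ _)) (sL v).
    exact: (subsetP (remove_colors_sub _ _ _ _ _)) (tL v).
  - move=> u w uS wS uw; rewrite !ffunE -(CS _ _ uS wS uw).
    by case: ifP => _; [apply: sS|apply: tS].
move=> [s t] [s' t'] /= [/ffunP E1 /ffunP E2]; congr pair; apply/ffunP => v.
  by have := E1 v; have := E2 v; rewrite !ffunE; case: ifP.
by have := E1 v; have := E2 v; rewrite !ffunE; case: ifP.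
Qed.

Lemma remove_colors_card T c c' L u :
  (#|L u| <= #|remove_colors T c c' L u| + (u \in T).*2)%N.
Proof.
rewrite /remove_colors; case: (u \in T); last by rewrite addn0.
rewrite (cardsD1 c (L u)) (cardsD1 c' (L u :\ c)) addnA addnC leq_add2l.
by case: (_ \in L u); case: (_ \in _).
Qed.

End ListColorings.

(** * The probability that a vertex avoids two given colors *)

Section Marginals.
Context {R : realType} {V : finType} {q : nat}.
Variables (e : rel V) (a : R) (B : {set V}) (d s : nat).
Hypotheses (e_sym : symmetric e) (e_irr : irreflexive e).
Hypotheses (a0 : 0 < a).
Hypotheses (exB : excess_le e B s).
Hypotheses (q_large : 2 * s.+1%:R <= a * ((q%:R : R) - (d + 2 * s.+1 + 2)%:R)).

Local Notation listT := (V -> {set 'I_q}).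

(** A list may lose [d] colors to neighbours outside the block, and two for each deleted neighbour
    since [remove_colors] takes two colors at a time. *)
Definition lists_large (S D : {set V}) (L : listT) :=
  forall u, u \in S -> (q <= #|L u| + d + 2 * #|nbhd e u D|)%N.

(** [D] is the set of vertices deleted so far; the color of each of them has
    been removed from the lists of its neighbours. *)
Definition marginal_bound n := forall (S D : {set V}) v (L : listT),
  (#|S| <= n)%N -> v \in S -> S \subset B -> D \subset B -> [disjoint S & D] ->
  connected_set e D -> connected_set e (v |: D) -> lists_large S D L ->
  forall c c' : 'I_q,
  expR (- (2 * saw_total e a n S v)) * #|list_colorings e S L|%:R <=
  #|[set x in list_colorings e S L | (x v != c) && (x v != c')]|%:R.

(** The chain rule: the vertices of [T] are conditioned one after another to avoid both colors. The
    lists remain large enough because only neighbours of [v] lose colors and [v] joins the deleted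
    set. *)
Lemma avoid_nbhd n : marginal_bound n ->
  forall (S D : {set V}) v (L : listT) (T : {set V}) (c c' : 'I_q),
  (#|S| <= n)%N -> S \subset B -> v |: D \subset B -> [disjoint S & v |: D] ->
  v \notin D -> connected_set e (v |: D) -> lists_large S D L ->
  T \subset nbhd e v S ->
  expR (- (2 * \sum_(u in T) saw_total e a n S u)) * #|list_colorings e S L|%:R
  <= #|list_colorings e S (remove_colors T c c' L)|%:R.
Proof.
move=> marg S D v L T c c' Sn SB DB SD vD cD large.
have [m] := ubnP #|T|; elim: m T => // m IH T Tm TN.
have [->|[w wT]] := set_0Vmem T.
  rewrite big_set0 mulr0 oppr0 expR0 mul1r.
  rewrite (@eq_list_colorings _ _ _ _ (remove_colors _ _ _ _) L) // => u.
  by rewrite /remove_colors inE.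
have wTD : w \notin T :\ w by rewrite !inE eqxx.
rewrite -(setD1K wT) big_setU1 //= mulrDr opprD expRD -mulrA.
have T'N : T :\ w \subset nbhd e v S by apply: subset_trans (subsetDl _ _) TN.
have T'm : (#|T :\ w| < m)%N by move: Tm; rewrite (cardsD1 w T) wT.
apply: (le_trans (ler_wpM2l (expR_ge0 _) (IH _ T'm T'N))).
have := subsetP TN _ wT; rewrite in_nbhd => /andP[wS vw].
rewrite list_colorings_removeU.
apply: (marg S (v |: D)) => //.
  by apply: (connected_setU1 e_sym cD (setU11 _ _)).
move=> u uS; have := large u uS; have := remove_colors_card (T :\ w) c c' L u.
have -> : #|nbhd e u (v |: D)| = (e u v + #|nbhd e u D|)%N.
  rewrite (cardsD1 v) inE setU11 /=; congr (_ + _)%N.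
  apply: eq_card => z; rewrite !inE; case: eqP => //= ->.
  by rewrite (negbTE vD).
have : (((u \in T :\ w) : nat) <= e u v)%N.
  case uT: (u \in T :\ w) => //.
  by have := subsetP T'N _ uT; rewrite in_nbhd e_sym => /andP[_ ->].
by clear; move: (u \in _) => b; lia.
Qed.

(** Improves the bound [expR (- l)] on a probability [r] close to 1, by making the exponent
    proportional to [1 - r]. For [r <= 2^-1] this follows from [1 <= 2 * (1 - r)], otherwise from
    [r^-1 <= 1 + 2 * (1 - r)]. *)
Lemma expR_tangent (l r : R) : 1 <= l -> expR (- l) <= r -> r <= 1 ->
  expR (- (2 * l * (1 - r))) <= r.
Proof.
move=> l1 lr r1; have [r2|r2] := leP r (2^-1).
  by apply: le_trans lr; rewrite ler_expR lerN2; nra.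
apply: (@le_trans _ _ (expR (- (2 * (1 - r))))).
  by rewrite ler_expR lerN2; nra.
rewrite expRN -[leRHS]invrK lef_pV2 ?posrE ?invr_gt0 ?expR_gt0 //; last by lra.
apply: le_trans (expR_ge1Dx _).
by rewrite -[r^-1]mul1r ler_pdivrMr; nra.
Qed.

Lemma sum_card_color (T : finType) (A : {set T}) (f : T -> 'I_q) (Y : {set 'I_q}) :
  (\sum_(y in Y) #|[set x in A | f x == y]| <= #|A|)%N.
Proof.
rewrite -[leqRHS]sum1_card (eq_bigr (fun y => \sum_(x in A | f x == y) 1%N)).
  rewrite (exchange_big_dep (mem A)) /=; last by move=> y x _ /andP[].
  apply: leq_sum => x xA; rewrite sum1_card.
  rewrite -(cards1 (f x)); apply/subset_leq_card/subsetP => y.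
  by rewrite unfold_in inE => /andP[_ /andP[_ /eqP->]].
move=> y _; rewrite -sum1_card; apply: eq_bigl => x.
by rewrite !inE.
Qed.

End Marginals.

Section MarginalBound.
Context {R : realType} {V : finType} {q : nat}.
Variables (e : rel V) (a : R) (B : {set V}) (d s : nat).
Hypotheses (e_sym : symmetric e) (e_irr : irreflexive e).
Hypotheses (a0 : 0 < a).
Hypotheses (exB : excess_le e B s).

Local Notation listT := (V -> {set 'I_q}).
Local Notation colorings S L := (list_colorings e S L).

(** [avoid_nbhd] gives such a bound for every color, but without the factor [a] in the exponent. A
    component of [S] contains at most [s.+1] neighbours of [v], so few colors are likely there;
    averaging over the many colors of [Y] gains the factor for one of them. *)
Lemma good_color n (S D : {set V}) v (L : listT) (Y : {set 'I_q}) :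
  marginal_bound (R := R) (q := q) e a B d n ->
  (#|S| <= n)%N -> v |: S \subset B -> v |: D \subset B ->
  [disjoint S & v |: D] -> v \notin S -> v \notin D ->
  connected_set e (v |: D) -> lists_large e d S D L ->
  2 * s.+1%:R <= a * #|Y|%:R ->
  exists2 y, y \in Y &
    expR (- (2 * a * \sum_(u in nbhd e v S) saw_total e a n S u)) *
      #|colorings S L|%:R <=
    #|colorings S (remove_colors (nbhd e v S) y y L)|%:R :> R.
Proof.
move=> marg Sn vSB DB SD vS vD cD large Yl.
have Y0 : (0 < #|Y|)%N.
  rewrite lt0n; apply/negP => /eqP Y0; move: Yl.
  by rewrite Y0 mulr0 leNgt mulr_gt0 ?ltr0n.
have /card_gt0P[y0 y0Y] := Y0.
pose M := #|colorings S L|; rewrite -/M.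
have [M0|M0] := posnP M; first by exists y0; rewrite // M0 mulr0.
have M0r : 0 < M%:R :> R by rewrite ltr0n.
have SB : S \subset B by apply: subset_trans (subsetUr _ _) vSB.
set U := nbhd e v S.
pose N (T : {set V}) y : R := #|colorings S (remove_colors T y y L)|%:R.
pose K := [set conn_class e S u | u in U].
(* The probability that the neighbours of [v] in the component [C] avoid [y]; [avoid_nbhd] bounds it
   below by [expR (- l C)]. *)
pose r C y : R := N (U :&: C) y / M%:R.
pose l C : R := 2 * \sum_(u in U :&: C) saw_total e a n S u.
have US u : u \in U -> u \in S by rewrite in_nbhd => /andP[].
have Ke C u : C \in K -> (u \in C) = (conn_class e S u == C).
  move=> /imsetP[w wU ->]; apply/idP/eqP => [/(conn_class_eq e_sym)|<-] //.
  exact: conn_class_refl.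
have N_le T y : N T y <= M%:R.
  rewrite ler_nat; apply/subset_leq_card/sub_list_colorings => u.
  exact: remove_colors_sub.
have r_le1 C y : r C y <= 1 by rewrite ler_pdivrMr // mul1r.
have r_ge0 C y : 0 <= r C y by rewrite divr_ge0 ?ler0n.
have r_exp C y : expR (- l C) <= r C y.
  rewrite ler_pdivlMr //; apply: (avoid_nbhd e_sym marg _ _ Sn SB DB) => //.
  exact: subsetIl.
have l_ge1 C : C \in K -> 1 <= l C.
  move=> /imsetP[w wU ->]; have wUC : w \in U :&: conn_class e S w.
    by rewrite inE wU conn_class_refl.
  rewrite /l (big_setD1 w) //=.
  have : 1 <= saw_total e a n S w.
    have wS := US w wU; have n0 : (0 < n)%N.
      by apply: leq_trans Sn; apply/card_gt0P; exists w.
    rewrite -(prednK n0) saw_total_rec lerDl mulr_ge0 ?(ltW a0) // sumr_ge0 //.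
    by move=> z _; exact/saw_total_ge0/ltW.
  have : 0 <= \sum_(u in (U :&: conn_class e S w) :\ w) saw_total e a n S u.
    by apply: sumr_ge0 => z _; exact/saw_total_ge0/ltW.
  lra.
(* Different components are colored independently, so the probabilities [r C y] multiply. *)
have prod_r y (K' : {set {set V}}) : K' \subset K ->
    M%:R * \prod_(C in K') r C y <= N (U :&: cover K') y.
  have [m] := ubnP #|K'|; elim: m K' => // m IH K' K'm K'K.
  have [->|[C CK']] := set_0Vmem K'.
    rewrite big_set0 mulr1 ler_nat; apply: subset_leq_card.
    rewrite (@eq_list_colorings _ _ _ _ (remove_colors _ _ _ _) L) // => u.
    by rewrite /remove_colors /cover big_set0 setI0 inE.
  have CK := subsetP K'K _ CK'.
  rewrite (big_setD1 C) //= mulrCA.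
  have K''K : K' :\ C \subset K by apply: subset_trans (subsetDl _ _) K'K.
  have K''m : (#|K' :\ C| < m)%N by move: K'm; rewrite (cardsD1 C K') CK'.
  apply: (le_trans (ler_wpM2l (r_ge0 C y) (IH _ K''m K''K))).
  rewrite /r mulrAC ler_pdivrMr // mulrC.
  have -> : U :&: cover K' = (U :&: cover (K' :\ C)) :|: (U :&: C).
    by rewrite -setIUr {1}/cover (big_setD1 C) //= -/(cover (K' :\ C)) setUC.
  rewrite /N -!natrM ler_nat; apply: (@list_colorings_swap _ _ _ C).
  - move=> u w uS wS uw; have /imsetP[z zU EC] := CK.
    rewrite EC; apply/idP/idP => h.
      exact: (conn_class_closed (US z zU) h wS uw).
    by apply: (conn_class_closed (US z zU) h uS); rewrite e_sym.
  - apply/pred0P => u /=; apply/negP => /andP[/setIP[_ /bigcupP[C' /setD1P[C'C C'K]]]].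
    move=> uC' uC; move/negP: C'C; apply.
    by move: uC uC'; rewrite !Ke ?(subsetP K'K) // => /eqP-> /eqP->.
  - exact: subsetIr.
(* A union bound over the neighbours in [C]: each has only one color, so its contributions over all
   [y] add up to at most 1, and there are at most [s.+1] neighbours. *)
have sum_r C : C \in K -> \sum_(y in Y) (1 - r C y) <= s.+1%:R.
  move=> CK; have /imsetP[z zU EC] := CK; have zS := US z zU.
  have CS : C \subset S by rewrite EC conn_class_sub.
  have vC : v \notin C by apply: contra vS; apply: (subsetP CS).
  have cC : connected_set e C by rewrite EC; apply: conn_class_connected.
  have zC : z \in C by rewrite EC conn_class_refl.
  have cvC : connected_set e (v |: C).
    apply: (connected_setU1 e_sym cC zC).
    by move: zU; rewrite in_nbhd e_sym => /andP[].
  have C0 : C != set0 by apply/set0Pn; exists z.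
  have vCB : v |: C \subset B by apply: subset_trans vSB; apply: setUS.
  have UC : (#|U :&: C| <= s.+1)%N.
    apply: leq_trans (nbhd_excess e_sym e_irr exB vCB vC cC cvC C0).
    apply/subset_leq_card/subsetP => u; rewrite inE !in_nbhd.
    by move=> /andP[/andP[_ ->] ->].
  have one y : 1 - r C y <=
      \sum_(u in U :&: C) #|[set x in colorings S L | x u == y]|%:R / M%:R.
    rewrite -mulr_suml -natr_sum ler_pdivlMr // mulrBl mul1r divfK ?gt_eqF //.
    rewrite lerBlDl -natrD ler_nat /M.
    rewrite -(cardsID (colorings S (remove_colors (U :&: C) y y L))).
    rewrite leq_add ?subset_leq_card ?subsetIr //.
    apply: (@leq_trans (\sum_(x in colorings S L)
        \sum_(u in U :&: C) (x u == y))%N).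
      rewrite -sum1_card big_mkcond [leqRHS]big_mkcond leq_sum // => x _.
      rewrite inE; case xL: (x \in colorings S L); rewrite ?andbF //= andbT.
      case: ifP => // xR; have [w wUC xw] : exists2 w, w \in U :&: C & x w == y.
        apply/exists_inP; apply: contraNT xR => /exists_inPn h.
        have /in_list_coloringsP[xL' xS] := xL.
        apply/in_list_coloringsP; split=> // u; rewrite /remove_colors.
        by case: ifP => // /h xu; rewrite !inE xL' andbT andbb.
      by rewrite (bigD1 w) //= xw.
    rewrite exchange_big leq_sum // => u _.
    rewrite -sum1_card [leqRHS]big_mkcond [leqLHS]big_mkcond leq_sum // => x _.
    by rewrite inE; case: (x \in _) => //=; case: (x u == y).
  apply: le_trans; first by apply: ler_sum => y _; exact: one.
  rewrite exchange_big; apply: (@le_trans _ _ (\sum_(u in U :&: C) 1)).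
    2: by rewrite sumr_const ler_nat.
  apply: ler_sum => u _.
  rewrite -mulr_suml ler_pdivrMr // mul1r -natr_sum ler_nat.
  exact: sum_card_color.
(* The total exponent that [expR_tangent] yields for [y]; the chosen color minimizes it, so it is at
   most the average. *)
pose f y := \sum_(C in K) 2 * l C * (1 - r C y).
have l_ge0 C : 0 <= l C.
  by rewrite mulr_ge0 // sumr_ge0 // => z _; exact/saw_total_ge0/ltW.
pose Phi := \sum_(u in U) saw_total e a n S u.
have sum_f : \sum_(y in Y) f y <= 4 * s.+1%:R * Phi.
  rewrite /f exchange_big /=.
  apply: (@le_trans _ _ (\sum_(C in K) 2 * s.+1%:R * l C)).
    apply: ler_sum => C CK; rewrite -mulr_sumr [leRHS]mulrAC.
    by rewrite ler_wpM2l ?sum_r // mulr_ge0.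
  rewrite -mulr_sumr /l -mulr_sumr mulrA.
  have -> : 2 * s.+1%:R * 2 = 4 * s.+1%:R :> R by ring.
  rewrite ler_wpM2l ?mulr_ge0 ?ler0n // /Phi.
  rewrite (partition_big (conn_class e S) (mem K)) /=; last first.
    by move=> u uU; apply: imset_f.
  apply: ler_sum => C CK; rewrite le_eqVlt; apply/orP; left; apply/eqP.
  apply: eq_bigl => u; rewrite in_setI. by rewrite (Ke C u CK).
have Phi0 : 0 <= Phi by rewrite sumr_ge0 // => z _; exact/saw_total_ge0/ltW.
case: (arg_minP f y0Y) => y yY miny; exists y => //.
have fy : f y <= 2 * a * Phi.
  have : #|Y|%:R * f y <= 4 * s.+1%:R * Phi.
    apply: le_trans sum_f; rewrite mulr_natl -sumr_const; exact: ler_sum.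
  have Y0r : 0 < #|Y|%:R :> R by rewrite ltr0n.
  move=> h; rewrite -(ler_pM2l Y0r); apply: (le_trans h).
  rewrite [leRHS]mulrA ler_wpM2r //; lra.
have EU : U = U :&: cover K.
  apply/esym/setIidPl/subsetP => u uU; apply/bigcupP; exists (conn_class e S u).
    exact: imset_f.
  exact: conn_class_refl.
rewrite [in leRHS]EU; apply: le_trans (prod_r y K (subxx _)).
rewrite [leRHS]mulrC ler_wpM2r ?ler0n //.
apply: (@le_trans _ _ (expR (- f y))); first by rewrite ler_expR lerN2.
rewrite /f -sumrN expR_sum; apply: ler_prod => C CK.
by rewrite expR_ge0 expR_tangent ?l_ge1.
Qed.

Hypothesis q_large : 2 * s.+1%:R <= a * ((q%:R : R) - (d + 2 * s.+1 + 2)%:R).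

(** Each color at [v] occurs in at most [M] colorings, a good color other than [c] and [c'] in at
    least [expR (- (2 * (a * P))) * M]. Since [c] and [c'] account for at most [2 * M], the ratio is
    at least a third of this exponential; the summand 1 of [saw_total_rec] pays for the third
    through [expR (- 2)]. *)
Lemma marginal_boundP n : marginal_bound (R := R) (q := q) e a B d n.
Proof.
elim: n => [|n IH] S D v L Sn vS SB DB SD cD cvD large c c'.
  by move: Sn; rewrite leqn0 cards_eq0 => /eqP S0; rewrite S0 inE in vS.
have vD : v \notin D by rewrite (disjointFr SD vS).
have vS' : v \notin S :\ v by rewrite !inE eqxx.
have S'n : (#|S :\ v| <= n)%N by move: Sn; rewrite (cardsD1 v) vS.
have vDB : v |: D \subset B by rewrite subUset sub1set DB (subsetP SB).
have S'D : [disjoint S :\ v & v |: D].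
  apply/pred0P => u /=; rewrite !inE; case: eqP => //= _.
  by apply/negP => /andP[/(disjointFr SD) ->].
pose Lc y := fix_color v y L.
have large' y : lists_large e d (S :\ v) D (Lc y).
  move=> u /setD1P[/negbTE uv uS]; have := large u uS.
  by rewrite /Lc /fix_color uv.
pose Y := L v :\ c :\ c'.
have degD : (#|nbhd e v D| <= s.+1)%N.
  have [->|D0] := eqVneq D set0.
    by rewrite (_ : nbhd e v set0 = set0) ?cards0 //; apply/setP => u; rewrite !inE.
  exact: (nbhd_excess e_sym e_irr exB vDB vD cD cvD D0).
(* [v] has at most [s.+1] deleted neighbours, so [L v] has at least [q - d - 2 * s.+1] colors; the
   last [2] in [q_large] pays for [c] and [c']. *)
have Yl : 2 * s.+1%:R <= a * #|Y|%:R.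
  apply: (le_trans q_large); rewrite ler_pM2l // lerBlDr -natrD ler_nat.
  have := large v vS; have := cardsD1 c (L v); have := cardsD1 c' (L v :\ c).
  move: degD (leq_b1 (c \in L v)) (leq_b1 (c' \in L v :\ c)); rewrite -/Y.
  move: #|Y| #|L v| #|L v :\ c| #|_| (nat_of_bool _) (nat_of_bool _); clear; lia.
set tot := #|list_colorings e S L|.
pose N y := #|[set x in list_colorings e S L | x v == y]|.
have Ny y y' : y \in L v -> N y =
    #|list_colorings e (S :\ v) (remove_colors (nbhd e v (S :\ v)) y y (Lc y'))|.
  move=> yL; rewrite /N list_colorings_fix //.
  rewrite (card_list_colorings_fix _ _ y') //.
  congr #|pred_of_set _|; apply: eq_list_colorings => u.
  rewrite /Lc /fix_color /remove_colors in_nbhd !inE.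
  by case: eqP => // ->; rewrite eqxx.
have vSB : v |: S :\ v \subset B by rewrite setD1K.
have [y yY good] :=
  good_color IH S'n vSB vDB S'D vS' vD cvD (large' c) Yl.
set M := #|list_colorings e (S :\ v) (Lc c)| in good.
set rest := #|[set x in list_colorings e S L | _]|.
have N_le y' : (N y' <= M)%N.
  have [yL|yL] := boolP (y' \in L v).
    rewrite (Ny y' c yL); apply/subset_leq_card/sub_list_colorings => u.
    exact: remove_colors_sub.
  rewrite (_ : N y' = 0) //; apply/eqP; rewrite cards_eq0; apply/eqP/setP => x.
  rewrite !inE; apply: contraNF yL => /andP[/andP[/forallP/(_ v) xL _] /eqP <-].
  exact: xL.
have [yc yc' yL] : [/\ y != c, y != c' & y \in L v].
  by move: yY; rewrite !inE => /and3P[-> ->].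
have Nrest : (N y <= rest)%N.
  apply/subset_leq_card/subsetP => x; rewrite !inE => /andP[-> /eqP->].
  by rewrite yc yc'.
have tot_le : (tot <= rest + N c + N c')%N.
  apply: leq_trans (leq_add (leq_card_setU _ _) (leqnn _)).
  apply: leq_trans (leq_card_setU _ _).
  apply/subset_leq_card/subsetP => x; rewrite !in_setU !in_set => ->.
  by case: eqP => //=; case: eqP => //= ->; rewrite ?orbT.
rewrite -(Ny y c yL) in good.
move: good; rewrite saw_total_rec; set P := \sum_(u in _) _ => good.
rewrite mulrDr mulr1 opprD expRD -mulrA mulrA.
have P0 : 0 <= P by rewrite sumr_ge0 // => z _; exact/saw_total_ge0/ltW.
have E1 : expR (- (2 * (a * P))) <= 1 :> R.
  by rewrite -[leRHS]expR0 ler_expR oppr_le0 !mulr_ge0 ?(ltW a0).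
have E2 : expR (- 2) * 3 <= 1 :> R.
  rewrite expRN mulrC ler_pdivrMr ?expR_gt0 // mul1r.
  by apply: le_trans (expR_ge1Dx _); lra.
have FM : expR (- (2 * (a * P))) * M%:R <= rest%:R.
  by rewrite mulrA; apply: (le_trans good); rewrite ler_nat.
have tot2 : (tot%:R : R) <= rest%:R + 2 * M%:R.
  rewrite -natrM -natrD ler_nat; apply: (leq_trans tot_le).
  by rewrite mul2n -addnn addnA !leq_add.
have rest0 : 0 <= (rest%:R : R) by rewrite ler0n.
move: E1 E2 FM (expR_ge0 (- (2 * (a * P)))) (expR_ge0 (-2 : R)).
move: (expR (- (2 * (a * P)))) (expR (-2)) => F G F1 G3 FM F0 G0.
rewrite -mulrA; apply: (@le_trans _ _ (G * (3 * rest%:R))); last by nra.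
by rewrite ler_wpM2l //; nra.
Qed.

End MarginalBound.

(** * Conditioning proper colorings on the complement of a set *)

Section ProperColorings.
Context {V : finType} {q : nat}.
Variable e : rel V.
Hypotheses (e_sym : symmetric e) (e_irr : irreflexive e).
Local Notation X := {ffun V -> 'I_q}.
Local Notation T := (proper_coloring e q).
Implicit Types (S C : {set V}) (s t r : T).

(** The classes fix the colors off [S], so [cmean (agree_off S)] is [E_S], and [cvar (agree_off S)]
    is the mean of [Var_S] up to normalization. *)
Definition agree_off S : rel T :=
  fun s t => [forall v, (v \notin S) ==> (val s v == val t v)].

Lemma agree_offP S s t :
  reflect (forall v, v \notin S -> val s v = val t v) (agree_off S s t).
Proof.
apply: (iffP forallP) => h v; first by move=> vS; apply/eqP; move: (h v); rewrite vS.
by apply/implyP => /h ->.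
Qed.

Lemma agree_off_equiv S : equivalence_rel (agree_off S).
Proof.
move=> s t r; split; first by apply/agree_offP.
move=> /agree_offP st; apply/agree_offP/agree_offP => h v vS.
  by rewrite -st ?h.
by rewrite st ?h.
Qed.

Lemma agree_off_refl S s : agree_off S s s.
Proof. exact/agree_offP. Qed.

Lemma agree_off_sym S s t : agree_off S s t = agree_off S t s.
Proof. by apply/agree_offP/agree_offP => h v /h. Qed.

Lemma agree_off_sub S S' : S \subset S' -> subrel (agree_off S) (agree_off S').
Proof.
move=> SS s t /agree_offP h; apply/agree_offP => v vS.
by apply: h; apply: contra vS; apply/subsetP.
Qed.

Lemma proper_edge s u w : e u w -> val s u != val s w.
Proof. by have /forallP/(_ u)/forallP/(_ w)/implyP := valP s. Qed.

Definition glue_fun S s t : X := [ffun v => if v \in S then val t v else val s v].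

(** The default [s] is taken when the combined function is not proper; [val_glue] says when this
    cannot happen. *)
Definition glue S s t : T := insubd s (glue_fun S s t).

Lemma val_glue S s t :
  (forall u w, u \in S -> w \notin S -> e u w -> val s w = val t w) ->
  val (glue S s t) = glue_fun S s t.
Proof.
move=> h; apply: insubdK; apply/forallP => u; apply/forallP => w; apply/implyP => uw.
rewrite !ffunE; case: ifPn => uS; case: ifPn => wS; try exact: proper_edge.
  by rewrite (h _ _ uS wS uw) proper_edge.
by rewrite (h _ _ wS uS) ?proper_edge // e_sym.
Qed.

Context {R : realType}.
Implicit Types (f g h : T -> R).

(** The conditional law inside [S] depends only on the colors of the outside neighbours of [S]:
    exchanging the outside of [s] for that of [s'] is a bijection between the two classes. *)
Lemma cmean_glue_le S s s' f g :
  (forall u w, u \in S -> w \notin S -> e u w -> val s w = val s' w) ->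
  (forall t, agree_off S s t -> f t <= g (glue S s' t)) ->
  cmean (agree_off S) f s <= cmean (agree_off S) g s'.
Proof.
move=> ss' fg.
have vg t : agree_off S s t -> val (glue S s' t) = glue_fun S s' t.
  move=> /agree_offP st; apply: val_glue => u w uS wS uw.
  by rewrite -(ss' _ _ uS wS uw) st.
have vg' t : agree_off S s' t -> val (glue S s t) = glue_fun S s t.
  move=> /agree_offP st; apply: val_glue => u w uS wS uw.
  by rewrite (ss' _ _ uS wS uw) st.
have ag t : agree_off S s t -> agree_off S s' (glue S s' t).
  by move=> st; apply/agree_offP => v vS; rewrite vg // ffunE (negbTE vS).
have ag' t : agree_off S s' t -> agree_off S s (glue S s t).
  by move=> st; apply/agree_offP => v vS; rewrite vg' // ffunE (negbTE vS).
have gK t : agree_off S s t -> glue S s (glue S s' t) = t.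
  move=> st; apply/val_inj/ffunP => v; rewrite vg' ?ag // ffunE vg // ffunE.
  by case: ifPn => vS; [rewrite vS|apply: (agree_offP _ _ _ st)].
have gK' t : agree_off S s' t -> glue S s' (glue S s t) = t.
  move=> st; apply/val_inj/ffunP => v; rewrite vg ?ag' // ffunE vg' // ffunE.
  by case: ifPn => vS; [rewrite vS|apply: (agree_offP _ _ _ st)].
have reidx (k : T -> R) : \sum_(t | agree_off S s' t) k t =
    \sum_(t | agree_off S s t) k (glue S s' t).
  rewrite (reindex_onto (glue S s') (glue S s)) //.
  apply: eq_bigl => t; apply/andP/idP => [[st /eqP E]|st]; last by rewrite ag // gK.
  by rewrite -E ag'.
rewrite /cmean reidx.
have -> : #|agree_off S s'|%:R = #|agree_off S s|%:R :> R.
  have := reidx (fun=> 1); rewrite !sumr_const => ->; congr _%:R.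
by rewrite ler_pM2r ?invr_gt0 ?(class_card_gt0 (agree_off_equiv S)) ?ler_sum.
Qed.

Section Product.
Variables (S1 S2 : {set V}).
Hypothesis S12 : forall u w, u \in S1 -> w \in S2 -> ~~ e u w.

(** With no edges between the two sets, the iterated mean is unchanged by resampling either of them,
    hence constant on the classes of the union and equal to the mean there. *)
Lemma cmean_setU f s :
  cmean (agree_off S1) (cmean (agree_off S2) f) s =
  cmean (agree_off (S1 :|: S2)) f s.
Proof.
have eqv := agree_off_equiv.
set g := cmean (agree_off S1) _.
have inv1 t t' : agree_off S1 t t' -> g t = g t' by apply: cmean_inv.
have le2 t t' : agree_off S2 t t' -> g t <= g t'.
  move=> tt'; apply: cmean_glue_le => [u w uS wS uw|r tr].
    apply: (agree_offP _ _ _ tt'); apply/negP => wS2.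
    by move/negP: (S12 uS wS2).
  rewrite (cmean_inv (eqv S2) f (y := glue S1 t' r)) //.
  apply/agree_offP => v vS2; rewrite val_glue ?ffunE.
    case: ifPn => // vS1; rewrite -(agree_offP _ _ _ tt') //.
    by rewrite -(agree_offP _ _ _ tr).
  move=> u w uS wS uw; rewrite -(agree_offP _ _ _ tr) //.
  apply/esym/(agree_offP _ _ _ tt'); apply/negP => wS2.
  by move/negP: (S12 uS wS2).
have inv2 t t' : agree_off S2 t t' -> g t = g t'.
  by move=> tt'; apply/eqP; rewrite eq_le !le2 // agree_off_sym.
rewrite -(cmean_cmean (eqv S2) (eqv (S1 :|: S2))); last exact/agree_off_sub/subsetUr.
rewrite -(cmean_cmean (eqv S1) (eqv (S1 :|: S2))); last exact/agree_off_sub/subsetUl.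
apply/esym/cmean_id => // t st.
have vg : val (glue S1 t s) = glue_fun S1 t s.
  apply: val_glue => u w uS wS uw; apply/esym/(agree_offP _ _ _ st).
  rewrite inE negb_or wS /=; apply/negP => wS2; by move/negP: (S12 uS wS2).
rewrite -[LHS]/(g t) (@inv1 t (glue S1 t s)); last first.
  by apply/agree_offP => v vS; rewrite vg ffunE (negbTE vS).
apply: inv2; apply/agree_offP => v vS; rewrite vg ffunE.
case: ifPn => // vS1; apply/esym/(agree_offP _ _ _ st).
by rewrite inE negb_or vS1.
Qed.

End Product.

(** After splitting off the variance in [S1], the rest is the second moment of the [S1]-mean of
    [f - E_S2 f], and averaging contracts. *)
Lemma cvar_setU S1 S2 f : (forall u w, u \in S1 -> w \in S2 -> ~~ e u w) ->
  cvar (agree_off (S1 :|: S2)) f <=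
  cvar (agree_off S1) f + cvar (agree_off S2) f.
Proof.
move=> S12; have eqv := agree_off_equiv.
rewrite (cvar_split (eqv S1) f (eqv (S1 :|: S2))) ?lerD2l; last first.
  exact/agree_off_sub/subsetUl.
pose k s := f s - cmean (agree_off S2) f s.
have -> : cvar (agree_off (S1 :|: S2)) (cmean (agree_off S1) f) =
    \sum_s cmean (agree_off S1) k s ^+ 2.
  apply: eq_bigr => s _; congr (_ ^+ 2).
  rewrite cmeanB (cmean_setU S12) (cmean_cmean (eqv S1)) //.
  exact/agree_off_sub/subsetUl.
exact: (sqr_cmean_le (eqv S1)).
Qed.

End ProperColorings.

(** * The two-block dynamics on a vertex and the rest of a set *)

Section RootStep.
Context {V : finType} {q : nat} {R : realType}.
Variable e : rel V.
Hypotheses (e_sym : symmetric e) (e_irr : irreflexive e).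
Local Notation X := {ffun V -> 'I_q}.
Local Notation T := (proper_coloring e q).
Implicit Types (S C : {set V}) (s t r : T) (f g h : T -> R).

Definition boundary_lists S s v : {set 'I_q} :=
  if v \in S then ~: [set val s w | w in nbhd e v (~: S)] else [set val s v].

Lemma boundary_lists_class S s (x : X) :
  reflect (exists2 t, val t = x & agree_off S s t)
          (x \in list_colorings e S (boundary_lists S s)).
Proof.
apply: (iffP (in_list_coloringsP _ _ _ _)) => [[xL xS]|[t <- /agree_offP st]].
  have xoff v : v \notin S -> x v = val s v.
    by move=> vS; have := xL v; rewrite /boundary_lists (negbTE vS) => /set1P.
  have xin u w : u \in S -> w \notin S -> e u w -> x u != x w.
    move=> uS wS uw; have := xL u; rewrite /boundary_lists uS inE.
    apply: contraNneq => E; apply/imsetP; exists w; first by rewrite !inE wS.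
    by rewrite E xoff.
  have px : is_proper e x.
    apply/forallP => u; apply/forallP => w; apply/implyP => uw.
    have [uS|uS] := boolP (u \in S); have [wS|wS] := boolP (w \in S).
    - exact: xS.
    - exact: xin.
    - by rewrite eq_sym xin // e_sym.
    - by rewrite !xoff // proper_edge.
  exists (Sub x px); rewrite ?SubK //.
  by apply/agree_offP => v vS; rewrite SubK xoff.
split=> [v|u w _ _]; last exact: proper_edge.
rewrite /boundary_lists; case: ifPn => [vS|/st ->]; last by rewrite inE.
rewrite inE; apply/imsetP => -[w]; rewrite !inE => /andP[wS vw].
by rewrite st // => E; have := proper_edge t vw; rewrite E eqxx.
Qed.

Lemma boundary_lists_card S s u : u \in S ->
  (q <= #|boundary_lists S s u| + #|nbhd e u (~: S)|)%N.
Proof.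
move=> uS; rewrite /boundary_lists uS cardsCs setCK card_ord.
have := leq_imset_card (val s) (mem (nbhd e u (~: S))).
by move=> h; rewrite -leq_subLR subKn // ?(leq_trans _ h) //;
  apply: leq_trans (max_card _) _; rewrite card_ord.
Qed.

(** The arithmetic of [class_le] for one pair of colors: [n] and [n'] count the colorings with
    either color at the root, [a] those that can be switched from the first to the second, [Z] the
    colorings of the rest, [K] the class and [l] the colors. *)
Lemma pair_weight_le (k l K Z n n' a f : R) : 0 < k -> 0 < l -> 0 < K ->
  0 <= Z -> 0 <= n' -> 0 <= n -> 0 <= f -> n' <= Z -> n <= Z -> k * Z <= a ->
  l * (k * Z) <= K -> n * n' * f / K ^+ 2 <= k ^- 2 * (a * f) / (l * K).
Proof.
move=> k0 l0 K0 Z0 n'0 n0 f0 n'Z nZ aZ KZ.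
have -> : k ^- 2 * (a * f) / (l * K) = a * K * f / (k ^+ 2 * l) / K ^+ 2.
  by field; rewrite !gt_eqF.
rewrite ler_pM2r ?invr_gt0 ?exprn_gt0 // ler_pdivlMr ?mulr_gt0 ?exprn_gt0 //.
rewrite mulrAC ler_wpM2r //.
apply: (@le_trans _ _ (k * Z * (l * (k * Z)))).
  have -> : k * Z * (l * (k * Z)) = Z * Z * (k ^+ 2 * l) by ring.
  by rewrite ler_wpM2r ?ler_pM // mulr_ge0 ?exprn_ge0 // ltW.
by apply: ler_pM => //; rewrite !mulr_ge0 // ltW.
Qed.

Section Step.
Variables (S : {set V}) (v : V) (k : R).
Hypotheses (vS : v \in S) (k0 : 0 < k).
Let U := nbhd e v (S :\ v).
Let lists s c := fix_color v c (boundary_lists S s).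
Hypothesis k_le : forall s c c',
  k * #|list_colorings e (S :\ v) (lists s c)|%:R <=
  #|list_colorings e (S :\ v) (remove_colors U c c' (lists s c))|%:R.

(** On a class [g] depends only on the color of [v]. Independent pairs of colorings are compared
    with pairs that differ only at [v]. By [k_le] any two available colors can be exchanged in at
    least [k * Z] colorings; one factor [k] is lost there, the other in bounding the class size
    below. *)
Let class_le g s0 : (forall s t, agree_off (S :\ v) s t -> g s = g t) ->
  cmean (agree_off S) (fun s => cmean (agree_off S) (fun t => (g s - g t) ^+ 2) s) s0 <=
  k ^- 2 * cmean (agree_off S)
    (fun s => cmean (agree_off [set v]) (fun t => (g s - g t) ^+ 2) s) s0.
Proof.
move=> g_inv.
pose col s := val s v.
pose Lv := boundary_lists S s0 v.
pose l := #|Lv|.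
pose K := [set s | agree_off S s0 s].
pose N c := #|[set s in K | col s == c]|.
pose A c c' := [set s in K | (col s == c) &&
  [exists t, agree_off [set v] s t && (col t == c')]].
(* The value of [g] at color [c] of [v]; the default 0 is taken only at colors that no coloring of
   [K] has there. *)
pose gam c := if [pick s in [set s in K | col s == c]] is Some s then g s else 0.
have eqv C : equivalence_rel (agree_off C : rel T) by apply: agree_off_equiv.
have g_gam s : s \in K -> g s = gam (col s).
  move=> sK; rewrite /gam; case: pickP => [t|/(_ s)]; last by rewrite inE sK eqxx.
  rewrite inE => /andP[tK /eqP tc]; apply: g_inv; apply/agree_offP => u.
  move: sK tK; rewrite !inE => /agree_offP sK /agree_offP tK.
  by rewrite negb_and negbK => /orP[/eqP->|uS]; rewrite ?tc // -sK // -tK.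
pose F c c' : R := (gam c - gam c') ^+ 2.
have F0 c c' : 0 <= F c c' by apply: sqr_ge0.
have valK s : s \in K -> val s \in list_colorings e S (boundary_lists S s0).
  by rewrite [s \in K]inE => sK; apply/boundary_lists_class; exists s.
have colL s : s \in K -> col s \in Lv.
  by move=> /valK /in_list_coloringsP[sL _]; apply: sL.
have vU : v \notin U by rewrite in_nbhd !inE eqxx.
(* A coloring in which all neighbours of [v] avoid both [c] and [c'] can give [v] either of them. *)
have A_ge c c' : c \in Lv -> c' \in Lv ->
    (#|list_colorings e (S :\ v) (remove_colors U c c' (lists s0 c))| <= #|A c c'|)%N.
  move=> cL c'L; apply: leq_trans (leq_imset_card (fun t : T => val t) (A c c')).
  apply/subset_leq_card/subsetP => x xl.
  have : x \in [set x in list_colorings e S (boundary_lists S s0) | x v == c].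
    rewrite list_colorings_fix //; move: x xl; apply/subsetP/sub_list_colorings.
    move=> u; rewrite /lists /fix_color /remove_colors.
    case: eqP => [->|_]; first by rewrite (negbTE vU).
    rewrite -/U; case: ifP => // _; apply/subsetP => z.
    by rewrite !inE => /and3P[_ -> ->].
  rewrite inE => /andP[xS /eqP xv].
  have /boundary_lists_class[s xs s0s] := xS.
  have : recolor x v c' \in list_colorings e S (boundary_lists S s0).
    have [xL xE] := in_list_coloringsP _ _ _ _ xS.
    have [xL' _] := in_list_coloringsP _ _ _ _ xl.
    have xc' w : w \in S -> w != v -> e v w -> x w != c'.
      move=> wS wv vw; have := xL' w; rewrite /remove_colors in_nbhd !inE wv wS vw.
      by rewrite !inE => /andP[].
    apply/in_list_coloringsP; split=> [u|u w uS wS uw]; rewrite !ffunE.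
      by case: eqP => // ->.
    case: (eqVneq u v) => [uv|uv]; case: (eqVneq w v) => [wv|wv].
    - by move: uw; rewrite uv wv e_irr.
    - by rewrite eq_sym xc' // -uv.
    - by rewrite xc' // -wv e_sym.
    - exact: xE.
  move=> /boundary_lists_class[t xt s0t].
  apply/imsetP; exists s => //; rewrite !inE s0s /col xs xv eqxx /=.
  apply/existsP; exists t; rewrite xt ffunE eqxx eqxx andbT.
  apply/agree_offP => u; rewrite inE => uv.
  by rewrite xs xt ffunE (negbTE uv).
have N_le c : (N c <= #|list_colorings e (S :\ v) (lists s0 c)|)%N.
  rewrite /N -(@card_imset _ _ (fun t : T => val t) _ val_inj).
  apply/subset_leq_card/subsetP => x /imsetP[s].
  rewrite inE => /andP[/valK /in_list_coloringsP[sL sE] /eqP sc] ->.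
  apply/in_list_coloringsP; split=> [u|u w _ _]; last exact: proper_edge.
  by rewrite /lists /fix_color; case: eqP => // ->; rewrite inE -sc.
have by_color (H : 'I_q -> R) :
    \sum_(s in K) H (col s) = \sum_(c in Lv) (N c)%:R * H c.
  rewrite (partition_big col (mem Lv)) //=; apply: eq_bigr => c _.
  rewrite (eq_bigr (fun=> H c)) => [|s /andP[_ /eqP->] //].
  rewrite sumr_const mulr_natl; congr (_ *+ _); apply: eq_card => s.
  by rewrite inE.
have class_K s : s \in K -> forall t, agree_off S s t = (t \in K).
  rewrite inE => s0s t; rewrite inE.
  by case: (eqv S s0 s t) => _ /(_ s0s).
have cK s : s \in K -> #|agree_off S s| = #|K|.
  by move=> sK; apply: eq_card => t; apply: class_K.
have s0K : s0 \in K by rewrite inE agree_off_refl.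
have lhs : cmean (agree_off S) (fun s => cmean (agree_off S)
      (fun t => (g s - g t) ^+ 2) s) s0 =
    (\sum_(c in Lv) \sum_(c' in Lv) (N c)%:R * (N c')%:R * F c c') / #|K|%:R ^+ 2.
  rewrite /cmean cK // expr2 invfM mulrA; congr (_ / _).
  rewrite mulr_suml (eq_bigl _ _ (class_K s0 s0K)).
  transitivity (\sum_(s in K)
      (\sum_(c' in Lv) (N c')%:R * F (col s) c') / #|K|%:R).
    apply: eq_bigr => s sK; rewrite cK // (eq_bigl _ _ (class_K s sK)).
    by rewrite -by_color; congr (_ / _); apply: eq_bigr => t tK; rewrite !g_gam.
  rewrite (by_color (fun c => (\sum_(c' in Lv) (N c')%:R * F c c') / #|K|%:R)).
  apply: eq_bigr => c _; rewrite mulrA; congr (_ / _); rewrite mulr_sumr.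
  by apply: eq_bigr => c' _; rewrite mulrA.
have K0 : 0 < #|K|%:R :> R by rewrite ltr0n; apply/card_gt0P; exists s0.
have l0 : (0 < l)%N by apply/card_gt0P; exists (col s0); apply: colL.
have rhs : (\sum_(c in Lv) \sum_(c' in Lv) #|A c c'|%:R * F c c') /
      (l%:R * #|K|%:R) <= cmean (agree_off S) (fun s =>
        cmean (agree_off [set v]) (fun t => (g s - g t) ^+ 2) s) s0.
  rewrite [in leRHS]/cmean cK // invfM mulrA ler_wpM2r ?invr_ge0 ?(ltW K0) //.
  rewrite (eq_bigl _ _ (class_K s0 s0K)) mulr_suml.
  pose E s c' := [exists t, agree_off [set v] s t && (col t == c')].
  apply: (@le_trans _ _
    (\sum_(s in K) (\sum_(c' in Lv) (E s c')%:R * F (col s) c') / l%:R)).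
    rewrite le_eqVlt; apply/orP; left; apply/eqP.
    rewrite [RHS](partition_big col (mem Lv)) //=; apply: eq_bigr => c cL.
    rewrite -mulr_suml; congr (_ / _); rewrite exchange_big /=.
    apply: eq_bigr => c' _.
    rewrite (eq_bigr (fun s => (E s c')%:R * F c c')) => [|s /andP[_ /eqP->] //].
    rewrite -mulr_suml; congr (_ * _).
    rewrite -sum1_card natr_sum big_mkcond [RHS]big_mkcond; apply: eq_bigr => s _.
    rewrite [s \in A _ _]inE -/(E s c').
    by case: (s \in K) => //=; case: (col s == c) => //=; case: (E s c').
  apply: ler_sum => s sK.
  have sub t : agree_off [set v] s t -> t \in K.
    by move=> st; rewrite -(class_K s sK); apply: (agree_off_sub _ st); rewrite sub1set.
  apply: ler_pM.
  - by apply: sumr_ge0 => c' _; rewrite mulr_ge0.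
  - by rewrite invr_ge0.
  - rewrite [leRHS](partition_big col (mem Lv)) /=; last first.
      by move=> t /sub; apply: colL.
    apply: ler_sum => c' _; case Esc: (E s c'); last first.
      by rewrite mul0r sumr_ge0 // => t _; apply: sqr_ge0.
    move/existsP: Esc => [t /andP[st tc]].
    rewrite (bigD1 t) /=; last by rewrite st.
    rewrite mul1r (g_gam s sK) (g_gam t (sub t st)) (eqP tc) lerDl sumr_ge0 //.
    by move=> r _; apply: sqr_ge0.
  - rewrite lef_pV2 ?posrE ?ltr0n // ?ler_nat; last first.
      by apply/card_gt0P; exists s; apply: agree_off_refl.
    rewrite -(@card_in_imset _ _ col) => [|t r].
      apply/subset_leq_card/subsetP => _ /imsetP[t st ->].
      exact/colL/sub.
    move=> /agree_offP st /agree_offP sr tr; apply/val_inj/ffunP => u.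
    have [->//|uv] := eqVneq u v.
    by rewrite -st ?inE // -sr ?inE.
rewrite lhs; apply: le_trans (ler_wpM2l _ rhs); last first.
  by rewrite invr_ge0 exprn_ge0 // ltW.
rewrite [leRHS]mulrA mulr_sumr !mulr_suml; apply: ler_sum => c cL.
rewrite mulr_sumr !mulr_suml; apply: ler_sum => c' c'L.
pose Z := #|list_colorings e (S :\ v) (lists s0 c)|.
have vS' : v \notin S :\ v by rewrite !inE eqxx.
have ZE c1 : #|list_colorings e (S :\ v) (lists s0 c1)| = Z.
  exact: card_list_colorings_fix.
have A_geZ c1 c2 : c1 \in Lv -> c2 \in Lv -> k * Z%:R <= #|A c1 c2|%:R.
  move=> c1L c2L; have := k_le s0 c1 c2; rewrite ZE => /le_trans; apply.
  by rewrite ler_nat A_ge.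
have K_ge : l%:R * (k * Z%:R) <= #|K|%:R.
  have := by_color (fun=> 1); rewrite sumr_const => ->.
  rewrite mulr_natl -sumr_const; apply: ler_sum => c1 c1L; rewrite mulr1.
  apply: (le_trans (A_geZ c1 c1 c1L c1L)); rewrite ler_nat.
  apply/subset_leq_card/subsetP => s; rewrite !inE => /andP[->].
  by move=> /andP[-> _].
have NZ c1 : (N c1)%:R <= Z%:R :> R by rewrite ler_nat -(ZE c1) N_le.
have := A_geZ c c' cL c'L; have := NZ c; have := NZ c'; have := F0 c c'.
have l0r : 0 < l%:R :> R by rewrite ltr0n.
have N0 c1 : 0 <= (N c1)%:R :> R by rewrite ler0n.
have := N0 c; have := N0 c'.
have Z0 : 0 <= Z%:R :> R by rewrite ler0n.
move=> h1 h2 h3 h4 h5 h6.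
by apply: (@pair_weight_le k l%:R #|K|%:R Z%:R (N c)%:R (N c')%:R).
Qed.

Lemma root_variance g : (forall s t, agree_off (S :\ v) s t -> g s = g t) ->
  cvar (agree_off S) g <= k ^- 2 * cvar (agree_off [set v]) g.
Proof.
move=> g_inv.
have eqv C : equivalence_rel (agree_off C : rel T) by apply: agree_off_equiv.
rewrite !cvar_pairs // -!mulr_suml mulrA ler_pM2r ?invr_gt0 //.
rewrite -(sum_cmeanT (eqv S)) -[in leRHS](sum_cmeanT (eqv S)) mulr_sumr.
by apply: ler_sum => s _; apply: class_le.
Qed.

(** [cvar_split] leaves the variance of the mean [g], which [root_variance] reduces to the vertex
    [v]. The second moment of [f - g] is the variance in [S :\ v]. The constant 3 is the 2 of
    [cvarD] plus the 1 of the split. *)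
Lemma root_step f : k <= 1 -> cvar (agree_off S) f <=
  3 * k ^- 2 * (cvar (agree_off [set v]) f + cvar (agree_off (S :\ v)) f).
Proof.
move=> k1.
have eqv C : equivalence_rel (agree_off C : rel T) by apply: agree_off_equiv.
have sub : subrel (agree_off (S :\ v) : rel T) (agree_off S).
  exact/agree_off_sub/subsetDl.
rewrite (cvar_split (eqv (S :\ v)) f (eqv S) sub).
set g := cmean (agree_off (S :\ v)) f.
have g_inv s t : agree_off (S :\ v) s t -> g s = g t by apply: cmean_inv.
have := root_variance g_inv.
have : cvar (agree_off [set v]) g <=
    2 * cvar (agree_off [set v]) f + 2 * cvar (agree_off (S :\ v)) f.
  pose h s := - (f s - g s).
  have -> : cvar (agree_off [set v]) g =
      cvar (agree_off [set v]) (fun s => f s + h s).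
    apply: eq_bigr => s _; congr ((_ - _) ^+ 2); first by rewrite /h; ring.
    by apply: eq_cmean => t; rewrite /h; ring.
  apply: (le_trans (cvarD _ f h)); rewrite lerD2l ler_pM2l //.
  apply: (le_trans (cvar_le_sqr (eqv _) h)); rewrite le_eqVlt; apply/orP; left.
  by apply/eqP/eq_bigr => s _; rewrite /h sqrrN.
have k2 : 1 <= k ^- 2.
  by rewrite invf_ge1 ?exprn_gt0 // exprn_ile1 // ltW.
have : 0 <= cvar (agree_off (S :\ v)) f by apply: cvar_ge0.
have : 0 <= cvar (agree_off [set v]) f by apply: cvar_ge0.
move: k2; move: (k ^- 2) (cvar _ f) (cvar (agree_off (S :\ v)) f)
  (cvar (agree_off [set v]) g) (cvar (agree_off S) g) => K x y z w.
move=> K1 x0 y0 zle wle; apply: (@le_trans _ _ (K * y + K * (2 * x + 2 * y))).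
  apply: lerD; first by rewrite ler_peMl.
  by apply: (le_trans wle); rewrite ler_wpM2l // (le_trans _ K1).
rewrite [3 * K]mulrC -!mulrA -mulrDr ler_wpM2l ?(le_trans _ K1) //; lra.
Qed.

End Step.

End RootStep.

(** * Poincare inequality in a block *)

Section BlockPoincare.
Context {V : finType} {q : nat} {R : realType}.
Variables (e : rel V) (a : R) (B : {set V}) (d s : nat) (om : V -> R).
Hypotheses (e_sym : symmetric e) (e_irr : irreflexive e).
Hypotheses (a0 : 0 < a).
Hypotheses (exB : excess_le e B s).
Hypothesis q_large : 2 * s.+1%:R <= a * ((q%:R : R) - (d + 2 * s.+1 + 2)%:R).
Hypothesis B_boundary : forall u, u \in B -> (#|nbhd e u (~: B)| <= d)%N.
Hypothesis om_ge : forall n (S : {set V}) u, S \subset B -> u \in S ->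
  ln 3 + 4 * \sum_(w in nbhd e u (S :\ u)) saw_total e a n (S :\ u) w <= om u.
Local Notation T := (proper_coloring e q).

(** With [k = expR (- (2 * P))], the constant [3 * k ^- 2] of [root_step] becomes
    [expR (ln 3 + 4 * P)], the form bounded by [om_ge]. *)
Lemma root_step_om (S D : {set V}) v (f : T -> R) :
  v \in S -> S \subset B -> D \subset B -> [disjoint S & D] ->
  connected_set e (v |: D) ->
  (forall u w, u \in S -> w \in B -> e u w -> (w \in S) || (w \in D)) ->
  cvar (agree_off S) f <=
  expR (om v) * (cvar (agree_off [set v]) f + cvar (agree_off (S :\ v)) f).
Proof.
move=> vS SB DB SD cvD closed.
pose n := #|V|; pose P := \sum_(w in nbhd e v (S :\ v)) saw_total e a n (S :\ v) w.
have P0 : 0 <= P by rewrite sumr_ge0 // => z _; exact/saw_total_ge0/ltW.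
have vS' : v \notin S :\ v by rewrite !inE eqxx.
have vD : v \notin D by rewrite (disjointFr SD vS).
pose k := expR (- (2 * P)).
have k0 : 0 < k by apply: expR_gt0.
have k1 : k <= 1 by rewrite /k -[leRHS]expR0 ler_expR oppr_le0 mulr_ge0.
have k_le (x : T) c c' :
    k * #|list_colorings e (S :\ v) (fix_color v c (boundary_lists S x))|%:R <=
    #|list_colorings e (S :\ v) (remove_colors (nbhd e v (S :\ v)) c c'
        (fix_color v c (boundary_lists S x)))|%:R.
  have marg : marginal_bound (q := q) e a B d n.
    exact: (@marginal_boundP _ _ _ _ _ _ _ _ e_sym e_irr a0 exB q_large n).
  apply: (@avoid_nbhd _ _ _ _ _ _ _ e_sym _ marg _ D v) => //.
  - exact: max_card.
  - by apply: subset_trans SB; apply: subsetDl.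
  - by rewrite subUset sub1set DB (subsetP SB).
  - apply/pred0P => u /=; rewrite !inE; case: eqP => //= _.
    by apply/negP => /andP[/(disjointFr SD) ->].
  - move=> u /setD1P[uv uS]; rewrite /fix_color (negbTE uv).
    have := boundary_lists_card x uS.
    have : (#|nbhd e u (~: S)| <= d + #|nbhd e u D|)%N.
      have uB := subsetP SB u uS.
      apply: leq_trans (leq_add (B_boundary uB) (leqnn _)).
      apply: leq_trans (leq_card_setU _ _).
      apply/subset_leq_card/subsetP => w; rewrite !inE => /andP[wS uw].
      rewrite uw !andbT; case wB: (w \in B) => //=.
      by have := closed u w uS wB uw; rewrite (negbTE wS).
  move: #|_| #|nbhd e u D| #|boundary_lists S x u| => i j l; clear; lia.
apply: le_trans (root_step e_sym e_irr vS k0 k_le f k1) _.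
rewrite ler_wpM2r ?addr_ge0 ?cvar_ge0 //; try exact: agree_off_equiv.
apply: le_trans (_ : expR (ln 3 + 4 * P) <= _); last first.
  by rewrite ler_expR om_ge.
rewrite expRD lnK ?posrE // ler_wpM2l // /k -expRM_natl -expRN ler_expR.
lra.
Qed.

(** [U] holds the entry points where a self-avoiding path through the deleted vertices may continue,
    at least one in each component. A connected [S] loses an entry [r], and [m] drops by [om r]; a
    disconnected [S] splits into independent parts that keep the same [m]. So the constant involves
    the heaviest path, not the sum over all vertices. *)
Lemma block_poincare_rec n : forall (S D U : {set V}) (m : R) (f : T -> R),
  (#|S| <= n)%N -> S \subset B -> D \subset B -> [disjoint S & D] ->
  connected_set e D -> U \subset S ->
  (forall u, u \in U -> connected_set e (u |: D)) ->
  (forall u, u \in S -> exists2 w, w \in U & w \in conn_class e S u) ->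
  (forall u w, u \in S -> w \in B -> e u w -> (w \in S) || (w \in D)) ->
  (forall u p, u \in U -> path e u p -> uniq (u :: p) ->
     {subset u :: p <= S} -> \sum_(w <- u :: p) om w <= m) ->
  cvar (agree_off S) f <= expR m * \sum_(w in S) cvar (agree_off [set w]) f.
Proof.
have eqv C : equivalence_rel (agree_off C : rel T) by apply: agree_off_equiv.
have var0 (S : {set V}) (f : T -> R) : 0 <= cvar (agree_off S) f by apply: cvar_ge0.
elim: n => [|n IH] S D U m f Sn SB DB SD cD US cU entry closed paths.
  move: Sn; rewrite leqn0 cards_eq0 => /eqP ->; rewrite big_set0 mulr0.
  apply: le_trans (_ : \sum_(x : T) 0 <= _); last by rewrite big1.
  apply: ler_sum => x _; rewrite cmean_id ?subrr ?expr0n // => y /agree_offP xy.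
  by congr f; apply/val_inj/ffunP => u; rewrite xy ?inE.
have [->|[u0 u0S]] := set_0Vmem S.
  rewrite big_set0 mulr0.
  apply: le_trans (_ : \sum_(x : T) 0 <= _); last by rewrite big1.
  apply: ler_sum => x _; rewrite cmean_id ?subrr ?expr0n // => y /agree_offP xy.
  by congr f; apply/val_inj/ffunP => u; rewrite xy ?inE.
have [r rU _] := entry _ u0S; have rS := subsetP US _ rU.
pose C := conn_class e S r.
have CS : C \subset S by apply: conn_class_sub.
have rC : r \in C by apply: conn_class_refl.
have cC : connected_set e C by apply: conn_class_connected.
have C_closed u w : u \in C -> w \in S -> e u w -> w \in C.
  by apply: conn_class_closed.
have [CE|CnS] := eqVneq C S.
  have om_r : om r <= m.
    have := paths r [::] rU isT isT; rewrite big_seq1; apply.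
    by move=> u; rewrite inE => /eqP->.
  apply: le_trans (root_step_om f rS SB DB SD (cU r rU) closed) _.
  have : cvar (agree_off (S :\ r)) f <=
      expR (m - om r) * \sum_(w in S :\ r) cvar (agree_off [set w]) f.
    apply: (IH _ (r |: D) (nbhd e r (S :\ r))).
    - by move: Sn; rewrite (cardsD1 r) rS.
    - by apply: subset_trans SB; apply: subsetDl.
    - by rewrite subUset sub1set DB (subsetP SB).
    - apply/pred0P => u /=; rewrite !inE; case: eqP => //= _.
      by apply/negP => /andP[/(disjointFr SD) ->].
    - exact: cU.
    - by apply/subsetP => u; rewrite in_nbhd => /andP[].
    - move=> u; rewrite in_nbhd => /andP[_ ru].
      exact: (connected_setU1 e_sym (cU r rU) (setU11 _ _) ru).
    (* Every component of [S :\ r] touches [r]: an edge leaving it inside the connected set [S] can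
       end nowhere else. *)
    - move=> u uS'; set C' := conn_class e (S :\ r) u.
      have C'S : C' \subset S :\ r by apply: conn_class_sub.
      have uC' : u \in C' by apply: conn_class_refl.
      have := @connected_boundary _ e C' S _ _ _ _.
      rewrite -{1}CE => /(_ cC (subset_trans C'S (subsetDl _ _))).
      have -> : C' != set0 by apply/set0Pn; exists u.
      have -> : C' != S.
        apply: contraTneq rS => <-; apply/negP => /(subsetP C'S).
        by rewrite !inE eqxx.
      move=> /(_ isT isT)[b [c [bS bC' cC' cb]]].
      have br : b = r.
        apply: contraNeq bC' => br; apply: (conn_class_closed uS' cC') cb.
        by rewrite !inE br.
      exists c => //; rewrite in_nbhd (subsetP C'S) //.
      by rewrite e_sym -br.
    - move=> u w /setD1P[_ uS] wB uw; have := closed u w uS wB uw.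
      by rewrite !inE; case: (w == r).
    move=> u p; rewrite in_nbhd => /andP[uS' ru] up unq sub.
    have rnp : r \notin u :: p by apply/negP => /sub; rewrite !inE eqxx.
    have := paths r (u :: p) rU; rewrite /= ru up => /(_ isT).
    rewrite [r \notin _]rnp => /(_ unq); rewrite big_cons => h.
    rewrite lerBrDl; apply: h => z; rewrite inE => /orP[/eqP->//|/sub].
    by rewrite !inE => /andP[].
  move=> h; rewrite [X in _ <= _ * X](big_setD1 r) //=.
  apply: (@le_trans _ _ (expR (om r) * (cvar (agree_off [set r]) f +
      expR (m - om r) * \sum_(w in S :\ r) cvar (agree_off [set w]) f))).
    by rewrite ler_wpM2l ?expR_ge0 // lerD2l.
  rewrite !mulrDr mulrA -expRD addrCA subrr addr0 lerD2r.
  by rewrite ler_wpM2r // ler_expR.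
have SE : S = C :|: (S :\: C) by rewrite -{1}(setID S C) (setIidPr CS).
have C0 : (0 < #|C|)%N by apply/card_gt0P; exists r.
have Clt : (#|C| < #|S|)%N.
  rewrite ltn_neqAle subset_leq_card // andbT; apply: contra CnS => /eqP E.
  by rewrite eqEcard CS E leqnn.
have Dlt : (#|S :\: C| < #|S|)%N.
  by rewrite cardsD (setIidPr CS) ltn_subrL C0 (leq_trans C0 (ltnW Clt)).
rewrite [in leLHS]SE; apply: le_trans (cvar_setU e_sym _ _) _.
  move=> u w uC; rewrite inE => /andP[wC wS]; apply: contra wC.
  exact: C_closed.
rewrite [in leRHS](big_setID C) /= (setIidPr CS).
rewrite mulrDr; apply: lerD.
  apply: (IH _ D (U :&: C)) => //.
  - exact: leq_trans Clt Sn.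
  - exact: subset_trans SB.
  - exact: disjointWl SD.
  - exact: subsetIr.
  - by move=> u /setIP[/cU].
  - move=> u uC; exists r; first by rewrite inE rU.
    by apply: (subsetP (sub_conn_class cC (subxx _) uC)).
  - move=> u w uC wB uw; have uS := subsetP CS u uC.
    by have /orP[wS|->] := closed u w uS wB uw; rewrite ?orbT // (C_closed u).
  by move=> u p /setIP[uU _] up unq sub; apply: paths => // z /sub /(subsetP CS).
have DS : S :\: C \subset S by apply: subsetDl.
apply: (IH _ D (U :\: C)) => //.
- exact: leq_trans Dlt Sn.
- exact: subset_trans SB.
- exact: disjointWl SD.
- exact: setSD.
- by move=> u /setDP[/cU].
- move=> u /setDP[uS uC]; have [w wU wu] := entry u uS.
  have wC : w \notin C.
    apply: contra uC; rewrite /C !inE => rw; apply: connect_trans rw _.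
    by rewrite (edge_in_connect_sym e_sym); move: wu; rewrite inE.
  exists w; first by rewrite inE wC.
  have sub : conn_class e S u \subset S :\: C.
    apply/subsetP => z zu; rewrite inE (subsetP (conn_class_sub e uS)) // andbT.
    apply: contra uC; rewrite /C !inE => rz; apply: connect_trans rz _.
    by rewrite (edge_in_connect_sym e_sym); move: zu; rewrite inE.
  have cu := conn_class_connected e_sym uS.
  exact: (subsetP (sub_conn_class cu sub (conn_class_refl _ _ _))).
- move=> u w /setDP[uS uC] wB uw.
  have /orP[wS|->] := closed u w uS wB uw; rewrite ?orbT // inE wS andbT orbC.
  rewrite (contra _ uC) ?orbT // => wC; apply: (C_closed w) => //.
  by rewrite e_sym.
by move=> u p /setDP[uU _] up unq sub; apply: paths => // z /sub /(subsetP DS).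
Qed.

Lemma block_poincare v m (f : T -> R) : v \in B -> connected_set e B ->
  (forall p, path e v p -> uniq (v :: p) -> {subset v :: p <= B} ->
     \sum_(w <- v :: p) om w <= m) ->
  cvar (agree_off B) f <= expR m * \sum_(w in B) cvar (agree_off [set w]) f.
Proof.
move=> vB cB paths.
apply: (@block_poincare_rec #|B| B set0 [set v]) => //.
- by rewrite sub0set.
- by apply/pred0P => u /=; rewrite inE andbF.
- by move=> u w; rewrite inE.
- by rewrite sub1set.
- by move=> u /set1P ->; rewrite setU0; apply: connected_set1.
- move=> u uB; exists v; first by rewrite inE.
  by apply: (subsetP (sub_conn_class cB (subxx _) uB)).
- by move=> u w uB wB _; rewrite wB.
by move=> u p /set1P ->; apply: paths.
Qed.

End BlockPoincare.

(** * Decay of the influence of a vertex *)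

Section SpatialMixing.
Context {V : finType} {q : nat} {R : realType}.
Variables (e : rel V) (d : nat).
Hypotheses (e_sym : symmetric e) (e_irr : irreflexive e).
Hypothesis q_gt : (2 * d <= q)%N.
Hypothesis q_gt0 : (0 < q)%N.
Local Notation T := (proper_coloring e q).
Implicit Types (S Z C : {set V}) (s t r : T) (f g h phi psi : T -> R).

Let eqv C : equivalence_rel (agree_off C : rel T).
Proof. exact: agree_off_equiv. Qed.

(** Bounds the probability that a disagreement next to [w] passes to [w], trivially at high
    degree. *)
Definition transmission (w : V) : R :=
  if (#|nbhd e w [set: V]| <= d)%N then (2 * d)%:R / q%:R else 1.

Lemma transmission_ge0 w : 0 <= transmission w.
Proof. by rewrite /transmission; case: ifP => // _; rewrite divr_ge0. Qed.

Lemma recolor_proper s w c : c \notin [set val s u | u in nbhd e w [set: V]] ->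
  exists2 t, agree_off [set w] s t & val t w = c.
Proof.
move=> cN; have N u : e w u -> val s u != c.
  move=> wu; apply: contraNneq cN => <-; apply: imset_f.
  by rewrite in_nbhd inE.
have p : is_proper e (recolor (val s) w c).
  apply/forallP => u; apply/forallP => v; apply/implyP => uv; rewrite !ffunE.
  case: (eqVneq u w) => [uw|uw]; case: (eqVneq v w) => [vw|vw].
  - by move: uv; rewrite uw vw e_irr.
  - by rewrite eq_sym N // -uw.
  - by rewrite N // -vw e_sym.
  - exact: proper_edge.
exists (Sub _ p); last by rewrite SubK ffunE eqxx.
by apply/agree_offP => u; rewrite inE => /negbTE uw; rewrite SubK ffunE uw.
Qed.

Lemma agree_off1_inj w s t t' : agree_off [set w] s t -> agree_off [set w] s t' ->
  val t w = val t' w -> t = t'.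
Proof.
move=> /agree_offP st /agree_offP st' tt'; apply/val_inj/ffunP => u.
by have [->//|uw] := eqVneq u w; rewrite -st ?inE // -st' ?inE.
Qed.

(** The two laws of the color of [w] are uniform on at most [q] colors each, with at least
    [q - 2 * d] in common. Mass [q%:R^-1] on each common color couples them with disagreement at
    most [(2 * d)%:R / q%:R]; the proof is the dual form of this coupling. *)
Lemma site_coupling w s s' (A A' : T -> R) (G Q : R) :
  (#|nbhd e w [set: V]| <= d)%N -> 0 <= Q ->
  (forall t t', agree_off [set w] s t -> agree_off [set w] s' t' ->
     A t - A' t' <= G + Q * (val t w != val t' w)%:R) ->
  cmean (agree_off [set w]) A s - cmean (agree_off [set w]) A' s' <=
  G + (2 * d)%:R / q%:R * Q.
Proof.
move=> wd Q0 AA'.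
pose K := agree_off [set w] s; pose K' := agree_off [set w] s'.
have q0 : 0 < q%:R :> R by rewrite ltr0n.
have sK' : K' s' by apply: agree_off_refl.
case: (@arg_minP _ _ _ s' K' A' sK') => t0 t0K t0min.
(* Subtracting the minimum makes [BB] nonnegative, so sums over matched colorings may be extended to
   the whole class and [q%:R^-1] replaced by [y^-1]. *)
pose b0 := A' t0.
pose AA t := A t - G - b0; pose BB t := A' t - b0.
have AAQ t : K t -> AA t <= Q.
  move=> tK; have := AA' t t0 tK t0K; rewrite /AA /b0.
  have : Q * (val t w != val t0 w)%:R <= Q by case: (_ != _); rewrite ?mulr1 ?mulr0.
  lra.
have BB0 t : K' t -> 0 <= BB t by move=> tK; rewrite subr_ge0 t0min.
pose x : R := #|K|%:R; pose y : R := #|K'|%:R.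
have x0 : 0 < x by apply: (class_card_gt0 (eqv [set w])).
have y0 : 0 < y by apply: (class_card_gt0 (eqv [set w])).
have card_le_q (r : T) : (#|agree_off [set w] r| <= q)%N.
  rewrite -[leqRHS]card_ord -(@card_in_imset _ _ (fun t : T => val t w)).
    exact: max_card.
  by move=> t t'; apply: agree_off1_inj.
have xq : x <= q%:R by rewrite ler_nat card_le_q.
have yq : y <= q%:R by rewrite ler_nat card_le_q.
pose same t t' := val t w == val t' w.
pose M t := \sum_(t' | K' t' && same t t') BB t'.
pose mu t : R := \sum_(t' | K' t' && same t t') 1.
have pointwise t : K t -> AA t / x <= M t / q%:R + (x^-1 - mu t / q%:R) * Q.
  move=> tK; have [t' /andP[t'K tt']|none] := pickP (fun t' => K' t' && same t t').
    have uniq_t' t'' : K' t'' && same t t'' = (t'' == t').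
      apply/andP/eqP => [[t''K st]|->//]; apply: (agree_off1_inj t''K t'K).
      by rewrite -(eqP st) (eqP tt').
    rewrite /M /mu (eq_bigl _ _ uniq_t') big_pred1_eq (eq_bigl _ _ uniq_t') big_pred1_eq.
    have := AA' t t' tK t'K; rewrite (_ : _ != _ = false) ?mulr0 ?addr0; last first.
      exact/negbTE/negPn.
    move=> le; have leB : AA t <= BB t' by rewrite /AA /BB; lra.
    rewrite mul1r; have -> : AA t / x = AA t / q%:R + (x^-1 - q%:R^-1) * AA t by ring.
    apply: lerD; first by rewrite ler_wpM2r // invr_ge0 ltW.
    by rewrite ler_wpM2l ?AAQ // subr_ge0 lef_pV2.
  rewrite /M /mu !big_pred0 // !mul0r subr0 add0r [leRHS]mulrC.
  by rewrite ler_wpM2r ?AAQ // invr_ge0 ltW.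
have sumM : \sum_(t | K t) M t <= \sum_(t | K' t) BB t.
  rewrite /M (exchange_big_dep K') /=; last by move=> t t' _ /andP[].
  apply: ler_sum => t' t'K.
  have [t /andP[tK stt']|none] := pickP (fun t => K t && (K' t' && same t t')).
    rewrite (bigD1 t) /=; last by rewrite tK.
    rewrite big1 ?addr0 // => t2 /andP[/andP[t2K /andP[_ st2]] /eqP[]].
    apply: (agree_off1_inj t2K tK).
    by move: stt' => /andP[_ st]; rewrite (eqP st2) (eqP st).
  by rewrite big_pred0 ?BB0.
(* Colors that no neighbour of [w] has in [s] or in [s'] are available in both. *)
have sum_mu : (q - 2 * d)%:R <= \sum_(t | K t) mu t.
  pose I := ~: ([set val s u | u in nbhd e w [set: V]] :|:
                [set val s' u | u in nbhd e w [set: V]]).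
  have cI : (q - 2 * d <= #|I|)%N.
    rewrite cardsCs setCK card_ord leq_sub2l //.
    apply: leq_trans (leq_card_setU _ _) _; rewrite mul2n -addnn.
    by apply: leq_add; apply: leq_trans (leq_imset_card _ _) wd.
  have I1 : (#|I|%:R : R) = \sum_(c in I) 1 by rewrite sumr_const.
  apply: (@le_trans _ _ #|I|%:R); first by rewrite ler_nat.
  have mu0 t : 0 <= mu t by apply: sumr_ge0.
  apply: (@le_trans _ _ (\sum_(t | K t && (val t w \in I)) mu t)); last first.
    by rewrite [leRHS](bigID (fun t => val t w \in I)) /= lerDl sumr_ge0.
  rewrite (partition_big (fun t : T => val t w) (mem I)) /=; last by move=> t /andP[].
  rewrite I1; apply: ler_sum => c; rewrite !inE negb_or => /andP[cs cs'].
  have [t st tc] := recolor_proper cs; have [t' st' tc'] := recolor_proper cs'.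
  rewrite (bigD1 t) /=; last first.
    by rewrite [K t]st tc eqxx andbT !inE negb_or cs.
  apply: (@le_trans _ _ (mu t)); last by rewrite lerDl sumr_ge0.
  rewrite /mu (bigD1 t') /=; last by rewrite [K' t']st' /same tc tc' eqxx.
  by rewrite lerDl sumr_ge0.
have main : (\sum_(t | K t) AA t) / x <=
    (\sum_(t | K' t) BB t) / y + (2 * d)%:R / q%:R * Q.
  rewrite mulr_suml; apply: (@le_trans _ _
      (\sum_(t | K t) (M t / q%:R + (x^-1 - mu t / q%:R) * Q))).
    exact: ler_sum.
  rewrite big_split /= -mulr_suml; apply: lerD.
    apply: (@le_trans _ _ ((\sum_(t | K' t) BB t) / q%:R)).
      by rewrite ler_wpM2r // invr_ge0 ltW.
    rewrite ler_wpM2l ?lef_pV2 //; exact: sumr_ge0.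
  rewrite -mulr_suml ler_wpM2r // sumrB sumr_const -mulr_suml.
  rewrite -[X in X - _]mulr_natr mulVf ?gt_eqF // lerBlDl -mulrDl.
  rewrite ler_pdivlMr // mul1r.
  have : (q%:R : R) = (q - 2 * d)%:R + (2 * d)%:R by rewrite -natrD subnK.
  by move=> ->; rewrite lerD2r.
have sumAA : (\sum_(t | K t) AA t) / x = cmean (agree_off [set w]) A s - G - b0.
  by rewrite -/(cmean (agree_off [set w]) AA s) /AA !cmeanB !(cmean_const (eqv [set w])).
have sumBB : (\sum_(t | K' t) BB t) / y = cmean (agree_off [set w]) A' s' - b0.
  by rewrite -/(cmean (agree_off [set w]) BB s') /BB cmeanB (cmean_const (eqv [set w])).
move: main; rewrite sumAA sumBB; lra.
Qed.

(** Bounds the probability that a disagreement at [w] occurs and spreads along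
    a self-avoiding path with [k] further vertices of [S]. *)
Fixpoint spread (k : nat) S (w : V) : R :=
  transmission w *
  if k is k'.+1 then \sum_(y in nbhd e w (S :\ w)) spread k' (S :\ w) y else 1.

Lemma spread_ge0 k S w : 0 <= spread k S w.
Proof.
elim: k S w => [|k IH] S w /=; rewrite mulr_ge0 ?transmission_ge0 //.
exact: sumr_ge0.
Qed.

Lemma spread_mono k S C w : S \subset C -> spread k S w <= spread k C w.
Proof.
elim: k S C w => [|k IH] S C w SC //=.
have SC' : S :\ w \subset C :\ w by apply: setSD.
rewrite ler_wpM2l ?transmission_ge0 // big_mkcond [leRHS]big_mkcond.
apply: ler_sum => y _; rewrite !in_nbhd.
have [yS|yS] := boolP (y \in S :\ w).
  by rewrite (subsetP SC' y yS); case: (e w y) => //=; apply: IH.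
by case: ifP => // _; apply: spread_ge0.
Qed.

Section Disagreement.
Variables (S0 C0 : {set V}) (ball : nat -> {set V}) (r0 : nat) (phi psi : T -> R).
Hypothesis ball_step : forall j u w, u \in ball j -> e u w -> w \in ball j.+1.
Hypothesis ball_C0 : forall j u, (j <= r0)%N -> u \in ball j -> u \in S0 -> u \in C0.
Hypothesis phi_psi : forall s t, phi s - psi t <= 1.
Hypothesis phi_psi0 : forall s t, agree_off C0 s t -> phi s - psi t <= 0.

Let cmean_sub_le S f g s t (M : R) :
  (forall r r', agree_off S s r -> agree_off S t r' -> f r - g r' <= M) ->
  cmean (agree_off S) f s - cmean (agree_off S) g t <= M.
Proof.
move=> fg; rewrite -(cmean_const (eqv S) (cmean (agree_off S) g t) s) -cmeanB.
rewrite -[leRHS](cmean_const (eqv S) M s); apply: cmean_le => // r sr.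
rewrite lerBlDr -lerBlDl -(cmean_const (eqv S) (f r - M) t).
by apply: cmean_le => // r' tr'; have := fg r r' sr tr'; lra.
Qed.

(** If no vertex of [S] is next to a disagreement, gluing matches the two classes, and the matched
    colorings differ only in [Z], inside [C0]. *)
Let disagreement_isolated S Z (k : V -> nat) s t :
  (forall z, z \in Z -> [/\ z \in C0, k z <= r0 & z \in ball (r0 - k z)])%N ->
  agree_off (S :|: Z) s t -> (forall z w, z \in Z -> w \in S -> ~~ e z w) ->
  cmean (agree_off S) phi s - cmean (agree_off S) psi t <=
  \sum_(z in Z) \sum_(w in nbhd e z S) spread (k z) S w.
Proof.
move=> Zk /agree_offP st noedge.
apply: (@le_trans _ _ 0); last first.
  by apply: sumr_ge0 => z _; apply: sumr_ge0 => w _; apply: spread_ge0.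
have st' u w : u \in S -> w \notin S -> e u w -> val s w = val t w.
  move=> uS wS uw; apply: st; rewrite inE (negbTE wS) /=.
  by apply/negP => wZ; move/negP: (noedge w u wZ uS); apply; rewrite e_sym.
rewrite subr_le0; apply: (cmean_glue_le e_sym) => // r /agree_offP sr.
rewrite -subr_le0; apply: phi_psi0; apply/agree_offP => v vC.
have vZ : v \notin Z by apply: contra vC => /Zk[].
rewrite (val_glue e_sym) ?ffunE.
  by case: ifPn => // vS; rewrite -sr // st // inE negb_or vS.
by move=> u w uS wS uw; rewrite -sr // (st' u w).
Qed.

(** [phi] and [psi] are dual potentials for the transport cost
    [agree_off C0 s t ? 0 : 1]; this expresses a coupling of the two conditional
    measures without constructing it. *)
Lemma disagreement_bound n : forall S Z (k : V -> nat) s t,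
  (#|S| <= n)%N -> S \subset S0 -> [disjoint Z & S] ->
  (forall z, z \in Z -> [/\ z \in C0, k z <= r0 & z \in ball (r0 - k z)])%N ->
  agree_off (S :|: Z) s t ->
  cmean (agree_off S) phi s - cmean (agree_off S) psi t <=
  \sum_(z in Z) \sum_(w in nbhd e z S) spread (k z) S w.
Proof.
have spread_sum0 S Z k : 0 <= \sum_(z in Z) \sum_(w in nbhd e z S) spread (k z) S w.
  by apply: sumr_ge0 => z _; apply: sumr_ge0 => w _; apply: spread_ge0.
elim: n => [|n IH] S Z k s t Sn SS0 ZS Zk st;
  (have [z /andP[zZ /existsP[w]]|noadj] :=
     pickP (fun z => (z \in Z) && [exists w, w \in nbhd e z S]); last first).
- have noedge z w : z \in Z -> w \in S -> ~~ e z w.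
    move=> zZ wS; apply: contraFN (noadj z) => zw; rewrite zZ; apply/existsP.
    by exists w; rewrite in_nbhd wS.
  exact: disagreement_isolated.
- by move: Sn; rewrite leqn0 cards_eq0 => /eqP->; rewrite in_nbhd inE.
- have noedge z w : z \in Z -> w \in S -> ~~ e z w.
    move=> zZ wS; apply: contraFN (noadj z) => zw; rewrite zZ; apply/existsP.
    by exists w; rewrite in_nbhd wS.
  exact: disagreement_isolated.
rewrite in_nbhd => /andP[wS zw].
pose S' := S :\ w.
have S'S : S' \subset S by apply: subsetDl.
have S'n : (#|S'| <= n)%N by move: Sn; rewrite (cardsD1 w) wS.
have wZ : w \notin Z by rewrite (disjointFl ZS wS).
(* The vertex [w] is revealed: [G] is the bound if it agrees, and [Q] the extra cost of a
   disagreement there, namely the further spread with one step less than at [z], or 1 when no steps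
   are left. *)
pose G := \sum_(y in Z) \sum_(x in nbhd e y S') spread (k y) S' x.
pose Q : R := if k z is k'.+1 then \sum_(y in nbhd e w S') spread k' S' y else 1.
have Q0 : 0 <= Q.
  rewrite /Q; case: (k z) => // k'; apply: sumr_ge0 => y _.
  exact: spread_ge0.
have spread_w : spread (k z) S w = transmission w * Q by rewrite /Q; case: (k z).
pose A := cmean (agree_off S') phi; pose A' := cmean (agree_off S') psi.
have pairs r r' : agree_off S s r -> agree_off S t r' ->
    A r - A' r' <= G + Q * (val r w != val r' w)%:R.
  move=> /agree_offP sr /agree_offP tr'.
  have rr' u : u \notin S -> u \notin Z -> val r u = val r' u.
    move=> uS uZ; rewrite -sr // -tr' //.
    by apply: (agree_offP _ _ _ st); rewrite inE negb_or uS.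
  have S'S0 : S' \subset S0 by apply: subset_trans SS0.
  have ZS' : [disjoint Z & S'] by apply: disjointWr ZS.
  case: eqP => [rw|rw] /=.
    rewrite mulr0 addr0; apply: IH => //; apply/agree_offP => u.
    rewrite !inE !negb_or negb_and negbK => /andP[/orP[/eqP->//|uS] uZ].
    exact: rr'.
  rewrite mulr1 /Q; case Ekz: (k z) => [|k'].
    apply: (@le_trans _ _ 1); last by rewrite lerDr /G.
    by apply: cmean_sub_le => ? ? _ _; apply: phi_psi.
  pose k2 y := if y == w then k' else k y.
  have -> : G + \sum_(y in nbhd e w S') spread k' S' y =
      \sum_(y in w |: Z) \sum_(x in nbhd e y S') spread (k2 y) S' x.
    rewrite big_setU1 //= /k2 eqxx addrC; congr (_ + _); apply: eq_bigr => y yZ.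
    by case: eqP => // yw; rewrite yw (negbTE wZ) in yZ.
  apply: IH => //.
  - rewrite -setI_eq0 setIUl setU_eq0 !setI_eq0 ZS' andbT.
    by rewrite disjoints1 !inE eqxx.
  - move=> y; rewrite /k2 !inE; case: eqP => [-> _|_ /=]; last exact: Zk.
    have [_ kz zball] := Zk z zZ; rewrite Ekz in kz zball.
    have wball : w \in ball (r0 - k').
      by rewrite -subSS subSn //; apply: ball_step zball zw.
    split=> //; last exact: ltnW kz.
    by apply: (ball_C0 (leq_subr _ _) wball); apply: (subsetP SS0).
  - apply/agree_offP => u; rewrite !inE !negb_or negb_and negbK.
    by move=> /andP[/orP[/eqP->|uS] /andP[uw uZ]]; [rewrite eqxx in uw|apply: rr'].
have pairs_le r r' : agree_off S s r -> agree_off S t r' -> A r - A' r' <= G + Q.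
  move=> sr tr'; apply: (le_trans (pairs _ _ sr tr')); rewrite lerD2l.
  by case: (_ != _); rewrite ?mulr1 ?mulr0.
have sub1 : subrel (agree_off [set w] : rel T) (agree_off S).
  by apply: agree_off_sub; rewrite sub1set.
have step : cmean (agree_off S) phi s - cmean (agree_off S) psi t <=
    G + transmission w * Q.
  have sub' : subrel (agree_off S' : rel T) (agree_off S) by apply: agree_off_sub.
  rewrite -[X in X - _](cmean_cmean (eqv S') (eqv S) sub').
  rewrite -[X in _ - X](cmean_cmean (eqv S') (eqv S) sub') -/A -/A'.
  (* At low degree [w] is resampled given all other colors, which is where [site_coupling] gives the
     factor [transmission w]. *)
  have [wd|wd] := boolP (#|nbhd e w [set: V]| <= d)%N; last first.
    by rewrite /transmission (negbTE wd) mul1r; apply: cmean_sub_le.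
  rewrite -[X in X - _](cmean_cmean (eqv [set w]) (eqv S) sub1).
  rewrite -[X in _ - X](cmean_cmean (eqv [set w]) (eqv S) sub1).
  apply: cmean_sub_le => r r' sr tr'.
  rewrite /transmission wd; apply: site_coupling => // r1 r1' rr1 rr1'.
  have trans (x y y1 : T) : agree_off S x y -> agree_off [set w] y y1 -> agree_off S x y1.
    by move=> xy yy1; case: (eqv S x y y1) => _ /(_ xy) ->; apply: sub1.
  by apply: pairs; [apply: trans rr1|apply: trans rr1'].
apply: (le_trans step).
have inner y : \sum_(x in nbhd e y S') spread (k y) S' x <=
    \sum_(x in nbhd e y S') spread (k y) S x.
  by apply: ler_sum => x _; apply: spread_mono.
have nbhdS' y : nbhd e y S' = nbhd e y S :\ w.
  by apply/setP => x; rewrite !inE andbA.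
rewrite /G (bigD1 z) //= [leRHS](bigD1 z) //= addrAC lerD //.
  rewrite [leRHS](big_setD1 w) ?in_nbhd ?wS //= -nbhdS' addrC spread_w lerD2l.
  exact: inner.
apply: ler_sum => y _; apply: (le_trans (inner y)); rewrite nbhdS'.
have [wN|wN] := boolP (w \in nbhd e y S).
  by rewrite [leRHS](big_setD1 w) //= lerDr spread_ge0.
by rewrite (setDidPl _) // disjoint_sym disjoints1.
Qed.

End Disagreement.

End SpatialMixing.

(** * Decomposition of the variance into blocks *)

Section BlockDecomposition.
Context {V : finType} {q : nat} {R : realType}.
Variables (e : rel V) (d : nat).
Hypotheses (e_sym : symmetric e) (e_irr : irreflexive e).
Hypothesis q_gt : (2 * d <= q)%N.
Hypothesis q_gt0 : (0 < q)%N.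
Variables (blk : V -> {set V}) (ball : V -> nat -> {set V}) (r0 : nat) (eps : R).
Hypothesis ball0 : forall x, x \in ball x 0.
Hypothesis ball_step : forall x j u w, u \in ball x j -> e u w -> w \in ball x j.+1.
Hypothesis ball_blk : forall x j u, (j <= r0)%N -> u \in ball x j -> u \in blk x.
Hypothesis eps_gt0 : 0 < eps.
Hypothesis spread_eps : forall x (S : {set V}),
  \sum_(w in nbhd e x S) @spread V q R e d r0 S w <= eps.
Local Notation T := (proper_coloring e q).
Implicit Types (S : {set V}) (f g h : T -> R).

Let eqv C : equivalence_rel (agree_off C : rel T).
Proof. exact: agree_off_equiv. Qed.

Let cvar_sub S S' f : S \subset S' -> cvar (agree_off S) f <= cvar (agree_off S') f.
Proof.
move=> SS; rewrite [leRHS](cvar_split (eqv S) f (eqv S') (agree_off_sub SS)).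
by rewrite lerDl cvar_ge0.
Qed.

(** For positive [y] the choice [l = y / (2 * E)] turns the linear bounds into the quadratic one. *)
Lemma sqr_le_of_linear (y E P : R) : 0 < E -> 0 <= P ->
  (forall l, 0 < l -> y <= l * E + P / (2 * l)) ->
  (forall l, 0 < l -> - y <= l * E + P / (2 * l)) -> y ^+ 2 <= 2 * E * P.
Proof.
wlog y0 : y / 0 <= y.
  move=> H E0 P0 h h'; have [y0|y0] := leP 0 y; first exact: H.
  by rewrite -sqrrN; apply: H => //; rewrite ?opprK // oppr_ge0 ltW.
move=> E0 P0 h _; have [->|yn0] := eqVneq y 0.
  by rewrite expr0n /= !mulr_ge0 // ltW.
have y1 : 0 < y by rewrite lt_neqAle eq_sym yn0.
have := h (y / (2 * E)) _; rewrite divr_gt0 ?mulr_gt0 // => /(_ isT).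
have -> : y / (2 * E) * E + P / (2 * (y / (2 * E))) = y / 2 + P * E / y.
  by field; rewrite !gt_eqF.
move=> h1; have : y * (y / 2) <= y * (P * E / y) by rewrite ler_wpM2l //; lra.
rewrite [leRHS]mulrC divfK ?gt_eqF //; nra.
Qed.

(** [h] does not see the colors in the block of [x], so the color of [x] matters only if a
    disagreement leaves the block, which has probability at most [eps]. The bound is a
    Cauchy-Schwarz inequality for the coupling, in dual form. *)
Lemma disagreement_variance S x h s t : x \in S ->
  (forall s t, agree_off (S :&: blk x) s t -> h s = h t) ->
  agree_off S s t ->
  (cmean (agree_off (S :\ x)) h s - cmean (agree_off (S :\ x)) h t) ^+ 2 <=
  2 * eps * (cmean (agree_off (S :\ x)) (fun s => h s ^+ 2) s +
             cmean (agree_off (S :\ x)) (fun s => h s ^+ 2) t).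
Proof.
move=> xS h_inv.
have bound (l : R) s' t' : 0 < l -> agree_off S s' t' ->
    cmean (agree_off (S :\ x)) h s' - cmean (agree_off (S :\ x)) h t' <=
    l * eps + (cmean (agree_off (S :\ x)) (fun s => h s ^+ 2) s' +
               cmean (agree_off (S :\ x)) (fun s => h s ^+ 2) t') / (2 * l).
  move=> l0 st'; pose b : R := (2 * l)^-1.
  have b0 : 0 < b by rewrite invr_gt0 mulr_gt0.
  (* The quadratic corrections give [phi r - psi r' <= 1] by completing a square, whatever the size
     of [h]. *)
  pose phi r := l^-1 * (h r + - b * h r ^+ 2).
  pose psi r := l^-1 * (h r + b * h r ^+ 2).
  have pp r r' : phi r - psi r' <= 1.
    rewrite /phi /psi -mulrBr ler_pdivrMl // mulr1.
    have k u : u <= l / 2 + b * u ^+ 2.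
      have : 0 <= b * (u - l) ^+ 2 by rewrite mulr_ge0 ?sqr_ge0 // ltW.
      have -> : b * (u - l) ^+ 2 = b * u ^+ 2 - u + l / 2.
        by rewrite /b; field; rewrite gt_eqF.
      lra.
    have := k (h r); have := k (- h r'); rewrite sqrrN; lra.
  have pp0 r r' : agree_off (S :&: blk x) r r' -> phi r - psi r' <= 0.
    move=> /h_inv E; rewrite /phi /psi -mulrBr E pmulr_rle0 ?invr_gt0 //.
    have : 0 <= b * h r' ^+ 2 by rewrite mulr_ge0 ?sqr_ge0 // ltW.
    lra.
  have := @disagreement_bound V q R e d e_sym e_irr q_gt q_gt0 (S :\ x)
    (S :&: blk x) (ball x) r0 phi psi (@ball_step x) _ pp pp0 #|S| (S :\ x)
    [set x] (fun=> r0) s' t' _ (subxx _) _ _ _.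
  have xin : x \in blk x by apply: (ball_blk (leq0n _) (ball0 x)).
  have H1 j u : (j <= r0)%N -> u \in ball x j -> u \in S :\ x -> u \in S :&: blk x.
    move=> jr uj; rewrite !inE => /andP[_ ->] /=; exact: ball_blk uj.
  have H2 : (#|S :\ x| <= #|S|)%N by rewrite subset_leq_card // subsetDl.
  have H3 : [disjoint [set x] & S :\ x] by rewrite disjoints1 !inE eqxx.
  have H4 z : z \in [set x] ->
      [/\ z \in S :&: blk x, (r0 <= r0)%N & z \in ball x (r0 - r0)].
    by move=> /set1P ->; rewrite subnn inE xS.
  have H5 : agree_off (S :\ x :|: [set x]) s' t' by rewrite setUC setD1K.
  move=> /(_ H1 H2 H3 H4 H5); rewrite big_set1 => /le_trans /(_ (spread_eps _ _)).
  rewrite /phi /psi !cmeanZ !cmeanD !cmeanZ -mulrBr ler_pdivrMl // -/b.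
  set c1 := cmean _ h _; set c2 := cmean _ h _; set c3 := cmean _ _ s'.
  set c4 := cmean _ _ t'; move=> H; rewrite [_ / (2 * l)]mulrC -/b; lra.
have pos s' : 0 <= cmean (agree_off (S :\ x)) (fun s => h s ^+ 2) s'.
  rewrite -(cmean_const (eqv (S :\ x)) 0 s'); apply: cmean_le => // r _.
  exact: sqr_ge0.
move=> st; apply: sqr_le_of_linear => //; first by rewrite addr_ge0.
  by move=> l l0; apply: bound.
move=> l l0; have ts : agree_off S t s by rewrite agree_off_sym.
by have := bound l t s l0 ts; rewrite opprB [X in _ + X / _]addrC.
Qed.

(** The variance gained by revealing [x]. The part [f - f1] contributes at most the variance in the
    block of [x]; [f1] is constant on recolorings within the block, so after centering it falls
    under [disagreement_variance]. *)
Lemma influence_variance S x f : x \in S ->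
  cvar (agree_off S) (cmean (agree_off (S :\ x)) f) <=
  2 * cvar (agree_off (blk x)) f + 4 * eps * cvar (agree_off [set: V]) f.
Proof.
move=> xS.
pose f1 := cmean (agree_off (S :&: blk x)) f.
pose h s := f1 s - cmean (agree_off S) f1 s.
pose A := cmean (agree_off (S :\ x)) h.
pose B := cmean (agree_off (S :\ x)) (fun s => f s - f1 s).
have subI : subrel (agree_off (S :&: blk x) : rel T) (agree_off S).
  exact/agree_off_sub/subsetIl.
have subD : subrel (agree_off (S :\ x) : rel T) (agree_off S).
  exact/agree_off_sub/subsetDl.
have h_inv s t : agree_off (S :&: blk x) s t -> h s = h t.
  move=> st; rewrite /h /f1 (cmean_inv (eqv _) f st); congr (_ - _).
  by apply: cmean_inv => //; apply: subI.
have hS s : cmean (agree_off S) h s = 0.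
  rewrite cmeanB [X in _ - X](cmean_id (eqv S)) ?subrr // => t st.
  by rewrite -(cmean_inv (eqv S) f1 st).
have sumA : \sum_s A s ^+ 2 <= 2 * eps * \sum_s h s ^+ 2.
  rewrite -(sum_cmeanT (eqv (S :\ x)) (fun s => h s ^+ 2)).
  apply: (sqr_le_cmean (eqv S)); first by rewrite mulr_ge0 // ltW.
    by move=> s t st; apply: disagreement_variance.
  by move=> s; rewrite (cmean_cmean (eqv _) (eqv S) subD) hS.
have sumh : \sum_s h s ^+ 2 <= cvar (agree_off [set: V]) f.
  apply: (@le_trans _ _ (cvar (agree_off S) f)); last exact/cvar_sub/subsetT.
  by rewrite (cvar_split (eqv _) f (eqv S) subI) lerDr cvar_ge0.
have sumB : \sum_s B s ^+ 2 <= cvar (agree_off (blk x)) f.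
  apply: le_trans (sqr_cmean_le (eqv _) _) _.
  exact/(cvar_sub _ (subsetIr S (blk x))).
have -> : cvar (agree_off S) (cmean (agree_off (S :\ x)) f) =
    \sum_s (B s + A s) ^+ 2.
  apply: eq_bigr => s _; congr (_ ^+ 2).
  rewrite (cmean_cmean (eqv _) (eqv S) subD) /B /A !cmeanB.
  rewrite [cmean _ (cmean _ f1) s](cmean_id (eqv _)); last first.
    by move=> t st; rewrite -(cmean_inv (eqv S) f1 (subD _ _ st)).
  rewrite [in cmean (agree_off S) f1 s]/f1 (cmean_cmean (eqv _) (eqv S) subI).
  by rewrite addrA subrK.
apply: (@le_trans _ _ (\sum_s (2 * B s ^+ 2 + 2 * A s ^+ 2))).
  apply: ler_sum => s _; rewrite -subr_ge0.
  have -> : 2 * B s ^+ 2 + 2 * A s ^+ 2 - (B s + A s) ^+ 2 = (B s - A s) ^+ 2.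
    by ring.
  exact: sqr_ge0.
rewrite big_split /= -!mulr_sumr; apply: lerD; first by rewrite ler_wpM2l.
have -> : 4 * eps * cvar (agree_off [set: V]) f =
   2 * (2 * eps * cvar (agree_off [set: V]) f) by ring.
rewrite ler_wpM2l //; apply: (le_trans sumA); rewrite ler_wpM2l // mulr_ge0 //.
exact: ltW.
Qed.

Lemma cvar_blocks_rec n S f : (#|S| <= n)%N ->
  cvar (agree_off S) f <= \sum_(x in S)
    (2 * cvar (agree_off (blk x)) f + 4 * eps * cvar (agree_off [set: V]) f).
Proof.
elim: n S => [|n IH] S Sn; have [->|[x xS]] := set_0Vmem S.
- rewrite big_set0; apply: (@le_trans _ _ (\sum_(s : T) 0)); last by rewrite big1.
  apply: ler_sum => s _; rewrite cmean_id ?subrr ?expr0n // => t /agree_offP st.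
  by congr f; apply/val_inj/ffunP => u; rewrite st ?inE.
- by move: Sn; rewrite leqn0 cards_eq0 => /eqP S0; rewrite S0 inE in xS.
- rewrite big_set0; apply: (@le_trans _ _ (\sum_(s : T) 0)); last by rewrite big1.
  apply: ler_sum => s _; rewrite cmean_id ?subrr ?expr0n // => t /agree_offP st.
  by congr f; apply/val_inj/ffunP => u; rewrite st ?inE.
rewrite (cvar_split (eqv (S :\ x)) f (eqv S)); last exact/agree_off_sub/subsetDl.
rewrite (big_setD1 x) //= [leLHS]addrC; apply: lerD.
  exact: influence_variance.
by apply: IH; move: Sn; rewrite (cardsD1 x) xS.
Qed.

(** The hypothesis on [eps] makes the error at most half of the left side; absorbing it doubles the
    factor 2 of [influence_variance]. *)
Lemma cvar_blocks f : 8 * eps * #|V|%:R <= 1 ->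
  cvar (agree_off [set: V]) f <= 4 * \sum_x cvar (agree_off (blk x)) f.
Proof.
move=> epsV; have := @cvar_blocks_rec #|V| [set: V] f (max_card _).
rewrite big_split /= sumr_const -mulr_sumr cardsT -[X in _ + X]mulr_natr.
have -> : \sum_(x in [set: V]) cvar (agree_off (blk x)) f =
    \sum_x cvar (agree_off (blk x)) f by apply: eq_bigl => x; rewrite inE.
have : 0 <= cvar (agree_off [set: V]) f by apply: cvar_ge0.
move: (cvar _ f) (\sum_x _) => v w v0 h.
have : 8 * eps * #|V|%:R * v <= v by rewrite ler_piMl.
lra.
Qed.

End BlockDecomposition.

(** * Self-avoiding paths in balls; blocks *)

Section BallGeometry.
Context {V : finType}.
Variable e : rel V.
Hypotheses (e_sym : symmetric e) (e_irr : irreflexive e).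
Implicit Types (u v w x y : V) (p : seq V).

Definition nat_ball x (j : nat) : {set V} :=
  [set u | if gdist e x u is Some k then (k <= j)%N else false].

Lemma in_nat_ballP x j u :
  reflect (exists2 k, (k <= j)%N & has_walk e x u k) (u \in nat_ball x j).
Proof.
rewrite inE; apply: (iffP idP) => [|[k kj /walk_gdist[i -> ik]]].
  by case E: gdist => [k|//] kj; exists k => //; have [] := gdist_some E.
exact: leq_trans kj.
Qed.

Lemma nat_ball_refl x j : x \in nat_ball x j.
Proof. by apply/in_nat_ballP; exists 0; last exact: has_walk0. Qed.

Lemma nat_ball_step x j u w : u \in nat_ball x j -> e u w -> w \in nat_ball x j.+1.
Proof.
move=> /in_nat_ballP[k kj xu] uw; apply/in_nat_ballP; exists (k + 1)%N.
  by rewrite addn1.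
exact: has_walk_cat xu (has_walk1 uw).
Qed.

Lemma has_walk_last x u k : has_walk e x u k.+1 ->
  exists2 w, has_walk e x w k & e w u.
Proof.
move=> /has_walkP[p]; case/lastP: p => [|p z] [] //.
rewrite size_rcons rcons_path last_rcons => -[sp] /andP[pp zl] <-.
by exists (last x p) => //; apply/has_walkP; exists p.
Qed.

Lemma nat_ball_connect x j (S : {set V}) u : nat_ball x j \subset S ->
  u \in nat_ball x j -> connect (edge_in e S) x u.
Proof.
move=> /subsetP BS /in_nat_ballP[k]; elim: k u => [|k IH] u kj.
  by move=> /has_walkP[p [/size0nil -> _ <-]]; apply: connect0.
move=> xu; have [w xw wu] := has_walk_last xu.
apply: connect_trans (IH w (ltnW kj) xw) _; apply: connect1.
rewrite /edge_in /= wu !BS //; apply/in_nat_ballP; first by exists k.+1.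
by exists k => //; apply: ltnW.
Qed.

Lemma nat_ball_connected x j : connected_set e (nat_ball x j).
Proof.
move=> u w uB wB; apply: connect_trans (nat_ball_connect (subxx _) wB).
by rewrite (edge_in_connect_sym e_sym) (nat_ball_connect (subxx _) uB).
Qed.

(** * The length of self-avoiding paths in a ball of bounded excess *)

Section SelfAvoidingLength.
Variables (x : V) (l s : nat).
Let W := nat_ball x l.
Hypothesis W_excess : (n_edges e W + 1 <= #|W| + s)%N.

Let depth u := if gdist e x u is Some k then k else 0%N.

(** Defines a breadth-first tree of the ball rooted at [x]; by [parentP] the default [u] is not
    taken at any other vertex of the ball. *)
Let parent u := odflt u
  [pick w | [&& e w u, w \in W & (depth w).+1 == depth u]].

Let depth_le u : u \in W -> (depth u <= l)%N.
Proof. by rewrite inE /depth; case: gdist. Qed.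

Let parentP u : u \in W -> u != x ->
  [/\ e (parent u) u, parent u \in W & (depth (parent u)).+1 = depth u].
Proof.
move=> uW ux; rewrite /parent; case: pickP => [w /and3P[wu wW /eqP dw]//|none].
have := uW; rewrite inE; case E: gdist => [k|//] kl.
have [xu umin] := gdist_some E; case: k E kl xu umin => [|k] E kl xu umin.
  by move/has_walkP: xu ux => [p [/size0nil -> _ /= <-]]; rewrite eqxx.
have [w xw wu] := has_walk_last xu.
have [j wj jk] := walk_gdist xw.
have kj : (k <= j)%N.
  have [xwj _] := gdist_some wj.
  by rewrite -ltnS; apply: umin; rewrite -addn1; apply: has_walk_cat (has_walk1 wu).
have wW : w \in W by rewrite inE wj (leq_trans jk) // ltnW.
by have := none w; rewrite wu wW /depth wj E eqSS eqn_leq jk kj.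
Qed.

Let tree_edges := [set [set u; parent u] | u in W :\ x].

Let card_tree_edges : #|tree_edges| = (#|W|).-1.
Proof.
rewrite card_in_imset; first by rewrite (cardsD1 x W) nat_ball_refl.
move=> u w /setD1P[ux uW] /setD1P[wx wW] E.
have [_ _ du] := parentP uW ux; have [_ _ dw] := parentP wW wx.
have : u \in [set w; parent w] by rewrite -E !inE eqxx.
case/set2P => // uw; have : w \in [set u; parent u] by rewrite E !inE eqxx.
case/set2P => // wu; rewrite -wu in du; rewrite -uw in dw.
by move: dw; rewrite -du => /esym /eqP; rewrite -addn2 -{1}[depth w]addn0 eqn_add2l.
Qed.

Let card_extra_edges : (#|induced_edges e W :\: tree_edges| <= s)%N.
Proof.
have sub : tree_edges \subset induced_edges e W.
  apply/subsetP => _ /imsetP[u /setD1P[ux uW] ->].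
  have [pu pW _] := parentP uW ux; rewrite !inE; apply/andP; split.
    apply/existsP; exists u; apply/existsP; exists (parent u).
    by rewrite e_sym pu eqxx.
  by apply/subsetP => z /set2P[]->.
have W0 : (0 < #|W|)%N by apply/card_gt0P; exists x; apply: nat_ball_refl.
rewrite cardsD (setIidPr sub) card_tree_edges.
move: W_excess W0; rewrite /n_edges; clear; lia.
Qed.

Fixpoint path_edges u p : seq {set V} :=
  if p is w :: p' then [set u; w] :: path_edges w p' else [::].

Lemma path_edges_sub u p A z : A \in path_edges u p -> z \in A -> z \in u :: p.
Proof.
elim: p u => [//|w p IH] u; rewrite [path_edges _ _]/= inE => /orP[/eqP->|Ap zA].
  by move=> /set2P[]->; rewrite !inE eqxx ?orbT.
by rewrite inE (IH _ Ap zA) orbT.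
Qed.

Lemma path_edges_uniq u p : uniq (u :: p) -> uniq (path_edges u p).
Proof.
elim: p u => [//|w p IH] u; rewrite cons_uniq => /andP[uN unq] /=.
rewrite IH // andbT; apply: contra uN => uw; apply: path_edges_sub uw _.
by rewrite !inE eqxx.
Qed.

Lemma path_edges_induced u p (S : {set V}) : path e u p -> {subset u :: p <= S} ->
  {subset path_edges u p <= induced_edges e S}.
Proof.
elim: p u => [//|w p IH] u /= /andP[uw pp] sub A; rewrite inE => /orP[/eqP->|].
  rewrite !inE; apply/andP; split.
    by apply/existsP; exists u; apply/existsP; exists w; rewrite uw eqxx.
  by apply/subsetP => z /set2P[]->; apply: sub; rewrite !inE eqxx ?orbT.
by apply: IH => // z zp; apply: sub; rewrite inE zp orbT.
Qed.

Let extra u p := count [predC tree_edges] (path_edges u p).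

(** Bounds the tree edges before the next non-tree edge: a path climbing from [u] makes at most
    [depth u] steps up and then [l] down; a descending one has at most [l - depth u] left. *)
Let slack u p := if p is w :: _ then
    if (u != x) && (w == parent u) then (depth u + l)%N
    else if (w != x) && (u == parent w) then (l - depth u)%N else 0%N
  else 0%N.

Let slack_le u p : (slack u p <= depth u + l)%N.
Proof.
case: p => [//|w p] /=; case: ifP => // _; case: ifP => // _.
exact: leq_trans (leq_subr _ _) (leq_addl _ _).
Qed.

(** Within a run of tree edges a self-avoiding path cannot climb after descending, so each run has
    at most [2 * l] edges; every extra edge is charged for itself and one run. *)
Let size_le_slack u p : path e u p -> uniq (u :: p) -> {subset u :: p <= W} ->
  (size p <= (2 * l).+1 * extra u p + slack u p)%N.
Proof.
elim: p u => [//|w p IH] u /= /andP[uw pp] unq sub.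
have uW : u \in W by apply: sub; rewrite inE eqxx.
have wW : w \in W by apply: sub; rewrite !inE eqxx orbT.
have unq' : uniq (w :: p) by move: unq => /andP[].
have sub' : {subset w :: p <= W} by move=> z zp; apply: sub; rewrite inE zp orbT.
have le := IH w pp unq' sub'; have sl := slack_le w p.
have dw := depth_le wW; have du := depth_le uW.
rewrite {1}/extra /= -/(extra w p).
have tree_par v : v \in W -> v != x -> [set v; parent v] \in tree_edges.
  by move=> vW vx; apply: imset_f; rewrite in_setD1 vx.
have [/andP[ux /eqP wpar]|notup] := boolP ((u != x) && (w == parent u)).
  have [_ _ dpu] := parentP uW ux; rewrite -wpar in dpu.
  rewrite {1}wpar [in X in (X + _)%N]/= tree_par //=.
  move: le sl dpu; clear; lia.
have [/andP[wx /eqP upar]|notdown] := boolP ((w != x) && (u == parent w)).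
  have [_ _ dpw] := parentP wW wx; rewrite -upar in dpw.
  rewrite {1}upar setUC tree_par //= add0n.
  (* After a step down, a step up would return to [u]. *)
  have sl' : (slack w p <= l - depth w)%N.
    case: p unq {IH pp sub unq' sub' le sl} => [//|z p] unq /=.
    case: ifP => [/andP[_ /eqP zu]|_]; last by case: ifP.
    by move: unq; rewrite zu -upar !inE eqxx orbT.
  move: le sl' dpw dw; clear; lia.
have -> : [set u; w] \notin tree_edges.
  apply/imsetP => -[v /setD1P[vx vW] E].
  have : v \in [set u; w] by rewrite E !inE eqxx.
  have pv : parent v \in [set u; w] by rewrite E !inE eqxx orbT.
  have [pe _ _] := parentP vW vx.
  have pvN : parent v != v by apply: contraTneq pe => ->; rewrite e_irr.
  move=> /set2P[vE|vE]; rewrite vE in vx pv pvN; move: pv => /set2P[pE|pE].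
  - by rewrite pE eqxx in pvN.
  - by rewrite vx pE eqxx in notup.
  - by rewrite vx pE eqxx in notdown.
  - by rewrite pE eqxx in pvN.
move: le sl dw; clear; lia.
Qed.

Lemma self_avoiding_size u p : path e u p -> uniq (u :: p) ->
  {subset u :: p <= W} -> (size (u :: p) <= 2 * s.+1 * l.+1)%N.
Proof.
move=> pp unq sub; have := size_le_slack pp unq sub.
have : (extra u p <= s)%N.
  apply: leq_trans card_extra_edges; rewrite /extra -size_filter.
  rewrite -(card_uniqP _); last by rewrite filter_uniq // path_edges_uniq.
  apply/subset_leq_card/subsetP => A; rewrite mem_filter /= inE => /andP[-> Ap].
  exact: path_edges_induced sub _ Ap.
have uW : u \in W by apply: sub; rewrite inE eqxx.
have := slack_le u p; have := depth_le uW.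
move: (slack u p) (extra u p) (depth u) => a b c; rewrite /=; clear; nia.
Qed.

End SelfAvoidingLength.

End BallGeometry.

Lemma has_walk_sym (V : finType) (e : rel V) (u v : V) k :
  symmetric e -> has_walk e u v k -> has_walk e v u k.
Proof.
move=> e_sym; elim: k v => [|k IH] v.
  by move=> /has_walkP[p [/size0nil -> _ /= <-]]; apply: has_walk0.
move=> /has_walk_last[w /IH wu wv].
by apply: has_walk_cons wu; rewrite e_sym.
Qed.

Lemma gdistC (V : finType) (e : rel V) (u v : V) :
  symmetric e -> gdist e u v = gdist e v u.
Proof.
move=> e_sym; case E: (gdist e u v) => [j|]; case F: (gdist e v u) => [k|] //.
- have [uv umin] := gdist_some E; have [vu vmin] := gdist_some F.
  congr Some; apply/eqP; rewrite eqn_leq.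
  by rewrite umin ?vmin //; apply: has_walk_sym.
- have [uv _] := gdist_some E.
  by have [i] := walk_gdist (has_walk_sym e_sym uv); rewrite F.
- have [vu _] := gdist_some F.
  by have [i] := walk_gdist (has_walk_sym e_sym vu); rewrite E.
Qed.

Lemma ball_vertices_nat (R : realType) (V : finType) (e : rel V) (x : V) (l : R) :
  symmetric e -> 0 <= l -> ball_vertices e x l = nat_ball e x (Num.truncn l).
Proof.
move=> e_sym l0; apply/setP => u; rewrite !inE gdistC //.
by case: (gdist e x u) => // k; rewrite truncn_ge_nat.
Qed.

Lemma ball_tree_excess_le (R : realType) (V : finType) (e : rel V) (x : V)
    (l t : R) (T0 : nat) : symmetric e -> 0 <= l -> t <= T0%:R ->
  (ball_tree_excess e x l)%:~R <= t ->
  (n_edges e (nat_ball e x (Num.truncn l)) + 1 <=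
   #|nat_ball e x (Num.truncn l)| + T0)%N.
Proof.
move=> e_sym l0 tT; rewrite /ball_tree_excess /tree_excess ball_vertices_nat // => h.
have := le_trans h tT; rewrite -[T0%:R]/(T0%:~R) ler_int /n_edges; lia.
Qed.

Section Blocks.
Context {V : finType}.
Variable e : rel V.
Hypotheses (e_sym : symmetric e) (e_irr : irreflexive e).
Variables (d r h l s : nat).
Implicit Types (u v w x y : V) (p : seq V).

Definition high_degree u := (d < #|nbhd e u [set: V]|)%N.

(** The relation is directed: only high-degree vertices are left, so a block gains the clusters of
    such vertices with their low-degree neighbours and stops there. *)
Definition leave_high : rel V := [rel u w | e u w && high_degree u].

Definition block x : {set V} :=
  [set u | [exists y, (y \in nat_ball e x r) && connect leave_high y u]].

Lemma in_blockP x u :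
  reflect (exists2 y, y \in nat_ball e x r & connect leave_high y u) (u \in block x).
Proof.
by rewrite inE; apply: (iffP existsP) => [[y /andP[]]|[y yx yu]];
  exists y => //; rewrite yx.
Qed.

Lemma nat_ball_block x j u : (j <= r)%N -> u \in nat_ball e x j -> u \in block x.
Proof.
move=> jr /in_nat_ballP[k kj xu]; apply/in_blockP; exists u; last exact: connect0.
by apply/in_nat_ballP; exists k => //; apply: leq_trans jr.
Qed.

Lemma block_refl x : x \in block x.
Proof. exact: (nat_ball_block (leq0n _) (nat_ball_refl _ _ _)). Qed.

(** A high-degree vertex of the block has all its neighbours in the block; any other vertex has at
    most [d] neighbours altogether. *)
Lemma block_boundary x u : u \in block x -> (#|nbhd e u (~: block x)| <= d)%N.
Proof.
move=> /in_blockP[y yx yu]; have [ud|] := leqP (#|nbhd e u [set: V]|) d.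
  apply: leq_trans ud; apply/subset_leq_card/subsetP => w.
  by rewrite !in_nbhd inE => /andP[_ ->]; rewrite inE.
move=> ud; rewrite (_ : nbhd _ _ _ = set0) ?cards0 //; apply/setP => w.
rewrite in_nbhd in_setC in_set0; apply/negbTE; rewrite negb_and negbK.
have [uw|] := boolP (e u w); last by rewrite orbT.
rewrite orbF; apply/in_blockP; exists y => //.
by apply: connect_trans yu _; apply: connect1; rewrite /leave_high /= uw.
Qed.

Lemma block_connected x : connected_set e (block x).
Proof.
suff H u : u \in block x -> connect (edge_in e (block x)) x u.
  move=> u w uB wB; apply: connect_trans (H w wB).
  by rewrite (edge_in_connect_sym e_sym) H.
move=> /in_blockP[y yx yu].
apply: connect_trans (nat_ball_connect _ yx) _.
  by apply/subsetP => z; apply: nat_ball_block.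
have /connectP[p pp ->] := yu.
suff K z : connect leave_high y z -> path leave_high z p ->
    connect (edge_in e (block x)) z (last z p) by apply: K.
elim: p z {pp yu} => [|w p IH] z yz /=; first by rewrite connect0.
move=> /andP[zw pw]; have yw := connect_trans yz (connect1 zw).
apply: connect_trans (IH w yw pw); apply: connect1; rewrite /edge_in /=.
have /andP[-> _] := zw; rewrite andbT; apply/andP; split; apply/in_blockP;
  by exists y.
Qed.

Hypothesis high_paths : forall p, sorted e p -> uniq p ->
  all high_degree p -> (size p <= h)%N.

(** On a simple path leaving the inner ball along [leave_high], all vertices but the last have high
    degree, so it has at most [h] edges. *)
Lemma block_nat_ball x : (r + h <= l)%N -> block x \subset nat_ball e x l.
Proof.
move=> rhl; apply/subsetP => u /in_blockP[y /in_nat_ballP[k kr xy]].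
move=> /connectP[p0 pp0 ->]; case: (shortenP pp0) => p pp unq _.
have sub : subrel leave_high e by move=> a b /andP[].
have ph : (size p <= h)%N.
  rewrite -(size_belast y p); apply: high_paths.
  - rewrite -(take_size_cat [:: last y p] (size_belast y p)) cats1 -lastI.
    by apply: take_sorted; apply: sub_path sub _ _ pp.
  - by move: unq; rewrite lastI rcons_uniq => /andP[].
  - elim: p y pp {unq xy pp0} => //= w p IH y /andP[/andP[_ ->] pp] /=.
    exact: IH.
apply/in_nat_ballP; exists (k + size p)%N.
  by apply: leq_trans rhl; apply: leq_add.
apply: has_walk_cat xy _; apply/has_walkP; exists p; split=> //.
exact: sub_path sub _ _ pp.
Qed.

End Blocks.

Section PathSums.
Context {R : realFieldType} {V : finType}.
Variables (e : rel V) (f : V -> R) (l : nat) (M : R).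
Hypothesis f_le : forall p, sorted e p -> uniq p -> (size p <= l.+1)%N ->
  \sum_(u <- p) f u <= M.

Lemma path_sum_le c p : sorted e p -> uniq p -> (size p <= c * l.+1)%N ->
  \sum_(u <- p) f u <= c%:R * M.
Proof.
elim: c p => [|c IH] p sp up.
  by rewrite leqn0 size_eq0 mul0r => /eqP->; rewrite big_nil.
move=> pc; rewrite -(cat_take_drop l.+1 p) big_cat -natr1 mulrDl mul1r /=.
have hd : \sum_(u <- drop l.+1 p) f u <= c%:R * M.
  apply: IH; [exact: drop_sorted|exact: drop_uniq|].
  by rewrite size_drop leq_subLR -mulSn.
have ht : \sum_(u <- take l.+1 p) f u <= M.
  apply: f_le; [exact: take_sorted|exact: take_uniq|].
  by rewrite size_take; case: ltnP.
by rewrite [leRHS]addrC; apply: lerD.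
Qed.

End PathSums.

Lemma path_weight_le_max (R : realType) (V : finType) (e : rel V) (a l : R) p :
  0 <= l -> sorted e p -> uniq p -> ((size p).-1)%:R <= l ->
  path_weight e a p <= max_path_weight e a l.
Proof.
move=> l0; case: p => [|u p] sp up pl.
  rewrite /path_weight big_nil; exact: bigmax_ge_id.
have kV : (size p < #|V|)%N.
  by rewrite -[(size p).+1]/(size (u :: p)) -(card_uniqP up) max_card.
have sz : size (u :: p) == (Ordinal kV).+1 by [].
rewrite /max_path_weight.
apply: le_trans (le_bigmax_cond _ (j := Ordinal kV) _ _) => //.
apply: (le_bigmax_cond _ (j := Tuple sz)
  (fun t : (Ordinal kV).+1.-tuple V => path_weight e a t)).
by apply/andP.
Qed.

(** * From the Poincare inequality to the mixing time *)

Section Mixing.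
Context {V : finType} {q : nat} {R : realType}.
Variable e : rel V.
Hypotheses (e_sym : symmetric e) (e_irr : irreflexive e).
Local Notation T := (proper_coloring e q).
Implicit Types (s t x y : T) (f g h : T -> R).

Let eqv C : equivalence_rel (agree_off C : rel T).
Proof. exact: agree_off_equiv. Qed.

(** The available colors at [v] correspond to the proper colorings that agree with [s] off [v], so
    an update is uniform on the class of [s]. *)
Lemma update_probE v s t : update_prob e v (val s) (val t) =
  (agree_off [set v] s t)%:R / #|agree_off [set v] s|%:R :> R.
Proof.
have avail r : agree_off [set v] s r -> val r v \in available_colors e (val s) v.
  move=> /agree_offP sr; rewrite inE; apply/imsetP => -[w]; rewrite inE => vw E.
  have wv : w \notin [set v] by rewrite inE; apply: contraTneq vw => ->; rewrite e_irr.
  by have := proper_edge r vw; rewrite E -sr // eqxx.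
have -> : #|agree_off [set v] s| = #|available_colors e (val s) v|.
  rewrite -(@card_in_imset _ _ (fun r : T => val r v)).
    apply: eq_card => c; apply/imsetP/idP => [[r rs ->]|]; first exact: avail.
    rewrite inE => cN; have [r sr rc] : exists2 r, agree_off [set v] s r & val r v = c.
      apply: recolor_proper => //; apply: contra cN => /imsetP[w].
      by rewrite in_nbhd => /andP[_ vw] ->; apply: imset_f; rewrite inE.
    by exists r.
  by move=> r r'; apply: agree_off1_inj.
rewrite /update_prob.
have -> : [forall w, (w != v) ==> (val t w == val s w)] = agree_off [set v] s t.
  by apply: eq_forallb => w; rewrite inE [val t w == _]eq_sym.
case st: (agree_off [set v] s t) => /=; last by rewrite mul0r.
by rewrite avail // mul1r.
Qed.

Lemma gibbs_samplerC s t :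
  gibbs_sampler s t = gibbs_sampler t s :> R.
Proof.
apply: eq_bigr => v _; congr (_ * _); rewrite !update_probE.
rewrite [agree_off _ t s]agree_off_sym.
case st: (agree_off [set v] s t); rewrite ?mul0r // !mul1r.
congr (_%:R^-1); apply: eq_card => r; rewrite !unfold_in.
by case: (eqv [set v] s t r) => _ /(_ st).
Qed.

Lemma sum_gibbs_sampler f s :
  \sum_t gibbs_sampler s t * f t =
  #|V|%:R^-1 * \sum_v cmean (agree_off [set v]) f s.
Proof.
rewrite /gibbs_sampler; under eq_bigr do rewrite mulr_suml.
rewrite exchange_big mulr_sumr; apply: eq_bigr => v _.
rewrite /cmean [X in _ * (X / _)]big_mkcond /= mulr_suml mulr_sumr.
apply: eq_bigr => t _; rewrite update_probE -mulrA.
by case: (agree_off _ s t); rewrite ?mul0r // mul1r [_^-1 * f t]mulrC.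
Qed.

Section Decay.
Variables (Gam : R).
Hypothesis n0 : (0 < #|V|)%N.
Hypothesis Gam0 : 0 < Gam.
Hypothesis poincare : forall f,
  cvar (agree_off [set: V]) f <= Gam * \sum_v cvar (agree_off [set v]) f.

Let n : R := #|V|%:R.
Let nr0 : 0 < n. Proof. by rewrite ltr0n. Qed.
Let N : R := #|T|%:R.

Let agreeT s t : agree_off [set: V] s t = true.
Proof. by apply/agree_offP => v; rewrite inE. Qed.

Let cmeanT f s : cmean (agree_off [set: V]) f s = (\sum_t f t) / N.
Proof.
rewrite /cmean (eq_bigl predT) => [|t]; last by rewrite agreeT.
congr (_ / _%:R); apply: eq_card => t; rewrite unfold_in; exact: agreeT.
Qed.

(** Jensen's inequality passes from the average of the projections to the average of their squares.
    By [sqr_cmean] each projection loses exactly its local variance, and the Poincare inequality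
    bounds the total loss below. *)
Lemma sampler_contracts f : \sum_s f s = 0 ->
  \sum_s (\sum_t gibbs_sampler s t * f t) ^+ 2 <=
  (1 - (Gam * n)^-1) * \sum_s f s ^+ 2.
Proof.
move=> f0.
have varT : \sum_s f s ^+ 2 = cvar (agree_off [set: V]) f.
  by apply: eq_bigr => s _; rewrite cmeanT f0 mul0r subr0.
pose S2 v := \sum_s cmean (agree_off [set v]) f s ^+ 2.
have jensen s : (\sum_t gibbs_sampler s t * f t) ^+ 2 <=
    n^-1 * \sum_v cmean (agree_off [set v]) f s ^+ 2.
  rewrite sum_gibbs_sampler -/n; pose c v := cmean (agree_off [set v]) f s.
  pose m := n^-1 * \sum_v c v.
  have : 0 <= n^-1 * \sum_v (c v - m) ^+ 2.
    by rewrite mulr_ge0 ?invr_ge0 ?(ltW nr0) // sumr_ge0 // => v _; apply: sqr_ge0.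
  have -> : \sum_v (c v - m) ^+ 2 = \sum_v c v ^+ 2 - n * m ^+ 2.
    transitivity (\sum_v (c v ^+ 2 + (- (2 * m)) * c v + m ^+ 2)).
      by apply: eq_bigr => v _; ring.
    rewrite !big_split /= -mulr_sumr sumr_const -(mulr_natr (m ^+ 2)) -/n.
    have -> : \sum_v c v = n * m by rewrite /m mulrA mulfV ?mul1r // gt_eqF.
    ring.
  rewrite mulrBr mulrA mulVf ?mul1r ?gt_eqF // subr_ge0; exact.
apply: le_trans; first by apply: ler_sum => s _; exact: jensen.
rewrite -mulr_sumr exchange_big /=.
have -> : \sum_v \sum_s cmean (agree_off [set v]) f s ^+ 2 =
    n * \sum_s f s ^+ 2 - \sum_v cvar (agree_off [set v]) f.
  rewrite /n mulr_natl -sumr_const -sumrB; apply: eq_bigr => v _.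
  by rewrite (sqr_cmean (eqv [set v]) f) addrC addKr.
rewrite mulrBr mulrA mulVf ?gt_eqF // mul1r mulrBl mul1r lerD2l lerN2.
rewrite invfM [Gam^-1 * _]mulrC -mulrA ler_wpM2l ?invr_ge0 ?(ltW nr0) //.
by rewrite varT ler_pdivrMl.
Qed.

Let law (x : T) k : T -> R := step_dist (@gibbs_sampler R V e q) x k.

Lemma sum_gibbs_sampler_cst f : \sum_s \sum_t gibbs_sampler s t * f t = \sum_s f s.
Proof.
under eq_bigr do rewrite sum_gibbs_sampler.
rewrite -mulr_sumr exchange_big /=.
under eq_bigr do rewrite (sum_cmeanT (eqv _)).
by rewrite sumr_const -(mulr_natr (\sum_s f s)) -/n mulrCA mulVf ?mulr1 // gt_eqF.
Qed.

Let lawS x k s : law x k.+1 s = \sum_t gibbs_sampler s t * law x k t.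
Proof. by apply: eq_bigr => t _; rewrite mulrC gibbs_samplerC. Qed.

(** As the chain is symmetric, laws evolve by the operator that acts on functions, and
    [sampler_contracts] applies to the deviation from uniform, whose squared norm is at most 1
    initially. *)
Lemma step_dist_decay (x : T) k :
  \sum_s law x k s = 1 /\
  \sum_s (law x k s - N^-1) ^+ 2 <= expR (- (k%:R / (Gam * n))).
Proof.
have N0 : 0 < N by rewrite ltr0n; apply/card_gt0P; exists x.
elim: k => [|k [sum1 IH]].
  have s1 : \sum_s (x == s)%:R = 1 :> R.
    rewrite (bigD1 x) //= eqxx big1 ?addr0 // => s /negbTE.
    by rewrite eq_sym => ->.
  split=> //; rewrite mul0r oppr0 expR0.
  have -> : \sum_s (law x 0 s - N^-1) ^+ 2 =
      cvar (agree_off [set: V]) (fun s => (x == s)%:R : R).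
    by apply: eq_bigr => s _; rewrite cmeanT s1 mul1r.
  apply: (le_trans (cvar_le_sqr (eqv _) _)).
  rewrite le_eqVlt; apply/orP; left; apply/eqP; rewrite -[RHS]s1.
  by apply: eq_bigr => s _; case: (x == s); rewrite ?expr1n ?expr0n.
have sum1' : \sum_s law x k.+1 s = 1.
  by under eq_bigr do rewrite lawS; rewrite sum_gibbs_sampler_cst.
split=> //.
pose f s := law x k s - N^-1.
have f0 : \sum_s f s = 0.
  by rewrite sumrB sum1 sumr_const -(mulr_natr N^-1) mulVf ?subrr // gt_eqF.
have row1 s : \sum_t gibbs_sampler s t = 1 :> R.
  transitivity (\sum_t gibbs_sampler s t * (1 : R)).
    by apply: eq_bigr => t _; rewrite mulr1.
  rewrite sum_gibbs_sampler (eq_bigr (fun=> 1)) => [|v _]; last exact: cmean_const.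
  by rewrite sumr_const mulVf // gt_eqF.
have -> : \sum_s (law x k.+1 s - N^-1) ^+ 2 =
    \sum_s (\sum_t gibbs_sampler s t * f t) ^+ 2.
  apply: eq_bigr => s _; congr (_ ^+ 2); rewrite lawS /f.
  under [RHS]eq_bigr do rewrite mulrBr.
  by rewrite sumrB -mulr_suml row1 mul1r.
apply: (le_trans (sampler_contracts f0)).
have S0 : 0 <= \sum_s f s ^+ 2 by apply: sumr_ge0 => s _; apply: sqr_ge0.
have -> : - (k.+1%:R / (Gam * n)) = - (Gam * n)^-1 - k%:R / (Gam * n).
  by rewrite -natr1; ring.
rewrite expRD.
apply: (@le_trans _ _ (expR (- (Gam * n)^-1) * \sum_s f s ^+ 2)).
  by rewrite ler_wpM2r //; apply: expR_ge1Dx.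
by rewrite ler_wpM2l ?expR_ge0.
Qed.

(** There are at most [q ^ #|V|] colorings; the bound on [k] lets the decay beat this factor by
    [expR (- 2)], whose square root is the required [expR (-1)]. *)
Lemma tv_distance_decay (x : T) k : (0 < q)%N ->
  Gam * n * (n * ln q%:R + 2) <= k%:R ->
  tv_distance (law x k) (@coloring_dist R V e q) <= (2 * expR 1)^-1.
Proof.
move=> q0 kle.
have N0 : 0 < N by rewrite ltr0n; apply/card_gt0P; exists x.
have Nq : N <= expR (n * ln q%:R).
  rewrite expRM_natl lnK ?posrE ?ltr0n // -natrX ler_nat.
  rewrite card_sub; apply: leq_trans (max_card _) _.
  by rewrite card_ffun card_ord.
pose f s := law x k s - N^-1.
have [_ decay] := step_dist_decay x k.
(* The Cauchy-Schwarz inequality, read off from the contraction of the mean over all colorings. *)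
have l1 : (\sum_s `|f s|) ^+ 2 <= N * \sum_s f s ^+ 2.
  have := sqr_cmean_le (eqv [set: V]) (fun s => `|f s|).
  rewrite (eq_bigr (fun=> ((\sum_s `|f s|) / N) ^+ 2)) => [|s _]; last by rewrite cmeanT.
  rewrite sumr_const -[leLHS]mulr_natl -/N expr_div_n expr2 invfM.
  have -> : \sum_s `|f s| ^+ 2 = \sum_s f s ^+ 2.
    by apply: eq_bigr => s _; rewrite real_normK ?num_real.
  move=> h; rewrite -ler_pdivrMl //; apply: le_trans h.
  rewrite le_eqVlt; apply/orP; left; apply/eqP; move: (\sum_s _) => A.
  by field; rewrite gt_eqF.
have l1e : \sum_s `|f s| <= expR (-1).
  rewrite -(@ler_pXn2r _ 2) ?nnegrE ?expR_ge0 ?sumr_ge0 //.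
  apply: (le_trans l1); apply: (@le_trans _ _
      (expR (n * ln q%:R) * expR (- (k%:R / (Gam * n))))).
    apply: ler_pM => //.
    by apply: sumr_ge0 => s _; apply: sqr_ge0.
  rewrite -expRD -expRM_natl ler_expR mulrN mulr1.
  have : n * ln q%:R + 2 <= k%:R / (Gam * n).
    by rewrite ler_pdivlMr ?mulr_gt0 // mulrC.
  lra.
rewrite /tv_distance invfM ler_wpM2l ?invr_ge0 // -expRN.
exact: l1e.
Qed.

Lemma mixing_time_le (k : nat) : (0 < q)%N -> Gam * n * (n * ln q%:R + 2) <= k%:R ->
  (mixing_time (@gibbs_sampler R V e q) (@coloring_dist R V e q) <= (k%:R)%:E)%E.
Proof.
move=> q0 kle; apply: ereal_inf_lbound => /=; exists k => // x.
exact: tv_distance_decay.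
Qed.

End Decay.
End Mixing.

(** * Choice of the parameters *)

Section SpreadBound.
Context {V : finType} {R : realType}.
Variables (e : rel V) (q d : nat) (a b : R).
Hypothesis b0 : 0 <= b.
Let deg u : R := #|nbhd e u [set: V]|%:R.
Let trans u : R := transmission (q := q) e d u.
Hypothesis trans_le : forall u, trans u <= b * expR (a * deg u).
Hypothesis trans_deg_le : forall u, trans u * deg u <= b * expR (a * deg u).

(** There are at most [deg w] continuations from [w], and [trans_deg_le] charges their number
    together with the transmission to [b * expR (a * deg w)]. The exponents add up along a path,
    where [M] bounds them. *)
Lemma spread_le k (S : {set V}) w (M : R) : w \in S ->
  (forall p, path e w p -> uniq (w :: p) -> {subset w :: p <= S} ->
     (size p <= k)%N -> \sum_(u <- w :: p) a * deg u <= M) ->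
  spread (q := q) e d k S w <= b ^+ k.+1 * expR M.
Proof.
elim: k S w M => [|k IH] S w M wS paths.
  rewrite /= mulr1 expr1; apply: (le_trans (trans_le w)).
  rewrite ler_wpM2l // ler_expR.
  have := paths [::] isT isT; rewrite big_seq1; apply=> //.
  by move=> u; rewrite inE => /eqP->.
rewrite [leLHS]/=.
have le y : y \in nbhd e w (S :\ w) ->
    spread (q := q) e d k (S :\ w) y <= b ^+ k.+1 * expR (M - a * deg w).
  rewrite in_nbhd => /andP[yS wy]; apply: IH => // p yp unq sub pk.
  have wN : w \notin y :: p by apply/negP => /sub; rewrite !inE eqxx.
  have := paths (y :: p); rewrite big_cons lerBrDl => -> //.
  - by rewrite /= wy.
  - by rewrite cons_uniq wN.
  - by move=> u; rewrite inE => /orP[/eqP->//|/sub]; rewrite !inE => /andP[].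
have nonneg : 0 <= b ^+ k.+1 * expR (M - a * deg w).
  by rewrite mulr_ge0 ?expR_ge0 ?exprn_ge0.
apply: (@le_trans _ _ (trans w * (deg w * (b ^+ k.+1 * expR (M - a * deg w))))).
  rewrite ler_wpM2l ?transmission_ge0 //; apply: le_trans (ler_sum _ le) _.
  rewrite sumr_const -[leLHS]mulr_natl ler_wpM2r // ler_nat.
  apply/subset_leq_card/subsetP => y; rewrite !in_nbhd in_setT.
  by move=> /andP[_ ->].
rewrite mulrA; apply: (le_trans (ler_wpM2r nonneg (trans_deg_le w))).
by rewrite mulrACA -exprS -expRD addrC subrK.
Qed.

End SpreadBound.

Lemma expR_ge_sqr (R : realType) (x : R) : 0 <= x -> x ^+ 2 / 4 <= expR x.
Proof.
move=> x0; have -> : x = 2%:R * (x / 2) by field.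
rewrite expRM_natl; have : 1 + x / 2 <= expR (x / 2) by apply: expR_ge1Dx.
have -> : (2%:R * (x / 2)) ^+ 2 / 4 = (x / 2) ^+ 2 by field.
by move=> h; rewrite lerXn2r ?nnegrE ?expR_ge0 ?divr_ge0 //; lra.
Qed.

(** * The Poincare inequality on the whole graph *)

Section Assembly.
Context {R : realType} {V : finType}.
Variables (e : rel V) (q d T0 : nat) (a a1 delta : R).
Hypotheses (e_sym : symmetric e) (e_irr : irreflexive e).
Hypotheses (a_gt0 : 0 < a) (a1_gt0 : 0 < a1) (a1_le1 : a1 <= 1) (delta_gt0 : 0 < delta).
(** Raised to the power [a / 2 * L], this is [#|V|] to the power [- (delta + 6)]: the path weights
    cost [delta], and 6 remains. *)
Let b : R := expR (- (2 / a * (delta + 6))).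
Hypothesis d_large : 4 / (b * a1 ^+ 2) <= d%:R.
Hypothesis d_large' : 2 * delta / a <= a1 * d%:R.
Hypothesis q_large_trans : 2 * d%:R * (d%:R + 1) <= b * q%:R.
Hypothesis q_large_list :
  2 * T0.+1%:R <= a1 * ((q%:R : R) - (d + 2 * T0.+1 + 2)%:R).
Hypothesis q_gt : (2 * d <= q)%N.
Hypothesis q_gt0 : (0 < q)%N.
Hypothesis card_gt1 : (1 < #|V|)%N.
Let L : R := ln #|V|%:R.
Let l := Num.truncn (a * L).
Let r := Num.truncn (a / 2 * L).
Let W u : R := \sum_(v | v != u) dist_weight e a1 u v.
Hypothesis ball_excess : forall v,
  (n_edges e (nat_ball e v l) + 1 <= #|nat_ball e v l| + T0)%N.
Hypothesis W_paths : forall p, sorted e p -> uniq p -> (size p <= l.+1)%N ->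
  \sum_(u <- p) W u <= delta * L.

Let deg u : R := #|nbhd e u [set: V]|%:R.

Let L_gt0 : 0 < L. Proof. by rewrite ln_gt0 // ltr1n. Qed.

Let l_itv : l%:R <= a * L < l.+1%:R.
Proof. by apply: truncn_itv; rewrite mulr_ge0 ?(ltW a_gt0) ?(ltW L_gt0). Qed.

Let r_itv : r%:R <= a / 2 * L < r.+1%:R.
Proof. by apply: truncn_itv; rewrite !mulr_ge0 ?(ltW a_gt0) ?(ltW L_gt0). Qed.

Let half_le : a / 2 * L <= a * L.
Proof.
by apply: ler_wpM2r; [exact: ltW|rewrite ler_pdivrMr // ler_pMr // ler1n].
Qed.

Let r_le_l : (r <= l)%N.
Proof.
rewrite truncn_ge_nat ?mulr_ge0 ?(ltW a_gt0) ?(ltW L_gt0) //.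
by case/andP: r_itv => /le_trans ->.
Qed.

Let b_gt0 : 0 < b. Proof. exact: expR_gt0. Qed.

Let deg_W u : a1 * deg u <= W u.
Proof.
rewrite /deg mulr_natr -sumr_const /W.
rewrite big_mkcond [leRHS]big_mkcond; apply: ler_sum => v _.
rewrite in_nbhd inE /=; case uv: (e u v); last first.
  by case: ifP => // _; apply: dist_weight_ge0; apply: ltW.
have -> : v != u by apply: contraTneq uv => ->; rewrite e_irr.
have := dist_weight_edge (ltW a1_gt0) a1_le1 v uv.
by rewrite dist_weight_refl mulr1.
Qed.

(** A vertex of degree above [d] has weight [W] at least [2 * delta / a], so a path of weight at
    most [delta * L] has at most [a / 2 * L] of them; this and [r] add up to at most [l]. *)
Let high_size p : sorted e p -> uniq p -> all (high_degree e d) p ->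
  (size p <= l - r)%N.
Proof.
move=> sp up hp.
have high_W u : high_degree e d u -> 2 * delta / a <= W u.
  move=> hu; apply: (le_trans d_large'); apply: le_trans (deg_W u).
  by rewrite ler_wpM2l ?(ltW a1_gt0) // ler_nat ltnW.
(* The weight bound covers only [l.+1] vertices, so it is applied to an initial segment; that
   segment proves shorter than [l.+1], so nothing was cut off. *)
have h : (size (take l.+1 p))%:R <= a / 2 * L.
  have : \sum_(u <- take l.+1 p) (2 * delta / a) <= delta * L.
    apply: le_trans (W_paths (take_sorted _ sp) (take_uniq _ up) _).
      rewrite big_seq [leRHS]big_seq; apply: ler_sum => u /mem_take up'.
      by apply: high_W; apply: (allP hp).
    by rewrite size_take; case: ltnP.
  rewrite big_const_seq count_predT iter_addr_0 -(mulr_natr (2 * delta / a)).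
  have -> : delta * L = (2 * delta / a) * (a / 2 * L) by field; rewrite gt_eqF.
  by rewrite ler_pM2l // !mulr_gt0 // invr_gt0.
move: h; rewrite size_take; case: ltnP => [lp|lp] h.
  by have := le_trans h half_le; case/andP: l_itv => _ /lt_le_trans/[apply]; rewrite ltxx.
rewrite leq_subRL //.
rewrite truncn_ge_nat ?mulr_ge0 ?(ltW a_gt0) ?(ltW L_gt0) // natrD.
by case/andP: r_itv => r1 _; lra.
Qed.

Let blk x := block e d r x.

Let blk_ball x : blk x \subset nat_ball e x l.
Proof.
apply: (@block_nat_ball _ _ _ _ (l - r)); first exact: high_size.
by rewrite subnKC.
Qed.

Let blk_excess x : excess_le e (blk x) T0.
Proof.
apply: (excess_le_sub (blk_ball x)); apply: excess_le_connected => //.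
exact: nat_ball_connected.
Qed.

Let c1 : R := 4 * (2 ^+ T0 / a1).
Let om u : R := ln 3 + c1 * W u.

Let om_ge x n (S : {set V}) u : S \subset blk x -> u \in S ->
  ln 3 + 4 * \sum_(w in nbhd e u (S :\ u)) saw_total e a1 n (S :\ u) w <= om u.
Proof.
move=> SB uS; rewrite /om lerD2l /c1 -!mulrA ler_wpM2l //.
rewrite [_^-1 * _]mulrC mulrA ler_pdivlMr // [leLHS]mulrC.
have SE := excess_le_sub SB (@blk_excess x).
exact: (saw_total_nbhd e_sym e_irr (ltW a1_gt0) a1_le1 _ uS SE).
Qed.

Let ln3_ge0 : 0 <= ln 3 :> R. Proof. by rewrite ln_ge0 // ler1n. Qed.

Let c1_ge0 : 0 <= c1.
Proof. by rewrite !mulr_ge0 ?invr_ge0 ?exprn_ge0 ?(ltW a1_gt0). Qed.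

(** A self-avoiding path in a block has at most [2 * T0.+1 * l.+1] vertices, hence consists of
    [2 * T0.+1] pieces covered by [W_paths]. *)
Let m : R := (2 * T0.+1)%:R * ((a * L + 1) * ln 3) + c1 * ((2 * T0.+1)%:R * (delta * L)).

Let om_paths x p : path e x p -> uniq (x :: p) -> {subset x :: p <= blk x} ->
  \sum_(w <- x :: p) om w <= m.
Proof.
move=> xp up sub.
have sz : (size (x :: p) <= 2 * T0.+1 * l.+1)%N.
  apply: (self_avoiding_size e_sym e_irr (ball_excess x)) => //.
  by move=> u /sub; apply: (subsetP (blk_ball x)).
rewrite big_split -mulr_sumr /=; apply: lerD; last first.
  by rewrite ler_wpM2l //; apply: path_sum_le W_paths _ _ _ _ sz.
rewrite big_const_seq count_predT iter_addr_0 -(mulr_natl (ln 3)) mulrA ler_wpM2r //.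
apply: (@le_trans _ _ (2 * T0.+1 * l.+1)%:R); first by rewrite ler_nat.
rewrite natrM ler_wpM2l // -natr1 lerD2r.
by case/andP: l_itv.
Qed.

Local Notation T := (proper_coloring e q).

Let local_poincare x (f : T -> R) :
  cvar (agree_off (blk x)) f <= expR m * \sum_w cvar (agree_off [set w]) f.
Proof.
have := @block_poincare V q R e a1 (blk x) d T0 om e_sym e_irr a1_gt0
  (@blk_excess x) q_large_list _ (@om_ge x) x m f (block_refl _ _ _ _) _ (@om_paths x).
move=> /(_ (@block_boundary _ _ _ _ _) (@block_connected _ _ e_sym _ _ _)) h.
apply: (le_trans h); rewrite ler_wpM2l ?expR_ge0 //.
rewrite [leLHS]big_mkcond; apply: ler_sum => w _; case: ifP => // _.
exact: cvar_ge0.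
Qed.

Let trans u : R := transmission (q := q) e d u.

(** At degree up to [d] this is the lower bound on [q]; above [d], the exponential dominates a
    square, and [d_large] makes the square exceed the degree. *)
Let trans_le u : trans u <= b * expR (a1 * deg u) /\
  trans u * deg u <= b * expR (a1 * deg u).
Proof.
have e1 : 1 <= expR (a1 * deg u).
  by rewrite -expR0 ler_expR mulr_ge0 // ltW.
have q0 : 0 < q%:R :> R by rewrite ltr0n.
rewrite /trans /transmission; case: ifPn => [ud|].
  have tb : (2 * d)%:R / q%:R * (d%:R + 1) <= b.
    by rewrite mulrAC ler_pdivrMr // natrM.
  have t0 : 0 <= (2 * d)%:R / q%:R :> R by rewrite divr_ge0.
  have bb : b <= b * expR (a1 * deg u) by rewrite ler_peMr // ltW.
  have degd : deg u <= d%:R by rewrite ler_nat.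
  have d0 : 0 <= d%:R :> R by [].
  split; apply: le_trans bb; apply: le_trans tb.
    by rewrite ler_peMr //; lra.
  by rewrite ler_wpM2l //; lra.
rewrite -ltnNge => ud; rewrite !mul1r.
have du : d%:R <= deg u by rewrite ler_nat ltnW.
have deg1 : 1 <= deg u by rewrite ler1n (leq_ltn_trans _ ud).
suff H : deg u <= b * expR (a1 * deg u) by split=> //; apply: le_trans H.
apply: (@le_trans _ _ (b * ((a1 * deg u) ^+ 2 / 4))); last first.
  by rewrite ler_wpM2l ?(ltW b_gt0) // expR_ge_sqr // mulr_ge0 // ltW.
have : 4 / (b * a1 ^+ 2) <= deg u by apply: le_trans du.
rewrite ler_pdivrMr ?mulr_gt0 ?exprn_gt0 // => h.
have -> : b * ((a1 * deg u) ^+ 2 / 4) = deg u * (deg u * (b * a1 ^+ 2)) / 4.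
  by field.
by rewrite ler_pdivlMr // ler_wpM2l // (le_trans _ deg1).
Qed.

Let nR : R := #|V|%:R.
Let expL : expR L = nR.
Proof. by rewrite lnK // posrE ltr0n ltnW. Qed.

Let eps : R := expR (- (5 * L)).

Let spread_eps x (S : {set V}) :
  \sum_(w in nbhd e x S) spread (q := q) e d r S w <= eps.
Proof.
have bound w : w \in nbhd e x S ->
    spread (q := q) e d r S w <= expR (- (6 * L)).
  rewrite in_nbhd => /andP[wS _].
  apply: (@le_trans _ _ (b ^+ r.+1 * expR (delta * L))).
    apply: (spread_le (ltW b_gt0) (fun u => (trans_le u).1)
      (fun u => (trans_le u).2) wS) => p wp up _ pr.
    apply: (@le_trans _ _ (\sum_(u <- w :: p) W u)).
      by apply: ler_sum => u _; apply: deg_W.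
    by apply: W_paths => //; rewrite ltnS; apply: leq_trans pr r_le_l.
  rewrite -expRM_natl -expRD ler_expR.
  have : a / 2 * L <= r.+1%:R by case/andP: r_itv => _ /ltW.
  have c0 : 0 <= 2 / a * (delta + 6).
    by rewrite !mulr_ge0 ?invr_ge0 ?(ltW a_gt0) // addr_ge0 // ltW.
  move=> /(ler_wpM2r c0).
  have -> : a / 2 * L * (2 / a * (delta + 6)) = delta * L + 6 * L.
    by field; rewrite gt_eqF.
  lra.
apply: le_trans (ler_sum _ bound) _; rewrite sumr_const -(mulr_natl (expR _)).
apply: (@le_trans _ _ (nR * expR (- (6 * L)))).
  by rewrite ler_wpM2r ?expR_ge0 // ler_nat max_card.
rewrite -expL -expRD ler_expR; lra.
Qed.

Let eps_small : 8 * eps * nR <= 1.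
Proof.
rewrite /eps -expL -mulrA -expRD.
have -> : - (5 * L) + L = - (4%:R * L) by ring.
rewrite expRN expRM_natl expL ler_pdivrMr ?exprn_gt0 ?ltr0n ?(ltnW card_gt1) // mul1r.
have n2 : 2 <= nR by rewrite ler_nat.
apply: (@le_trans _ _ (2 ^+ 4)); first by rewrite -natrX ler_nat.
by rewrite lerXn2r // nnegrE; lra.
Qed.

(** The factor [nR] comes from extending the local sum of each of the [nR] blocks to all
    vertices. *)
Lemma gibbs_poincare (f : T -> R) : cvar (agree_off [set: V]) f <=
  (4 * (nR * expR m)) * \sum_w cvar (agree_off [set w]) f.
Proof.
have := @cvar_blocks V q R e d e_sym e_irr q_gt q_gt0 blk (nat_ball e) r eps
  (fun x => nat_ball_refl e x 0) _ _ (expR_gt0 _) spread_eps f eps_small.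
move=> /(_ (@nat_ball_step _ _) (fun x j u => @nat_ball_block _ _ _ _ x j u)) h.
apply: (le_trans h); rewrite -mulrA ler_wpM2l // -mulrA.
apply: le_trans (ler_sum _ (fun x _ => local_poincare x f)) _.
by rewrite sumr_const -(mulr_natl (expR m * _)).
Qed.

End Assembly.

Theorem theorem2 (R : realType) (a alpha t delta : R)
    (ha : 0 < a) (halpha : 0 < alpha) (ht : 0 < t) (hdelta : 0 < delta) :
  exists (q0 : nat) (C : R),
  forall q : nat, (q0 <= q)%N ->
  exists K : R,
  forall (V : finType) (e : rel V), symmetric e -> irreflexive e ->
    (forall v : V,
       (ball_tree_excess e v (a * ln (#|V|%:R : R)))%:~R <= t) ->
    max_path_weight e alpha (a * ln (#|V|%:R : R)) < delta * ln (#|V|%:R : R) ->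
    (mixing_time (@gibbs_sampler R V e q) (@coloring_dist R V e q)
       <= (K * (#|V|%:R : R) `^ C)%:E)%E.
Proof.
(* Distance weights grow with the base, so the path bound passes to [a1], and [a1 <= 1] allows
   [dist_weight_edge]. *)
pose a1 := Num.min alpha 1.
have a1_gt0 : 0 < a1 by rewrite lt_min halpha ltr01.
have a1_le1 : a1 <= 1 by rewrite ge_min lexx orbT.
have a1_alpha : a1 <= alpha by rewrite ge_min lexx.
pose T0 := (Num.truncn t).+1.
have tT0 : t <= T0%:R by apply/ltW/truncnS_gt.
pose b : R := expR (- (2 / a * (delta + 6))).
have b_gt0 : 0 < b by apply: expR_gt0.
(* One summand lets the exponential of a degree above [d] beat that degree, the other makes
   high-degree vertices rare on paths. *)
pose dR : R := 4 / (b * a1 ^+ 2) + 2 * delta / a / a1.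
pose d := (Num.truncn dR).+1.
have d_dR : dR <= d%:R by apply/ltW/truncnS_gt.
have d1_ge0 : 0 <= 4 / (b * a1 ^+ 2).
  by rewrite divr_ge0 // mulr_ge0 ?exprn_ge0 ?ltW.
have d2_ge0 : 0 <= 2 * delta / a / a1.
  by rewrite !mulr_ge0 ?invr_ge0 ?ltW.
have d_large : 4 / (b * a1 ^+ 2) <= d%:R by rewrite (le_trans _ d_dR) // lerDl.
have d_large' : 2 * delta / a <= a1 * d%:R.
  by rewrite [leRHS]mulrC -ler_pdivrMr // (le_trans _ d_dR) // lerDr.
(* [q1] keeps the transmission small, [q2] the lists long. *)
pose q1 : R := 2 * d%:R * (d%:R + 1) / b.
pose q2 : R := 2 * T0.+1%:R / a1 + (d + 2 * T0.+1 + 2)%:R.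
pose q0 := ((Num.truncn q1).+1 + (Num.truncn q2).+1 + 2 * d)%N.
pose c1 : R := 4 * (2 ^+ T0 / a1).
pose E0 : R := (2 * T0.+1)%:R * ln 3.
pose E1 : R := (2 * T0.+1)%:R * (a * ln 3) + c1 * ((2 * T0.+1)%:R * delta).
(* The exponent [m] equals [E0 + E1 * L], so [Gam] is of order [n ^ (E1 + 1)]; the number of steps
   [Gam * n * (n * ln q%:R + 2)] adds two powers. *)
exists q0, (E1 + 3) => q q0q.
have q1q : q1 <= q%:R.
  apply: (@le_trans _ _ (Num.truncn q1).+1%:R); first exact/ltW/truncnS_gt.
  by rewrite ler_nat (leq_trans _ q0q) // /q0 -addnA leq_addr.
have q2q : q2 <= q%:R.
  apply: (@le_trans _ _ (Num.truncn q2).+1%:R); first exact/ltW/truncnS_gt.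
  by rewrite ler_nat (leq_trans _ q0q) // /q0 addnAC leq_addl.
have q_gt : (2 * d <= q)%N by rewrite (leq_trans _ q0q) // leq_addl.
have q_gt0 : (0 < q)%N by rewrite (leq_trans _ q0q) // /q0 !addSn.
have q_trans : 2 * d%:R * (d%:R + 1) <= b * q%:R.
  by rewrite [leRHS]mulrC -ler_pdivrMr.
have q_list : 2 * T0.+1%:R <= a1 * ((q%:R : R) - (d + 2 * T0.+1 + 2)%:R).
  by rewrite [leRHS]mulrC -ler_pdivrMr // lerBrDr.
(* The final [+ 1] pays for rounding the number of steps up to an integer. *)
exists (4 * expR E0 * (ln q%:R + 2) + 1) => V e e_sym e_irr excess weight.
set L := ln #|V|%:R in excess weight *.
(* The maximal weight is nonnegative, so the strict weight hypothesis excludes graphs with at most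
   one vertex. *)
have L_gt0 : 0 < L.
  rewrite -(pmulr_rgt0 _ hdelta); apply: le_lt_trans weight.
  by rewrite /max_path_weight; apply: bigmax_ge_id.
have card_gt1 : (1 < #|V|)%N.
  rewrite ltnNge; apply/negP => V1; move: L_gt0; rewrite /L ltNge => /negP; apply.
  by apply: ln_le0; rewrite lern1.
have aL0 : 0 <= a * L by rewrite mulr_ge0 ?ltW.
have W_paths p : sorted e p -> uniq p -> (size p <= (Num.truncn (a * L)).+1)%N ->
    \sum_(u <- p) \sum_(v | v != u) dist_weight e a1 u v <= delta * L.
  move=> sp up ps; apply: ltW; apply: le_lt_trans weight.
  apply: (@le_trans _ _ (path_weight e alpha p)); last first.
    apply: path_weight_le_max => //; rewrite -truncn_ge_nat //.
    by case: (size p) ps.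
  apply: ler_sum => u _; apply: ler_sum => v _.
  exact/dist_weight_mono/a1_alpha/ltW.
have ball_excess v : (n_edges e (nat_ball e v (Num.truncn (a * L))) + 1 <=
    #|nat_ball e v (Num.truncn (a * L))| + T0)%N.
  exact: ball_tree_excess_le e_sym aL0 tT0 (excess v).
have poincare := gibbs_poincare e_sym e_irr ha a1_gt0 a1_le1 hdelta d_large
  d_large' q_trans q_list q_gt q_gt0 card_gt1 ball_excess W_paths.
rewrite -/L in poincare.
set m := (2 * T0.+1)%:R * _ + _ in poincare.
have mE : m = E0 + E1 * L by rewrite /m /E0 /E1 /c1; ring.
set n : R := #|V|%:R in poincare *.
have n_gt0 : 0 < n by rewrite ltr0n ltnW.
pose Gam := 4 * (n * expR m).
have Gam_gt0 : 0 < Gam by rewrite !mulr_gt0 ?expR_gt0.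
pose X := Gam * n * (n * ln q%:R + 2).
have lnq : 0 <= ln q%:R :> R by rewrite ln_ge0 // ler1n.
have X0 : 0 <= X.
  apply: mulr_ge0; first exact/ltW/mulr_gt0.
  by rewrite addr_ge0 // mulr_ge0 // ltW.
pose k := (Num.truncn X).+1.
have Xk : X <= k%:R by apply/ltW/truncnS_gt.
have kX : k%:R <= X + 1 by rewrite -natr1 lerD2r truncn_le.
apply: le_trans (mixing_time_le e_sym e_irr (ltnW card_gt1) Gam_gt0 poincare q_gt0 Xk) _.
rewrite lee_fin; apply: (le_trans kX).
have nC : n `^ (E1 + 3) = expR (E1 * L) * n ^+ 3.
  rewrite /powR gt_eqF // -/L mulrDl expRD; congr (_ * _).
  by rewrite expRM_natl lnK ?posrE.
have n1 : 1 <= n by rewrite ler1n ltnW.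
have E1_ge0 : 0 <= E1.
  rewrite addr_ge0 // !mulr_ge0 ?ln_ge0 ?ler1n ?invr_ge0 ?exprn_ge0 //; exact: ltW.
have pow1 : 1 <= n `^ (E1 + 3).
  rewrite nC mulr_ege1 ?exprn_ege1 //.
  by rewrite -expR0 ler_expR mulr_ge0 // ltW.
rewrite mulrDl mul1r lerD // nC /X /Gam mE expRD.
have -> : 4 * (n * (expR E0 * expR (E1 * L))) * n * (n * ln q%:R + 2) =
  4 * expR E0 * expR (E1 * L) * n ^+ 2 * (n * ln q%:R + 2) by ring.
have -> : 4 * expR E0 * (ln q%:R + 2) * (expR (E1 * L) * n ^+ 3) =
  4 * expR E0 * expR (E1 * L) * n ^+ 2 * (n * ln q%:R + n * 2) by ring.
rewrite ler_wpM2l ?lerD2l ?ler_peMl //.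
by rewrite !mulr_ge0 ?expR_ge0 ?exprn_ge0 // ltW.
Qed.
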